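(* Let $\phi:[c]^v\to\mathbb R$ be an arbitrary function, and let $\{Q_n\}_{n\ge1}$ be a sequence of symmetric, zero-diagonal $v$-tensors such that $\|W_{Q_n}-W_\infty\|_{\square^*}\to 0$ as $n\to\infty$, for some $W_\infty\in\mathcal W_v$. Then the following hold. (i) Let $\mathbf X=(X_1,\ldots,X_n)$ with $X_i$ i.i.d. from $\mu$. Then $N_n(Q_n,\phi,\mathbf X)$ satisfies a large deviation principle with speed $n$ and the good rate function $$J_{W_\infty}(t):=\inf_{\boldsymbol f\in\mathcal F_c:\ G_{W_\infty,\phi}(\boldsymbol f)=t}\left\{\int_0^1\sum_{r=1}^c f_r(u)\log\frac{f_r(u)}{\mu_r}\,du\right\}.$$ (ii) For any $\beta\in\mathbb R$, $$\lim_{n\to\infty}Z_{Q_n}(\beta,\mu)=\sup_{\boldsymbol f\in\mathcal F_c}\left\{\beta\, G_{W_\infty,\phi}(\boldsymbol f)-\int_0^1\sum_{r=1}^c f_r(u)\log\frac{f_r(u)}{\mu_r}\,du\right\}.$$ Moreover, the supremum on the right-hand side is attained.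
   Context: Integers $c,v\ge2$ are fixed, $[m]:=\{1,\ldots,m\}$, and $\mu$ is a probability measure on $[c]$ with $\mu_r:=\mu(\{r\})>0$ for all $r\in[c]$. A $v$-tensor $Q_n:[n]^v\to\mathbb R$ is symmetric if it is invariant under permutations of its arguments, and zero-diagonal if $Q_n(i_1,\ldots,i_v)=0$ whenever $i_1,\ldots,i_v$ are not all distinct. Define $$N_n(Q_n,\phi,\mathbf X):=\frac1{n^v}\sum_{i_1,\ldots,i_v=1}^n Q_n(i_1,\ldots,i_v)\,\phi(X_{i_1},\ldots,X_{i_v}),\qquad Z_{Q_n}(\beta,\mu):=\frac1n\log\mathbb E_{\mu^{\otimes n}}\exp\big(n\beta N_n(Q_n,\phi,\mathbf X)\big).$$ $\mathcal W_v$ is the space of symmetric real-valued functions in $L^1([0,1]^v)$. For a symmetric zero-diagonal tensor $Q_n$, $W_{Q_n}\in\mathcal W_v$ is the step function $W_{Q_n}(x_1,\ldots,x_v):=Q_n(i_1,\ldots,i_v)$ if $\max\{\lceil nx_r\rceil,1\}=i_r$ for all $r\in[v]$. For $W\in\mathcal W_v$, $\|W\|_{\square^*}:=\sup_{S\subseteq[0,1]}\left|\int_{S^v}W(x_1,\ldots,x_v)\prod_{i}dx_i\right|$ (supremum over measurable $S$). $\mathcal F_c$ is the set of measurable $\boldsymbol f=(f_1,\ldots,f_c):[0,1]\to[0,1]^c$ with $\sum_{r=1}^c f_r(x)=1$ for all $x$ (modulo a.e. equality). For $W\in\mathcal W_v$, $$G_{W,\phi}(\boldsymbol f):=\int_{[0,1]^v}W(x_1,\ldots,x_v)\sum_{r_1,\ldots,r_v\in[c]}\phi(r_1,\ldots,r_v)\prod_{a=1}^v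 f_{r_a}(x_a)\,dx_1\cdots dx_v.$$ Conventions: $0\log0=0$ and $\inf\emptyset=+\infty$. *)

(* Defs.v *)
From HB Require Import structures.
From mathcomp Require Import all_boot all_order all_algebra all_fingroup.
From mathcomp Require Import all_classical all_reals all_analysis.

Set Implicit Arguments.
Unset Strict Implicit.
Unset Printing Implicit Defensive.

Import Order.TTheory GRing.Theory Num.Theory.
Import numFieldNormedType.Exports.

Local Open Scope classical_set_scope.
Local Open Scope ring_scope.

(* [c] with c >= 2 is 'I_k.+2, c = k + 2: a measurableType is pointed, so the
   discrete sigma-algebra is only available on nonempty ordinals. *)
HB.instance Definition _ (k : nat) := isPointed.Build 'I_k.+1 ord0.
HB.instance Definition _ (k : nat) := @isMeasurable.Build default_measure_display
  'I_k.+1 discrete_measurable discrete_measurable0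
  discrete_measurableC discrete_measurableU.

Section power_measure.
Context d (T : measurableType d) (R : realType).
Variable m : {sigma_finite_measure set T -> \bar R}.

Section step.
Variables (n : nat) (M : {sigma_finite_measure set (n.-tuple T) -> \bar R}).

Definition consp (p : T * n.-tuple T) : n.+1.-tuple T := [tuple of p.1 :: p.2].

Lemma measurable_consp : measurable_fun setT consp.
Proof. exact: measurable_cons. Qed.

Definition power_measureS : set (n.+1.-tuple T) -> \bar R :=
  pushforward (m \x M)%E consp.

Let power0 : power_measureS set0 = 0%E.
Proof. by rewrite /power_measureS /pushforward preimage_set0 measure0. Qed.

Let power_ge0 A : (0 <= power_measureS A)%E.
Proof. exact: (measure_ge0 (m \x M)%E). Qed.

Let power_sigma_additive : semi_sigma_additive power_measureS.
Proof.
have mc := measurable_consp.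
exact: measure_semi_sigma_additive.
Qed.

HB.instance Definition _ := isMeasure.Build _ _ _ power_measureS
  power0 power_ge0 power_sigma_additive.

Let power_sigma_finite : sigma_finite setT power_measureS.
Proof.
have /sigma_finiteP[F [TF ndF Foo]] := sigma_finiteT m.
have /sigma_finiteP[G [TG ndG Goo]] := sigma_finiteT M.
pose u (t : n.+1.-tuple T) : T * n.-tuple T := (thead t, [tuple of behead t]).
have consK p : u (consp p) = p.
  by case: p => x t; congr pair; apply/val_inj.
have mu : measurable_fun setT u.
  by apply/measurable_fun_pair; [exact: measurable_tnth|exact: measurable_behead].
exists (fun k => u @^-1` (F k `*` G k)).
  rewrite -preimage_bigcup -(preimage_setT u); congr (_ @^-1` _).
  rewrite -setXTT TF TG predeqE => -[x y]; split.
    move=> [/= [i _ Fix] [j _ Gjy]]; exists (maxn i j) => //; split.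
    - by move: x Fix; exact/subsetPset/ndF/leq_maxl.
    - by move: y Gjy; exact/subsetPset/ndG/leq_maxr.
  by move=> [i _ []/= ? ?]; split; exists i.
move=> k; have [mFk Fk] := Foo k; have [mGk Gk] := Goo k; split.
  by rewrite -[X in measurable X]setTI; apply: mu => //; exact: measurableX.
rewrite /power_measureS /pushforward (_ : _ @^-1` _ = F k `*` G k).
  by rewrite product_measure1E// lte_mul_pinfty// ge0_fin_numE.
rewrite -comp_preimage (_ : u \o consp = id) ?preimage_id//.
exact/funext.
Qed.

HB.instance Definition _ := Measure_isSigmaFinite.Build _ _ _ power_measureS
  power_sigma_finite.

End step.

(* The n-fold product of m: power_measure_box gives its value on boxes. *)
Fixpoint power_measure n : {sigma_finite_measure set (n.-tuple T) -> \bar R} :=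
  if n isn't n'.+1 then \d_([tuple] : 0.-tuple T) else power_measureS (power_measure n').

End power_measure.

Notation "m ^\x n" := (power_measure m n) (at level 30) : ring_scope.

Lemma power_measure_box (R : realType) d (T : measurableType d)
    (m : {sigma_finite_measure set T -> \bar R}) n (A : 'I_n -> set T) :
  (forall i, measurable (A i)) ->
  measurable [set t : n.-tuple T | forall i, A i (tnth t i)] /\
  (m ^\x n) [set t | forall i, A i (tnth t i)] = (\prod_(i < n) m (A i))%E.
Proof.
move=> mA.
have mB : measurable [set t : n.-tuple T | forall i, A i (tnth t i)].
  rewrite (_ : mkset _ = \big[setI/setT]_(i < n) (fun t : n.-tuple T => tnth t i) @^-1` A i).
    by apply: bigsetI_measurable => i _; rewrite -[X in measurable X]setTI; exact: measurable_tnth.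
  by rewrite -bigcap_seq; apply/seteqP; split => [t h i _|t h i]; [exact: h|apply: h; rewrite /= mem_index_enum].
split=> //; elim: n A mA mB => [A mA _|n IH A mA mB].
  by rewrite big_ord0 /= diracE mem_set// => -[].
have mB' : measurable [set t : n.-tuple T | forall i, A (lift ord0 i) (tnth t i)].
  rewrite (_ : mkset _ = \big[setI/setT]_(i < n) (fun t : n.-tuple T => tnth t i) @^-1` A (lift ord0 i)).
    by apply: bigsetI_measurable => i _; rewrite -[X in measurable X]setTI; exact: measurable_tnth.
  by rewrite -bigcap_seq; apply/seteqP; split => [t h i _|t h i]; [exact: h|apply: h; rewrite /= mem_index_enum].
rewrite big_ord_recl -(IH (fun i => A (lift ord0 i)))// -product_measure1E//.
rewrite /= /power_measureS /pushforward; congr (_ _).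
apply/seteqP; split=> -[x t] /=.
  by move=> h; split; [exact: (h ord0)|move=> i; have := h (lift ord0 i); rewrite tnthS].
by move=> [hx ht] i; case: (unliftP ord0 i) => [j ->|->]; [rewrite tnthS|].
Qed.

Section large_deviations.
Local Open Scope ereal_scope.
Context {S : topologicalType} {R : realType}.

Definition good_rate_function (I : S -> \bar R) :=
  [/\ forall t, 0 <= I t,
      lower_semicontinuous I
    & forall a : R, compact [set t | I t <= a%:E]].

(* lne 0 = -oo, and ereal_inf set0 = +oo *)
Definition satisfies_LDP (law : nat -> set S -> \bar R) (speed : nat -> R)
    (I : S -> \bar R) :=
  (forall F, closed F ->
     limn_esup (fun n => (speed n)^-1%:E * lne (law n F)) <=
     - ereal_inf [set I t | t in F]) /\
  (forall U, open U ->
     - ereal_inf [set I t | t in U] <=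
     limn_einf (fun n => (speed n)^-1%:E * lne (law n U))).

End large_deviations.

Section iid.
Context d d' (Om : measurableType d) (T : measurableType d') (R : realType).
Context (P : probability Om R) (I : finType).

Definition mutually_independent (X : I -> {RV P >-> T}) :=
  forall (J : {set I}) (A : I -> set T), (forall i, measurable (A i)) ->
    P (\bigcap_(i in [set` J]) X i @^-1` A i) =
    (\prod_(i in J) P (X i @^-1` A i))%E.

Definition iid (mu : probability T R) (X : I -> {RV P >-> T}) :=
  mutually_independent X /\
  forall i A, measurable A -> distribution P (X i) A = mu A.

End iid.

Definition permute (T : Type) (v : nat) (s : 'S_v) (t : v.-tuple T) :
  v.-tuple T := [tuple tnth t (s a) | a < v].

Section tensors.
Context {R : realType} {v n : nat}.

Definition symmetric_tensor (Q : v.-tuple 'I_n -> R) :=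
  forall (s : 'S_v) i, Q (permute s i) = Q i.

Definition zero_diagonal (Q : v.-tuple 'I_n -> R) :=
  forall i : v.-tuple 'I_n, ~~ uniq i -> Q i = 0.

Definition Nstat (k : nat) (Q : v.-tuple 'I_n -> R) (phi : v.-tuple 'I_k -> R)
    (x : n.-tuple 'I_k) : R :=
  (n%:R ^+ v)^-1 *
  \sum_(i : v.-tuple 'I_n) Q i * phi [tuple tnth x (tnth i a) | a < v].

Definition logZ (k : nat) (Q : v.-tuple 'I_n -> R) (phi : v.-tuple 'I_k.+1 -> R)
    (mu : probability 'I_k.+1 R) (beta : R) : R :=
  n%:R^-1 * ln (\int[mu ^\x n]_x expR (n%:R * beta * Nstat Q phi x)).

(* 'I_n is 0-based, hence the successor. The default value 0 is only reached
   outside [0,1]^v, or when n = 0. *)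
Definition step_kernel (Q : v.-tuple 'I_n -> R) (x : v.-tuple R) : R :=
  if [pick i : v.-tuple 'I_n | [forall a,
        Num.max (Num.ceil (n%:R * tnth x a)) 1 == (tnth i a).+1%:Z]] is Some i
  then Q i else 0.

End tensors.

Section kernels.
Context {R : realType} {v : nat}.
Local Notation leb := (@lebesgue_measure R).
Local Notation I01 := (`[0 : R, 1 : R]%classic).

Definition setpow (S : set R) : set (v.-tuple R) :=
  [set x | forall a, S (tnth x a)].

(* W_v: elements of L^1 are classes mod a.e. equality, so symmetry is a.e. *)
Definition kernel_space (W : v.-tuple R -> R) :=
  (leb ^\x v).-integrable (setpow I01) (EFin \o W) /\
  forall s : 'S_v, {ae leb ^\x v, forall x,
    setpow I01 x -> W (permute s x) = W x}.

Definition cut_norm (W : v.-tuple R -> R) : \bar R :=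
  ereal_sup [set `|\int[leb ^\x v]_(x in setpow S) (W x)%:E|%E
            | S in [set S | measurable S /\ S `<=` I01]].

(* F_c: functions on R of which only the restriction to [0,1] is used *)
Definition fractional_coloring (k : nat) (f : 'I_k -> R -> R) :=
  (forall r, measurable_fun I01 (f r)) /\
  forall x, x \in `[0, 1] ->
    (forall r, f r x \in `[0, 1]) /\ \sum_(r < k) f r x = 1.

Definition Gfun (k : nat) (W : v.-tuple R -> R) (phi : v.-tuple 'I_k -> R)
    (f : 'I_k -> R -> R) : R :=
  \int[leb ^\x v]_(x in setpow I01)
    (W x * \sum_(r : v.-tuple 'I_k)
       phi r * \prod_(a < v) f (tnth r a) (tnth x a)).

End kernels.

Section rate.
Context {R : realType} {k : nat} (mu : probability 'I_k.+1 R).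

(* ln is total, so the factor f r u gives 0 log 0 = 0 *)
Definition rel_entropy (f : 'I_k.+1 -> R -> R) : R :=
  \int[@lebesgue_measure R]_(u in `[0 : R, 1 : R]%classic)
    (\sum_(r < k.+1) f r u * ln (f r u / fine (mu [set r]))).

Definition rateJ (v : nat) (W : v.-tuple R -> R) (phi : v.-tuple 'I_k.+1 -> R)
    (t : R) : \bar R :=
  ereal_inf [set (rel_entropy f)%:E
            | f in [set f | fractional_coloring f /\ Gfun W phi f = t]].

End rate.

(* Main.v *)
Require Import Defs.
From HB Require Import structures.
From mathcomp Require Import all_boot all_order all_algebra all_fingroup.
From mathcomp Require Import all_classical all_reals all_analysis.
From mathcomp Require Import measurable_realfun ring lra.

(* A coloring x of [n] is encoded by its empirical fractional coloring, a step
   function on [0,1]. The statistic N_n is the value of G at the empirical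
   coloring for the step kernel of Q_n, and polarization turns the convergence in
   the diagonal cut norm into N_n(x) = G_W(empirical x) + o(1) uniformly in x.
   Fractional colorings are weakly compact and G_W is weakly continuous, so it
   remains to prove a Sanov theorem for the empirical colorings in the weak
   topology. The upper bound is Chernoff's: with l = log (f / mu), the dual formula
   for the relative entropy gives mass at most exp (- n (H(f) - e)) near f, and
   compactness makes this global. The lower bound is a change of measure to
   independent colors whose laws are the cell averages of f: they concentrate at
   f, and their relative entropy is at most n H(f) by convexity. The sums
   over colorings x are then estimated near a maximizer (Laplace's method), and
   lower semicontinuity of H with compactness gives attainment and goodness. *)

Set Implicit Arguments.
Unset Strict Implicit.
Unset Printing Implicit Defensive.

Import Order.TTheory GRing.Theory Num.Theory.
Import numFieldNormedType.Exports.

Local Open Scope classical_set_scope.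
Local Open Scope ring_scope.

(** * Weak limits of functions with values in [0, 1] *)

(** Colorings are plain functions and carry no topology here. Weak convergence is a relation between
    a filter and a coloring, and compactness says that every ultrafilter of colorings has a weak
    limit; refining to an ultrafilter replaces the extraction of subsequences. Weak convergence
    controls linear functionals only, while G has degree v in f. It is still continuous because its
    v factors live on separate variables, so that integrals over boxes factor. The entropy is merely
    lower semicontinuous, which suffices for the upper bound, attainment and goodness; the lower
    bound needs approximations of f whose entropy is not larger, and sampling supplies them.
    Sampling serves a second time, for the kernels: a random union of cells approximates any
    function with values in [0, 1], so a bound over sets, which is all that the cut norm gives,
    extends to such functions. The entropy estimates all come from tangent lines, ln x <= x - 1 and
    1 + x <= exp x. *)

Section bounded_measurable.
Context d (T : measurableType d) (R : realType).
Implicit Types (D : set T) (f g : T -> R).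

(** Most integrands below are bounded and measurable. This class is closed under ring operations,
    and integrability on sets of finite measure is then automatic. *)
Definition bmfun D f :=
  measurable_fun D f /\ exists C, forall x, D x -> `|f x| <= C.

Lemma bmfun_cst D c : bmfun D (cst c).
Proof. by split; [exact: measurable_cst|exists `|c|]. Qed.

Lemma bmfunD D f g : bmfun D f -> bmfun D g -> bmfun D (fun x => f x + g x).
Proof.
move=> [mf [a fa]] [mg [b gb]]; split; first exact: measurable_funD.
by exists (a + b) => x Dx; rewrite (le_trans (ler_normD _ _))// lerD ?fa ?gb.
Qed.

Lemma bmfunM D f g : bmfun D f -> bmfun D g -> bmfun D (fun x => f x * g x).
Proof.
move=> [mf [a fa]] [mg [b gb]]; split; first exact: measurable_funM.
by exists (a * b) => x Dx; rewrite normrM ler_pM ?fa ?gb.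
Qed.

Lemma bmfunZ D c f : bmfun D f -> bmfun D (fun x => c * f x).
Proof. by apply: bmfunM; exact: bmfun_cst. Qed.

Lemma bmfunN D f : bmfun D f -> bmfun D (fun x => - f x).
Proof.
move=> [mf [a fa]]; split; first exact: measurable_funN.
by exists a => x Dx; rewrite normrN fa.
Qed.

Lemma bmfunB D f g : bmfun D f -> bmfun D g -> bmfun D (fun x => f x - g x).
Proof. by move=> bf bg; apply: bmfunD => //; exact: bmfunN. Qed.

Lemma bmfun_sum D (I : Type) (s : seq I) (P : pred I) (F : I -> T -> R) :
  (forall i, P i -> bmfun D (F i)) -> bmfun D (fun x => \sum_(i <- s | P i) F i x).
Proof.
move=> bF; elim: s => [|i s IH].
  by under eq_fun do rewrite big_nil; exact: bmfun_cst.
under eq_fun do rewrite big_cons.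
have [Pi|nPi] := boolP (P i); last exact: IH.
by apply: bmfunD => //; exact: bF.
Qed.

Lemma bmfun_prod D (I : Type) (s : seq I) (P : pred I) (F : I -> T -> R) :
  (forall i, P i -> bmfun D (F i)) -> bmfun D (fun x => \prod_(i <- s | P i) F i x).
Proof.
move=> bF; elim: s => [|i s IH].
  by under eq_fun do rewrite big_nil; exact: bmfun_cst.
under eq_fun do rewrite big_cons.
have [Pi|nPi] := boolP (P i); last exact: IH.
by apply: bmfunM => //; exact: bF.
Qed.

Lemma bmfun_indic D (A : set T) : measurable A -> bmfun D \1_A.
Proof.
move=> mA; split; first exact: measurable_indic.
by exists 1 => x _; rewrite indicE; case: (_ \in _); rewrite ?normr1 ?normr0.
Qed.

Lemma bmfunS D E f : measurable D -> E `<=` D -> bmfun D f -> bmfun E f.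
Proof.
move=> mD ED [mf [a fa]]; split; first exact: measurable_funS mf.
by exists a => x /ED/fa.
Qed.

Lemma eq_bmfun D f g : (forall x, D x -> f x = g x) -> bmfun D f -> bmfun D g.
Proof.
move=> fg [mf [a fa]]; split; last by exists a => x Dx; rewrite -fg// fa.
by apply: eq_measurable_fun mf => x /set_mem; exact: fg.
Qed.

Lemma bmfun_itv01 D f : measurable_fun D f ->
  (forall x, D x -> 0 <= f x <= 1) -> bmfun D f.
Proof.
move=> mf f01; split=> //; exists 1 => x /f01/andP[f0 f1].
by rewrite ger0_norm.
Qed.

Variable m : {measure set T -> \bar R}.

Lemma integrable_bmM D f g : measurable D -> m.-integrable D (EFin \o f) ->
  bmfun D g -> m.-integrable D (EFin \o (fun x => f x * g x)).
Proof.
move=> mD fi [mg [a ga]].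
apply: eq_integrable (integrableMl mD fi mg _) => //.
exists a; split; first exact: num_real.
by move=> M aM x Dx /=; rewrite (le_trans (ga x Dx))// ltW.
Qed.

Lemma bmfun_integrable D f : measurable D -> (m D < +oo)%E -> bmfun D f ->
  m.-integrable D (EFin \o f).
Proof.
move=> mD mDoo [mf [a fa]]; apply: measurable_bounded_integrable => //.
exists a; split; first exact: num_real.
by move=> M aM x Dx /=; rewrite (le_trans (fa x Dx))// ltW.
Qed.

Lemma Rintegral_sum D (I : Type) (s : seq I) (P : pred I) (F : I -> T -> R) :
  measurable D -> (forall i, P i -> m.-integrable D (EFin \o F i)) ->
  \int[m]_(x in D) (\sum_(i <- s | P i) F i x) =
  \sum_(i <- s | P i) \int[m]_(x in D) F i x.
Proof.
move=> mD Fi; elim: s => [|i s IH].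
  rewrite big_nil -[RHS](mul0r (fine (m D))) -Rintegral_cst//.
  by under eq_Rintegral do rewrite big_nil.
under eq_Rintegral do rewrite big_cons; rewrite big_cons.
case: ifPn => // Pi; rewrite RintegralD ?IH//; first exact: Fi.
rewrite (_ : _ \o _ = (fun x => \sum_(j <- s | P j) (F j x)%:E)%E).
  exact: integrable_sum.
by apply/funext => x /=; rewrite sumEFin.
Qed.

Lemma le_norm_Rintegral_bound D f c : measurable D -> (m D < +oo)%E ->
  measurable_fun D f -> (forall x, D x -> `|f x| <= c) ->
  `|\int[m]_(x in D) f x| <= c * fine (m D).
Proof.
move=> mD Doo mf fc; have bf : bmfun D f by split=> //; exists c.
rewrite -Rintegral_cst//; apply: (le_trans (le_normr_Rintegral _ _)) => //.
  exact: bmfun_integrable.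
apply: le_Rintegral => //; last exact: bmfun_integrable (bmfun_cst _ _).
exact/integrable_norm/bmfun_integrable.
Qed.

End bounded_measurable.

Lemma cvg_sumr (R : realType) (X : Type) (F : set_system X) {FF : Filter F}
    (I : Type) (s : seq I) (a : I -> X -> R) (l : I -> R) :
  (forall i, a i @ F --> l i) ->
  (fun x => \sum_(i <- s) a i x) @ F --> \sum_(i <- s) l i.
Proof.
move=> al; elim: s => [|i s IH].
  by under eq_fun do rewrite big_nil; rewrite big_nil; exact: cvg_cst.
by under eq_fun do rewrite big_cons; rewrite big_cons; exact: cvgD.
Qed.

Lemma cvg_prodr (R : realType) (X : Type) (F : set_system X) {FF : Filter F}
    (I : Type) (s : seq I) (a : I -> X -> R) (l : I -> R) :
  (forall i, a i @ F --> l i) ->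
  (fun x => \prod_(i <- s) a i x) @ F --> \prod_(i <- s) l i.
Proof.
move=> al; elim: s => [|i s IH].
  by under eq_fun do rewrite big_nil; rewrite big_nil; exact: cvg_cst.
by under eq_fun do rewrite big_cons; rewrite big_cons; exact: cvgM.
Qed.

(** An exchange of limits: it suffices to approximate [c], eventually along the filter, and [c0] by
    quantities known to converge. The error splits into three parts of size e / 3. *)
Lemma cvg_approx (X : Type) (F : set_system X) {FF : Filter F} (R : realType)
    (c : X -> R) (c0 : R) :
  (forall e, 0 < e -> exists a : X -> R, exists a0 : R,
    [/\ a @ F --> a0, `|a0 - c0| <= e & \forall g \near F, `|a g - c g| <= e]) ->
  c @ F --> c0.
Proof.
move=> H; apply/cvgrPdist_le => e e0.
have [a [a0 [/cvgrPdist_le aF ac acF]]] := H (e / 3) ltac:(by rewrite divr_gt0).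
have {}aF := aF (e / 3) ltac:(by rewrite divr_gt0).
near=> g.
have h1 : `|a0 - a g| <= e / 3 by near: g.
have h2 : `|a g - c g| <= e / 3 by near: g.
rewrite (_ : c0 - c g = - (a0 - c0) + (a0 - a g) + (a g - c g)); last by ring.
rewrite (le_trans (ler_normD _ _))// (_ : e = e / 3 + e / 3 + e / 3); last by field.
rewrite lerD// (le_trans (ler_normD _ _))// lerD// normrN//.
Unshelve. all: by end_near. Qed.

Section unit_functions.
Context d (T : measurableType d) (R : realType) (m : {measure set T -> \bar R}).
Implicit Types (D A B : set T) (f : T -> R).

Definition unit_fun D f := measurable_fun D f /\ forall x, D x -> 0 <= f x <= 1.

Lemma unit_bmfun D f : unit_fun D f -> bmfun D f.
Proof. by move=> [mf f01]; exact: bmfun_itv01. Qed.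

Lemma measureI_lty D A : measurable D -> measurable A -> (m D < +oo)%E ->
  (m (D `&` A) < +oo)%E.
Proof.
move=> mD mA Doo; rewrite (le_lt_trans _ Doo)//.
by apply: le_measure; rewrite ?inE//; exact: measurableI.
Qed.

Lemma unit_integrable D A f : measurable D -> measurable A -> (m D < +oo)%E ->
  unit_fun D f -> m.-integrable (D `&` A) (EFin \o f).
Proof.
move=> mD mA Doo uf.
apply: bmfun_integrable; [exact: measurableI|exact: measureI_lty|].
by apply: bmfunS (unit_bmfun uf) => //; exact: subIsetl.
Qed.

Lemma Rintegral_diff D f A B : measurable D -> measurable A -> measurable B ->
  (m D < +oo)%E -> B `<=` A -> unit_fun D f ->
  \int[m]_(x in D `&` (A `\` B)) f x =
    \int[m]_(x in D `&` A) f x - \int[m]_(x in D `&` B) f x.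
Proof.
move=> mD mA mB Doo BA uf; apply/eqP; rewrite eq_sym subr_eq; apply/eqP.
have mAB : measurable (A `\` B) by exact: measurableD.
rewrite -Rintegral_setU//; last 4 first.
- exact: measurableI.
- exact: measurableI.
- by rewrite -setIUr; apply: unit_integrable => //; exact: measurableU.
- by apply/disj_set2P; rewrite -subset0 => x [[_ [_ nB]] [_ Bx]].
by rewrite -setIUr setUC setDUK.
Qed.

(** The bound does not depend on [f]; this uniformity allows limits along increasing sets to be
    exchanged with limits along a filter of functions. *)
Lemma Rintegral_diff_le D f A B : measurable D -> measurable A -> measurable B ->
  (m D < +oo)%E -> B `<=` A -> unit_fun D f ->
  `|\int[m]_(x in D `&` B) f x - \int[m]_(x in D `&` A) f x| <=
    fine (m (D `&` A)) - fine (m (D `&` B)).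
Proof.
move=> mD mA mB Doo BA uf; rewrite distrC -Rintegral_diff//.
have := @Rintegral_diff D (cst 1) A B mD mA mB Doo.
rewrite !Rintegral_cst; [|by apply: measurableI => //; try exact: measurableD..].
rewrite !mul1r => <-; last by split=> // x _ /=; rewrite ler01 lexx.
  have mAB : measurable (A `\` B) by exact: measurableD.
  rewrite -[leRHS]mul1r; apply: le_norm_Rintegral_bound;
    [exact: measurableI|exact: measureI_lty| |].
  by apply: measurable_funS uf.1 => //; exact: subIsetl.
  by move=> x [/uf.2/andP[f0 f1] _]; rewrite ger0_norm.
by [].
Qed.

Lemma cvg_measureI D (A : (set T)^nat) : measurable D -> (m D < +oo)%E ->
  (forall i, measurable (A i)) -> nondecreasing_seq A ->
  (fun n => fine (m (D `&` A n))) @ \oo --> fine (m (D `&` \bigcup_i A i)).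
Proof.
move=> mD Doo mA ndA; have mU : measurable (\bigcup_i A i) by exact: bigcup_measurable.
apply: fine_cvg; rewrite fineK; last by rewrite ge0_fin_numE//; exact: measureI_lty.
rewrite setI_bigcupr; apply: nondecreasing_cvg_mu => [i||].
- exact: measurableI.
- by rewrite -setI_bigcupr; exact: measurableI.
- by move=> i j ij; apply/subsetPset; apply: setIS; apply/subsetPset; exact: ndA.
Qed.

End unit_functions.

Section weak_limit.
Context d (T : measurableType d) (R : realType) (m : {measure set T -> \bar R}).
Context (X : Type) (F : set_system X) {FF : Filter F}.
Variables (D : set T) (h : X -> T -> R) (h0 : T -> R).
Hypotheses (mD : measurable D) (Doo : (m D < +oo)%E).
Hypothesis hF : \forall g \near F, unit_fun D (h g).
Hypothesis h0u : unit_fun D h0.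

Let lim_on A := (fun g => \int[m]_(x in D `&` A) h g x) @ F -->
  \int[m]_(x in D `&` A) h0 x.

(** Differences are handled by linearity. For an increasing union, one set of the sequence
    approximates it with an error that [Rintegral_diff_le] bounds uniformly in the functions. *)
Let lim_on_lambda : lim_on setT -> lambda_system setT [set A | measurable A /\ lim_on A].
Proof.
move=> limT; split => //.
- move=> A B BA [mA lA] [mB lB]; split; first exact: measurableD.
  rewrite /lim_on Rintegral_diff//.
  apply: cvg_trans (cvgB lA lB).
  apply: near_eq_cvg; near=> g; rewrite Rintegral_diff//.
  by near: g.
- move=> A ndA mlA.
  have mA i : measurable (A i) by have [] := mlA i.
  have mU : measurable (\bigcup_i A i) by exact: bigcup_measurable.
  split=> //; apply: cvg_approx => e e0.
  have := cvg_measureI mD Doo mA ndA.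
  move=> /cvgrPdist_le/(_ _ e0)[N _ /(_ _ (leqnn N)) /= HN].
  have AU : A N `<=` \bigcup_i A i by exact: bigcup_sup.
  exists (fun g => \int[m]_(x in D `&` A N) h g x), (\int[m]_(x in D `&` A N) h0 x).
  split; first by have [] := mlA N.
  + by rewrite (le_trans _ HN)// (le_trans (Rintegral_diff_le _ _ _ _ _ _))// ler_norm.
  + near=> g; rewrite (le_trans _ HN)// (le_trans (Rintegral_diff_le _ _ _ _ _ _))// ?ler_norm//.
    by near: g.
Unshelve. all: by end_near. Qed.

Variable G : set (set T).
Hypotheses (mG : measurable = <<s G >>) (setIG : setI_closed G).
Hypothesis limG : forall A, G A -> lim_on A.
Hypothesis limT : lim_on setT.

(** Dynkin's theorem: convergence on a generating pi-system extends to all measurable sets. *)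
Let lim_on_measurable A : measurable A -> lim_on A.
Proof.
move=> mA; have : [set A | measurable A /\ lim_on A] A; last by case.
apply: (lambda_system_subset setIG (lim_on_lambda limT) _ (fun _ _ => @subsetT _ _)).
  by move=> B GB; split; [rewrite mG; exact: sub_sigma_algebra|exact: limG].
by rewrite -mG.
Qed.

Import HBSimple.

Let Rintegral_sfun (s : {sfun T >-> R}) f : unit_fun D f ->
  \int[m]_(x in D) (s x * f x) =
  \sum_(y <- finmap.enum_fset (fset_set (range s))) y * \int[m]_(x in D `&` s @^-1` [set y]) f x.
Proof.
move=> uf.
under eq_Rintegral.
  move=> x _; rewrite fimfunE fsbig_finite//= mulr_suml.
  over.
rewrite Rintegral_sum//; last first.
  move=> y _; apply: bmfun_integrable => //; apply: bmfunM; last exact: unit_bmfun.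
  by apply: bmfunZ; exact: bmfun_indic.
apply: eq_bigr => y _.
under eq_Rintegral do rewrite -mulrA.
rewrite RintegralZl//; last first.
  apply: bmfun_integrable => //; apply: bmfunM; last exact: unit_bmfun.
  exact: bmfun_indic.
congr *%R; rewrite [RHS]Rintegral_mkcondr; apply: eq_Rintegral => x _.
by rewrite patchE indicE; case: ifP; rewrite ?mul1r ?mul0r.
Qed.

(** Simple functions are dense in L1, and against a [0, 1]-valued function the error of replacing
    [W] by a simple one is at most their L1 distance, uniformly along the filter. For a simple
    function the claim is convergence on its level sets. *)
Lemma cvg_weak_integrable W : m.-integrable D (EFin \o W) ->
  (fun g => \int[m]_(x in D) (W x * h g x)) @ F --> \int[m]_(x in D) (W x * h0 x).
Proof.
move=> iW; apply: cvg_approx => e e0.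
have [s [si _ sW]] := approximation_sfun_integrable mD iW.
have /cvgrPdist_le/(_ _ e0)[N _ /(_ _ (leqnn N)) HN] :
    (fun n => \int[m]_(x in D) `|W x - s n x|) @ \oo --> 0 by exact: fine_cvg sW.
have iWs : m.-integrable D (EFin \o (fun x => s N x - W x)).
  apply: eq_integrable (integrableB mD (si N) iW) => //.
have key f : unit_fun D f -> `|\int[m]_(x in D) (s N x * f x) - \int[m]_(x in D) (W x * f x)| <= e.
  move=> uf; rewrite -RintegralB//; [|exact/integrable_bmM/unit_bmfun..].
  under eq_Rintegral do rewrite -mulrBl.
  apply: (le_trans (le_normr_Rintegral mD _)); first exact/integrable_bmM/unit_bmfun.
  apply: (@le_trans _ _ (\int[m]_(x in D) `|s N x - W x|)).
    apply: le_Rintegral => //.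
    - exact/integrable_norm/integrable_bmM/unit_bmfun.
    - exact/integrable_norm.
    - move=> x /uf.2/andP[f0 f1].
      by rewrite normrM ler_piMr// ger0_norm.
  apply: le_trans HN; rewrite sub0r normrN (le_trans _ (ler_norm _))//.
  by under eq_Rintegral do rewrite distrC.
exists (fun g => \int[m]_(x in D) (s N x * h g x)), (\int[m]_(x in D) (s N x * h0 x)).
split; [|exact: key|by near=> g; apply: key; near: g].
rewrite Rintegral_sfun//.
apply: (@cvg_trans _ ((fun g => \sum_(y <- finmap.enum_fset (fset_set (range (s N))))
    y * \int[m]_(x in D `&` s N @^-1` [set y]) h g x) @ F)).
  by apply: near_eq_cvg; near=> g; rewrite Rintegral_sfun//; near: g.
apply: cvg_sumr => y; apply: cvgMr.
exact: lim_on_measurable.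
Unshelve. all: by end_near. Qed.

End weak_limit.

(** * Integration over finite product measures *)

Section power_integral.
Context d (T : measurableType d) (R : realType).
Variable m : {sigma_finite_measure set T -> \bar R}.

Lemma measurable_box n (A : 'I_n -> set T) : (forall i, measurable (A i)) ->
  measurable [set t : n.-tuple T | forall i, A i (tnth t i)].
Proof. by move=> mA; have [] := power_measure_box m mA. Qed.

Lemma measurable_prod_tnth n (h : 'I_n -> T -> R) :
  (forall i, measurable_fun setT (h i)) ->
  measurable_fun setT (fun t : n.-tuple T => \prod_(i < n) h i (tnth t i)).
Proof.
move=> mh; apply: measurable_prod => i _.
exact: measurableT_comp (mh i) (measurable_tnth i).
Qed.

(** Tonelli's theorem, by induction along the recursive construction of the power measure. *)
Lemma ge0_integral_prod_tnth n (h : 'I_n -> T -> R) :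
  (forall i, measurable_fun setT (h i)) -> (forall i x, 0 <= h i x) ->
  (\int[m ^\x n]_t (\prod_(i < n) h i (tnth t i))%:E =
   \prod_(i < n) \int[m]_x (h i x)%:E)%E.
Proof.
elim: n h => [|n IH] h mh h0.
  rewrite [RHS]big_ord0; under eq_integral do rewrite big_ord0.
  by rewrite /= integral_dirac//= diracE mem_set// mul1e.
rewrite big_ord_recl -IH//= /power_measureS.
have mP := measurable_prod_tnth (h := fun i => h (lift ord0 i)) (fun i => mh _).
rewrite ge0_integral_pushforward//=; last 3 first.
- exact: measurable_consp.
- by apply/measurable_EFinP; exact: measurable_prod_tnth.
- by move=> t _; rewrite lee_fin prodr_ge0.
rewrite preimage_setT.
transitivity (\int[(m \x m ^\x n)%E]_z ((h ord0 z.1)%:E *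
    (\prod_(i < n) h (lift ord0 i) (tnth z.2 i))%:E))%E.
  apply: eq_integral => -[x t] _ /=; rewrite -EFinM big_ord_recl/=.
  by congr (_ * _)%:E; apply: eq_bigr => i _; rewrite tnthS.
rewrite fubini_tonelli1//=; last 2 first.
- apply: emeasurable_funM; apply/measurable_EFinP.
    exact: measurableT_comp (mh ord0) measurable_fst.
  apply: measurable_prod => i _; apply: measurableT_comp => //.
  exact: measurableT_comp (measurable_tnth i) measurable_snd.
- by move=> z; rewrite mule_ge0 ?lee_fin ?prodr_ge0.
rewrite /fubini_F/=.
under eq_integral.
  move=> x _; rewrite ge0_integralZl//=; last 3 first.
  - exact/measurable_EFinP.
  - by move=> t _; rewrite lee_fin prodr_ge0.
  - by rewrite lee_fin.
  over.
rewrite ge0_integralZr//=.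
- exact/measurable_EFinP.
- by move=> x _; rewrite lee_fin.
- by apply: integral_ge0 => t _; rewrite lee_fin prodr_ge0.
Qed.

Lemma Rintegral_box n (D : set T) (A : 'I_n -> set T) (h : 'I_n -> T -> R) :
  measurable D -> (m D < +oo)%E ->
  (forall i, measurable (A i)) -> (forall i, A i `<=` D) ->
  (forall i, measurable_fun D (h i)) -> (forall i x, D x -> 0 <= h i x <= 1) ->
  \int[m ^\x n]_(t in [set t | forall i, A i (tnth t i)])
    (\prod_(i < n) h i (tnth t i)) = \prod_(i < n) \int[m]_(x in A i) h i x.
Proof.
move=> mD Doo mA AD mh h01.
(* Each factor is extended by 0 outside its side, so that the product vanishes off the box and the
   integral runs over the whole space. *)
rewrite Rintegral_mkcond (_ : _ \_ _ = fun t : n.-tuple T =>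
    \prod_(i < n) (h i \_ (A i)) (tnth t i)); last first.
  apply/funext => t; rewrite patchE; case: ifPn => [/set_mem /= At|].
    by apply: eq_bigr => i _; rewrite patchE mem_set.
  move/negP => /= nA; have [i nAi] : exists i, ~ A i (tnth t i).
    by apply: contrapT => /forallNP H; apply: nA; apply/mem_set => i; apply: contrapT.
  by rewrite (bigD1 i)//= patchE memNset// mul0r.
rewrite /Rintegral (ge0_integral_prod_tnth (h := fun i => h i \_ (A i))); last 2 first.
- move=> i; apply/(measurable_restrictT _ (mA i)).
  by apply: measurable_funS (mh i) => //.
- move=> i x; rewrite patchE; case: ifPn => // /set_mem /AD Dx.
  by have /andP[] := h01 i x Dx.
rewrite (eq_bigr (fun i => (\int[m]_(x in A i) h i x)%:E)).
  by rewrite -(big_morph EFin EFinM (erefl _)).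
move=> i _; rewrite fineK; last first.
  apply: integrable_fin_num => //; apply: bmfun_integrable => //.
    by rewrite (le_lt_trans _ Doo)//; apply: le_measure; rewrite ?inE.
  by apply: bmfunS (AD i) _ => //; apply: bmfun_itv01 => // x; exact: h01.
by rewrite [RHS]integral_mkcond; under [RHS]eq_integral do rewrite restrict_EFin.
Qed.

Definition boxes n : set (set (n.-tuple T)) :=
  [set B | exists2 A : 'I_n -> set T, (forall i, measurable (A i)) &
    B = [set t | forall i, A i (tnth t i)]].

(** The sigma-algebra on tuples is generated by coordinate preimages, and such a preimage is a box
    with all sides but one full. *)
Lemma measurable_boxesE n : measurable = <<s @boxes n >>.
Proof.
apply/seteqP; split; last first.
  apply: smallest_sub; first exact: sigma_algebra_measurable.
  by move=> _ [A mA ->]; exact: measurable_box.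
rewrite {1}/measurable/= /g_sigma_preimage.
apply: smallest_sub; first exact: smallest_sigma_algebra.
elim/big_ind: _ => [||i _]; [exact: sub0set|by move=> X Y XS YS; rewrite subUset|].
move=> _ [A mA <-]; apply: sub_sigma_algebra.
exists (fun j => if j == i then A else setT).
  by move=> j; case: ifP.
apply/seteqP; split=> t /=.
  by move=> [_ At] j; case: eqP => [->|].
by move=> /(_ i); rewrite eqxx.
Qed.

Lemma boxes_setI n : setI_closed (@boxes n).
Proof.
move=> _ _ [A mA ->] [B mB ->]; exists (fun i => A i `&` B i).
  by move=> i; exact: measurableI.
apply/seteqP; split=> t /=; first by move=> [tA tB] i.
by move=> tAB; split=> i; have [] := tAB i.
Qed.

End power_integral.

(** * Weak convergence and compactness of fractional colorings *)

Section weak_convergence.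
Context {R : realType} {k : nat}.
Local Notation leb := (@lebesgue_measure R).
Local Notation I01 := (`[0 : R, 1 : R]%classic).
Implicit Types (f g : 'I_k -> R -> R) (F : set_system ('I_k -> R -> R)).

Lemma measurable_I01 : measurable I01.
Proof. exact: measurable_itv. Qed.

Lemma leb_I01 : leb I01 = 1%E.
Proof. by rewrite lebesgue_measure_itv/= lte_fin ltr01 oppr0 adde0. Qed.

Lemma leb_I01_lty : (leb I01 < +oo)%E.
Proof. by rewrite leb_I01 ltry. Qed.

(** Weak-star convergence, tested on half-lines only: they form a pi-system generating the Borel
    sets, so [cvg_weak_integrable] recovers all integrable test functions. *)
Definition wcvg F f := F (@fractional_coloring R k) /\
  forall r a, (fun g => \int[leb]_(x in I01 `&` `]-oo, a[) g r x) @ F -->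
    \int[leb]_(x in I01 `&` `]-oo, a[) f r x.

Lemma coloring_measurable f r : fractional_coloring f -> measurable_fun I01 (f r).
Proof. by move=> [mf _]; exact: mf. Qed.

Lemma coloring_itv01 f r x : fractional_coloring f -> I01 x -> 0 <= f r x <= 1.
Proof.
move=> [_ f01] x01; have [+ _] := f01 x x01.
by move=> /(_ r); rewrite in_itv/=.
Qed.

Lemma coloring_sum f x : fractional_coloring f -> I01 x -> \sum_(r < k) f r x = 1.
Proof. by move=> [_ f01] x01; have [_ ->] := f01 x x01. Qed.

Lemma coloring_bmfun f r : fractional_coloring f -> bmfun I01 (f r).
Proof.
move=> cf; apply: bmfun_itv01; first exact: coloring_measurable.
by move=> x; exact: coloring_itv01.
Qed.

Lemma wcvg_integrable F f r W : Filter F -> wcvg F f -> fractional_coloring f ->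
  leb.-integrable I01 (EFin \o W) ->
  (fun g => \int[leb]_(x in I01) (W x * g r x)) @ F -->
    \int[leb]_(x in I01) (W x * f r x).
Proof.
move=> FF [Fc Ff] cf iW.
apply: (@cvg_weak_integrable _ _ _ leb _ _ _ I01 (fun g => g r) (f r) _ _ _ _
  (@RGenInftyO.G R)) => //.
- exact: leb_I01_lty.
- apply: filterS Fc => g cg; split; first exact: coloring_measurable.
  by move=> x; exact: coloring_itv01.
- split; first exact: coloring_measurable.
  by move=> x; exact: coloring_itv01.
- exact: RGenInftyO.measurableE.
- move=> _ _ [a ->] [b ->]; exists (Num.min a b).
  by apply/seteqP; split=> x /=; rewrite !in_itv/= lt_min => /andP.
- by move=> _ [a ->]; exact: Ff.
(* The half-line up to 2 contains [0, 1], so the whole interval is itself one of the tests. *)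
- rewrite (_ : I01 `&` setT = I01 `&` `]-oo, 2[); first exact: Ff.
  apply/seteqP; split=> x /=; rewrite !in_itv/=; last by case.
  by move=> [/andP[x0 x1] _]; rewrite x0 x1 (le_lt_trans x1)// ltr1n.
Qed.

Lemma wcvg_measurable F f r (A : set R) : Filter F -> wcvg F f ->
  fractional_coloring f -> measurable A -> A `<=` I01 ->
  (fun g => \int[leb]_(x in A) g r x) @ F --> \int[leb]_(x in A) f r x.
Proof.
move=> FF Ff cf mA AI.
have E h : \int[leb]_(x in A) h x = \int[leb]_(x in I01) (\1_A x * h x).
  rewrite -(setIidr AI) Rintegral_mkcondr; apply: eq_Rintegral => x _.
  by rewrite setIidr// patchE indicE; case: ifP; rewrite ?mul1r ?mul0r.
rewrite E; under eq_fun do rewrite E.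
apply: wcvg_integrable => //.
by apply: bmfun_integrable; [|exact: leb_I01_lty|exact: bmfun_indic].
Qed.

Section tuples.
Variable v : nat.
Local Notation D := (setpow I01 : set (v.-tuple R)).

Lemma measurable_setpow (S : set R) : measurable S -> measurable (setpow S : set (v.-tuple R)).
Proof. by move=> mS; apply: (measurable_box leb (A := fun _ => S)). Qed.

Lemma leb_setpow_I01 : (leb ^\x v) D = 1%E.
Proof.
have [_ ->] := power_measure_box leb (A := fun _ : 'I_v => I01) (fun _ => measurable_I01).
by rewrite big1// => i _; exact: leb_I01.
Qed.

Lemma leb_setpow_lty : ((leb ^\x v) D < +oo)%E.
Proof. by rewrite leb_setpow_I01 ltry. Qed.

Lemma measurable_comp_tnth (h : R -> R) a : measurable_fun I01 h ->
  measurable_fun D (fun x => h (tnth x a)).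
Proof.
move=> mh; apply: (measurable_comp measurable_I01 _ mh) => //.
  by move=> _ [x Dx <-]; exact: Dx.
exact: measurable_funS (measurable_tnth a).
Qed.

Lemma bmfun_comp_tnth (h : R -> R) a : bmfun I01 h -> bmfun D (fun x => h (tnth x a)).
Proof.
move=> [mh [C hC]]; split; first exact: measurable_comp_tnth.
by exists C => x Dx; exact/hC/Dx.
Qed.

Lemma bmfun_prod_tnth (h : 'I_v -> R -> R) : (forall a, bmfun I01 (h a)) ->
  bmfun D (fun x => \prod_(a < v) h a (tnth x a)).
Proof. by move=> bh; apply: bmfun_prod => a _; exact: bmfun_comp_tnth. Qed.

Lemma prod_itv01 (I : Type) (s : seq I) (h : I -> R) :
  (forall i, 0 <= h i <= 1) -> 0 <= \prod_(i <- s) h i <= 1.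
Proof.
move=> h01; elim/big_ind: _ => //; first by rewrite ler01 lexx.
by move=> x y /andP[x0 x1] /andP[y0 y1]; rewrite mulr_ge0//= mulr_ile1.
Qed.

(** On a box the integral of the product factors into one-dimensional integrals, each of which
    converges. Boxes form a generating pi-system and the products stay in [0, 1], so
    [cvg_weak_integrable] applies in dimension v. *)
Lemma wcvg_tuple F f W (s : v.-tuple 'I_k) : Filter F -> wcvg F f ->
  fractional_coloring f -> (leb ^\x v).-integrable D (EFin \o W) ->
  (fun g => \int[leb ^\x v]_(x in D) (W x * \prod_(a < v) g (tnth s a) (tnth x a)))
    @ F -->
  \int[leb ^\x v]_(x in D) (W x * \prod_(a < v) f (tnth s a) (tnth x a)).
Proof.
move=> FF Ff cf iW.
have U g : fractional_coloring g ->
  measurable_fun D (fun x => \prod_(a < v) g (tnth s a) (tnth x a)) /\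
  forall x, D x -> 0 <= \prod_(a < v) g (tnth s a) (tnth x a) <= 1.
  move=> cg; split; first by case: (bmfun_prod_tnth (fun a => coloring_bmfun (tnth s a) cg)).
  by move=> x Dx; apply: prod_itv01 => a; apply: coloring_itv01 => //; exact: Dx.
have boxl B : boxes B ->
    (fun g => \int[leb ^\x v]_(x in D `&` B) \prod_(a < v) g (tnth s a) (tnth x a)) @ F
    --> \int[leb ^\x v]_(x in D `&` B) \prod_(a < v) f (tnth s a) (tnth x a).
  move=> [A mA ->].
  have -> : D `&` [set t | forall i, A i (tnth t i)] =
      [set t : v.-tuple R | forall i, (I01 `&` A i) (tnth t i)].
    apply/seteqP; split=> [t [tI tA] i|t H].
      by split; [exact: tI|exact: tA].
    by split=> i; have [] := H i.
  have E g : fractional_coloring g ->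
      \int[leb ^\x v]_(x in [set t | forall i, (I01 `&` A i) (tnth t i)])
        \prod_(a < v) g (tnth s a) (tnth x a) =
      \prod_(a < v) \int[leb]_(x in I01 `&` A a) g (tnth s a) x.
    move=> cg; apply: (@Rintegral_box _ _ _ leb v I01 (fun i => I01 `&` A i)
      (fun a => g (tnth s a))) => //.
    - exact: leb_I01_lty.
    - by move=> i; apply: measurableI; [exact: measurable_I01|exact: mA].
    - by move=> i; exact: coloring_measurable.
    - by move=> i x; exact: coloring_itv01.
  rewrite E//; apply: (@cvg_trans _ ((fun g =>
      \prod_(a < v) \int[leb]_(x in I01 `&` A a) g (tnth s a) x) @ F)).
    by apply: near_eq_cvg; apply: filterS Ff.1 => g cg; rewrite E.
  apply: cvg_prodr => a; apply: wcvg_measurable => //; exact: measurableI.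
apply: (@cvg_weak_integrable _ _ _ (leb ^\x v) _ _ _ D
  (fun g x => \prod_(a < v) g (tnth s a) (tnth x a))
  (fun x => \prod_(a < v) f (tnth s a) (tnth x a)) _ _ _ _ (@boxes _ R v)) => //.
- exact: measurable_setpow.
- exact: leb_setpow_lty.
- by apply: filterS Ff.1 => g cg; exact: U.
- exact: U.
- exact: measurable_boxesE leb v.
- exact: boxes_setI.
- apply: boxl; exists (fun _ => setT) => //.
  by apply/seteqP; split.
Qed.

Lemma GfunE W (phi : v.-tuple 'I_k -> R) f : fractional_coloring f ->
  (leb ^\x v).-integrable D (EFin \o W) ->
  Gfun W phi f = \sum_(s : v.-tuple 'I_k) phi s *
   \int[leb ^\x v]_(x in D) (W x * \prod_(a < v) f (tnth s a) (tnth x a)).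
Proof.
move=> cf iW; rewrite /Gfun; under eq_Rintegral do rewrite mulr_sumr.
have mD : measurable D by exact: measurable_setpow.
have bf s := bmfun_prod_tnth (fun a => coloring_bmfun (tnth s a) cf).
rewrite Rintegral_sum//; last first.
  by move=> s _; apply: integrable_bmM => //; exact/bmfunZ/bf.
apply: eq_bigr => s _; under eq_Rintegral do rewrite mulrCA.
by rewrite RintegralZl//; exact/integrable_bmM/bf.
Qed.

Lemma wcvg_Gfun F f W (phi : v.-tuple 'I_k -> R) : Filter F -> wcvg F f ->
  fractional_coloring f -> (leb ^\x v).-integrable D (EFin \o W) ->
  Gfun W phi g @[g --> F] --> Gfun W phi f.
Proof.
move=> FF Ff cf iW; rewrite GfunE//.
apply: (@cvg_trans _ ((fun g => \sum_(s : v.-tuple 'I_k) phi s *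
   \int[leb ^\x v]_(x in D) (W x * \prod_(a < v) g (tnth s a) (tnth x a))) @ F)).
  by apply: near_eq_cvg; apply: filterS Ff.1 => g cg; rewrite GfunE.
by apply: cvg_sumr => s; apply: cvgMr; exact: wcvg_tuple.
Qed.

Lemma Gfun_bounded W (phi : v.-tuple 'I_k -> R) :
  (leb ^\x v).-integrable D (EFin \o W) ->
  exists C, forall f, fractional_coloring f -> `|Gfun W phi f| <= C.
Proof.
move=> iW; have mD : measurable D by exact: measurable_setpow.
exists (\sum_(s : v.-tuple 'I_k) `|phi s| * \int[leb ^\x v]_(x in D) `|W x|) => f cf.
have bf s := bmfun_prod_tnth (fun a => coloring_bmfun (tnth s a) cf).
rewrite GfunE// (le_trans (ler_norm_sum _ _ _))//; apply: ler_sum => s _.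
rewrite normrM ler_wpM2l// (le_trans (le_normr_Rintegral _ _))//.
  exact/integrable_bmM/bf.
apply: le_Rintegral => //.
- exact/integrable_norm/integrable_bmM/bf.
- exact: integrable_norm.
move=> x Dx; rewrite normrM ler_piMr//.
have /andP[p0 p1] : 0 <= \prod_(a < v) f (tnth s a) (tnth x a) <= 1.
  by apply: prod_itv01 => a; apply: coloring_itv01 => //; exact: Dx.
by rewrite ger0_norm.
Qed.

End tuples.
End weak_convergence.

(** A segment is compact, and a cluster point of an ultrafilter is a limit of it. *)
Lemma ultra_cvg_itv (R : realType) (X : Type) (F : set_system X) (h : X -> R) (a b : R) :
  UltraFilter F -> F [set g | a <= h g <= b] -> cvg (h @ F).
Proof.
move=> FU Fab.
have /(_ _ _) [] := @segment_compact R a b (h @ F) _ _.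
  by rewrite nbhs_filterE /=; apply: filterS Fab => g /=; rewrite in_itv.
move=> p [_ clp]; apply/cvg_ex; exists p => B pB.
have [//|FnB] := in_ultra_setVsetC (h @^-1` B) FU.
have [q [/= nBq Bq]] := clp (~` B) B FnB pB.
by have := nBq Bq.
Qed.

Lemma cvgr_unique (R : realType) (X : Type) (F : set_system X) {FF : ProperFilter F}
    (h : X -> R) (a b : R) : h @ F --> a -> h @ F --> b -> a = b.
Proof. by move=> ha hb; rewrite -(cvg_lim _ ha)// -(cvg_lim _ hb). Qed.

Section compactness.
Context {R : realType} {k : nat}.
Local Notation leb := (@lebesgue_measure R).
Local Notation I01 := (`[0 : R, 1 : R]%classic).
Local Notation mR := (measurableTypeR R).

Lemma coloring_unit n (f : 'I_n -> R -> R) r :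
  fractional_coloring f -> unit_fun I01 (f r).
Proof.
by move=> cf; split; [exact: coloring_measurable|move=> x; exact: coloring_itv01].
Qed.

Lemma coloring_integrable n (f : 'I_n -> R -> R) r (A : set mR) :
  fractional_coloring f -> measurable A -> leb.-integrable (I01 `&` A) (EFin \o f r).
Proof.
move=> cf mA.
exact: (@unit_integrable _ mR _ leb I01 A (f r) measurable_I01 mA leb_I01_lty
  (coloring_unit r cf)).
Qed.

Section limit_measure.
Variables (F : set_system ('I_k.+1 -> R -> R)) (FU : UltraFilter F).
Hypothesis Fc : F (@fractional_coloring R k.+1).
Variable r : 'I_k.+1.

Let int_on (A : set mR) := fun g : 'I_k.+1 -> R -> R => \int[leb]_(x in I01 `&` A) g r x.

Let int_on_itv A g : measurable A -> fractional_coloring g ->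
  0 <= int_on A g <= fine (leb (I01 `&` A)).
Proof.
move=> mA cg; have [mg g01] := coloring_unit r cg; apply/andP; split.
  by apply: Rintegral_ge0 => x [/g01/andP[]].
rewrite (le_trans (ler_norm _))// -[leRHS]mul1r; apply: le_norm_Rintegral_bound.
- exact: measurableI.
- by apply: measureI_lty => //; exact: leb_I01_lty.
- by apply: measurable_funS mg => //; exact: subIsetl.
- by move=> x [/g01/andP[g0 g1] _]; rewrite ger0_norm.
Qed.

Let limR A := lim (int_on A @ F).

Let cvg_limR A : measurable A -> int_on A @ F --> limR A.
Proof.
move=> mA; apply: (@ultra_cvg_itv _ _ _ _ 0 (fine (leb (I01 `&` A)))).
by apply: filterS Fc => g cg; exact: int_on_itv.
Qed.

Let limR_itv A : measurable A -> 0 <= limR A <= fine (leb (I01 `&` A)).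
Proof.
move=> mA; have := cvg_limR mA => cA; apply/andP; split.
  apply: (cvgr_to_ge cA); apply: filterS Fc => g cg.
  by have /andP[] := int_on_itv mA cg.
apply: (cvgr_to_le cA); apply: filterS Fc => g cg.
by have /andP[] := int_on_itv mA cg.
Qed.

(** The setwise limit of the measures with density [g r] on [0, 1]. A measure is a function on all
    sets, hence the default value 0 off the measurable ones. *)
Definition limit_measure (A : set mR) : \bar R :=
  if pselect (measurable A) then (limR A)%:E else 0%E.

Let limit_measureE A : measurable A -> limit_measure A = (limR A)%:E.
Proof. by rewrite /limit_measure; case: pselect. Qed.

Let limit_measure0 : limit_measure set0 = 0%E.
Proof.
rewrite limit_measureE//; congr EFin; apply/eqP; rewrite eq_le.
have := limR_itv measurable0; rewrite setI0 measure0 /=.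
by move=> /andP[-> ->].
Qed.

Let limit_measure_ge0 A : (0 <= limit_measure A)%E.
Proof.
rewrite /limit_measure; case: pselect => // mA.
by rewrite lee_fin; have /andP[] := limR_itv mA.
Qed.

Let limR_setU A B : measurable A -> measurable B -> A `&` B = set0 ->
  limR (A `|` B) = limR A + limR B.
Proof.
move=> mA mB AB0; apply: cvgr_unique (cvg_limR (measurableU _ _ mA mB)) _.
apply: cvg_trans (cvgD (cvg_limR mA) (cvg_limR mB)).
apply: near_eq_cvg; apply: filterS Fc => g cg.
change (int_on A g + int_on B g = int_on (A `|` B) g).
rewrite /int_on setIUr Rintegral_setU//.
- exact: measurableI.
- exact: measurableI.
- by rewrite -setIUr; apply: coloring_integrable => //; exact: measurableU.
- by apply/disj_set2P; rewrite setIACA AB0 setI0.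
Qed.

Let limR_bigsetU (A : (set mR)^nat) n : (forall i, measurable (A i)) -> trivIset setT A ->
  limR (\big[setU/set0]_(i < n) A i) = \sum_(0 <= i < n) limR (A i).
Proof.
move=> mA tA; elim: n => [|n IH].
  by rewrite big_ord0 big_geq//; apply: EFin_inj; rewrite -limit_measureE.
rewrite big_ord_recr/= big_nat_recr//= limR_setU ?IH//.
  exact: bigsetU_measurable.
rewrite -subset0 => x []; rewrite -bigcup_mkord => -[i /= ni Aix] Anx.
have := tA i n I I; rewrite /= => in_; move: (ni); rewrite in_ ?ltnn//.
by exists x.
Qed.

Let limR_diff A B : measurable A -> measurable B -> B `<=` A ->
  `|limR B - limR A| <= fine (leb (I01 `&` A)) - fine (leb (I01 `&` B)).
Proof.
move=> mA mB BA.
apply: (cvgr_to_le (cvg_norm (cvgB (cvg_limR mB) (cvg_limR mA)))).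
apply: filterS Fc => g cg; apply: Rintegral_diff_le => //.
  exact: leb_I01_lty.
exact: coloring_unit.
Qed.

(** Countable additivity may be lost in a setwise limit along an ultrafilter. Here the common
    domination by Lebesgue measure on [0, 1] yields continuity along increasing unions. *)
Let limit_measure_sigma_additive : semi_sigma_additive limit_measure.
Proof.
move=> A mA tA mU; rewrite limit_measureE//.
apply: (@cvg_trans _ ((fun n => (limR (\big[setU/set0]_(i < n) A i))%:E) @ \oo)).
  apply: near_eq_cvg; apply: nearW => n /=.
  rewrite limR_bigsetU// -sumEFin; apply: eq_bigr => i _.
  by rewrite limit_measureE.
apply: cvg_EFin; first exact: nearW.
pose B n := \big[setU/set0]_(i < n) A i.
have mB n : measurable (B n) by exact: bigsetU_measurable.
have UB : \bigcup_i B i = \bigcup_i A i.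
  apply/seteqP; split=> [x [n _]|x [n _ Anx]].
    by rewrite /B -bigcup_mkord => -[i _ Aix]; exists i.
  by exists n.+1 => //; rewrite /B -bigcup_mkord; exists n => /=.
apply/cvgrPdist_le => e e0.
have ndB : nondecreasing_seq B.
  move=> i j ij; apply/subsetPset => x; rewrite /B -!bigcup_mkord.
  by move=> -[l /= li Alx]; exists l => //=; exact: leq_trans li ij.
have /cvgrPdist_le/(_ _ e0) :=
  @cvg_measureI _ mR _ leb I01 B measurable_I01 leb_I01_lty mB ndB.
apply: filterS => n; apply: le_trans; rewrite distrC UB.
rewrite (le_trans (limR_diff mU (mB n) _)) ?ler_norm//.
by rewrite -UB; exact: bigcup_sup.
Qed.

HB.instance Definition _ := isMeasure.Build _ _ _ limit_measure
  limit_measure0 limit_measure_ge0 limit_measure_sigma_additive.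

Let limit_measure_fin : fin_num_fun limit_measure.
Proof. by move=> A mA; rewrite limit_measureE. Qed.

HB.instance Definition _ := Measure_isFinite.Build _ _ _ limit_measure limit_measure_fin.

(** The domination by Lebesgue measure passes to the limit, and the Radon-Nikodym theorem provides
    the density. *)
Lemma limit_measure_density : exists h : R -> R,
  [/\ measurable_fun setT h, forall x, 0 <= h x, leb.-integrable setT (EFin \o h) &
   forall A, measurable A -> int_on A @ F --> \int[leb]_(x in A) h x].
Proof.
have dom : limit_measure `<< leb.
  apply/null_content_dominatesP => B mB B0.
  rewrite limit_measureE//; congr EFin; apply/eqP; rewrite eq_le.
  have /andP[-> h] := limR_itv mB; rewrite andbT (le_trans h)//.
  have : (leb (I01 `&` B) <= leb B)%E.
    by apply: le_measure; rewrite ?inE//; exact: measurableI.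
  rewrite B0 => IB0; have /eqP -> : leb (I01 `&` B) == 0%E.
    by rewrite eq_le IB0 measure_ge0.
  by [].
have [h [h0 hfin hi hE]] := radon_nikodym_sigma_finite dom.
have hh : h = EFin \o (fine \o h) by apply/funext => x /=; rewrite fineK.
exists (fine \o h); split.
- by apply/measurable_EFinP; rewrite -hh; exact: measurable_int hi.
- by move=> x /=; exact: fine_ge0.
- by rewrite -hh.
- move=> A mA; rewrite /Rintegral.
  have -> : (fun x => ((fine \o h) x)%:E) = h by rewrite [RHS]hh.
  have -> : (\int[leb]_(x in A) h x)%E = (limR A)%:E.
    by rewrite -hE//; exact: limit_measureE.
  exact: cvg_limR.
Qed.

End limit_measure.

(** The limit is found one color at a time, as a density. Integrating the sum of the densities over
    every measurable set shows that it is 1 almost everywhere on [0, 1]. *)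
Lemma coloring_compact (F : set_system ('I_k.+1 -> R -> R)) : UltraFilter F ->
  F (@fractional_coloring R k.+1) ->
  exists2 f, fractional_coloring f & wcvg F f.
Proof.
move=> FU Fc.
have /choice[h hP] := limit_measure_density FU Fc.
have mh r : measurable_fun setT (h r) by have [] := hP r.
have h0 r x : 0 <= h r x by have [_ ] := hP r.
pose s x := \sum_(r < k.+1) h r x.
have ms : measurable_fun setT s by exact: measurable_sum.
have ih r A : measurable A -> leb.-integrable A (EFin \o h r).
  by move=> mA; have [_ _ hi _] := hP r; exact: integrableS hi.
have sI : ae_eq leb I01 (EFin \o s) (cst 1%E).
  apply: integral_ae_eq => //.
  - rewrite (_ : _ \o _ = (fun x => \sum_(r < k.+1) (h r x)%:E)%E).
      by apply: integrable_sum => // r _; exact: ih.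
    by apply/funext => x /=; rewrite sumEFin.
  move=> A AI mA.
  have iA r : leb.-integrable A (EFin \o h r) by exact: ih.
  have Aoo : (leb A < +oo)%E.
    by rewrite (le_lt_trans _ leb_I01_lty)//; apply: le_measure; rewrite ?inE.
  rewrite integral_cst// mul1e.
  transitivity (\int[leb]_(x in A) s x)%:E.
    rewrite /Rintegral fineK//; apply: integrable_fin_num => //.
    rewrite (_ : (fun x => (s x)%:E) = (fun x => \sum_(r < k.+1) (h r x)%:E)%E).
      by apply: integrable_sum => // r _; exact: ih.
    by apply/funext => x /=; rewrite sumEFin.
  rewrite -[RHS]fineK ?ge0_fin_numE//; congr EFin.
  rewrite Rintegral_sum//.
  apply: (@cvgr_unique _ _ F _ (fun g => \sum_(r < k.+1) \int[leb]_(x in I01 `&` A) g r x)).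
    by apply: cvg_sumr => r; have [_ _ _] := hP r; exact.
  apply: (@cvg_trans _ ((fun=> fine (leb A)) @ F)); last exact: cvg_cst.
  apply: near_eq_cvg; apply: filterS Fc => g cg.
  rewrite -Rintegral_sum//; last 2 first.
  - exact: measurableI.
  - by move=> r _; exact: coloring_integrable.
  rewrite (setIidr AI) -[LHS]mul1r -Rintegral_cst//; apply: eq_Rintegral => x /set_mem/AI xI.
  by rewrite (coloring_sum cg).
(* A coloring must sum to 1 at every point of [0, 1], so [f] is the constant color [ord0] on the
   null part where the densities fail to. Elsewhere nonnegativity and total 1 give the upper bound
   1. *)
pose f r x := if s x == 1 then h r x else (r == ord0)%:R.
have mf r : measurable_fun setT (f r).
  apply: measurable_fun_ifT => //.
  exact: measurable_fun_eqr.
have cf : fractional_coloring f.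
  split=> [r|x _]; first exact: measurable_funS (mf r).
  rewrite /f; case: eqP => [sx|_]; last first.
    split=> [r|]; first by rewrite in_itv/=; case: (r == ord0); rewrite ler01 lexx.
    by rewrite (bigD1 ord0)//= big1 ?addr0// => r /negbTE ->.
  split=> // r; rewrite in_itv/= h0/= -sx /s (bigD1 r)//= lerDl.
  exact: sumr_ge0.
exists f => //; split=> // r a.
have mA : measurable (I01 `&` `]-oo, a[) by exact: measurableI.
have [_ _ _ /(_ _ mA)] := hP r.
rewrite setIA setIid (_ : \int[leb]_(x in _) h r x = \int[leb]_(x in I01 `&` `]-oo, a[) f r x)//.
congr fine; apply: ae_eq_integral => //.
- by apply/measurable_EFinP; exact: measurable_funS (mh r).
- by apply/measurable_EFinP; exact: measurable_funS (mf r).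
apply: filterS sI => x sx [xI _]; rewrite /f.
by case: eqP => // ns1; exfalso; apply: ns1; have [] := sx xI.
Qed.

End compactness.

(** * Empirical colorings *)

Section product_sums.
Context {R : realType} {T : finType} {n : nat}.
Implicit Types (p F : 'I_n -> T -> R).

Lemma sum_tuple_prod F :
  \sum_(x : n.-tuple T) \prod_(j < n) F j (tnth x j) = \prod_(j < n) \sum_r F j r.
Proof.
rewrite bigA_distr_bigA/=.
rewrite (reindex (fun f : {ffun 'I_n -> T} => [tuple f i | i < n]))/=; last first.
  exists (fun t : n.-tuple T => [ffun i => tnth t i]) => [f _|t _].
    by apply/ffunP => i; rewrite ffunE tnth_mktuple.
  by apply: eq_from_tnth => i; rewrite tnth_mktuple ffunE.
by apply: eq_bigr => f _; apply: eq_bigr => i _; rewrite tnth_mktuple.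
Qed.

Definition wprod p (x : n.-tuple T) : R := \prod_(j < n) p j (tnth x j).

Definition stochastic p := (forall j r, 0 <= p j r) /\ forall j, \sum_r p j r = 1.

Lemma wprod_ge0 p x : stochastic p -> 0 <= wprod p x.
Proof. by move=> [p0 _]; exact: prodr_ge0. Qed.

Lemma sum_wprod p : stochastic p -> \sum_x wprod p x = 1.
Proof. by move=> [_ p1]; rewrite sum_tuple_prod big1. Qed.

Lemma sum_wprod_prod p (s : seq 'I_n) (h : 'I_n -> T -> R) : uniq s -> stochastic p ->
  \sum_x wprod p x * \prod_(i <- s) h i (tnth x i) =
  \prod_(i <- s) \sum_r p i r * h i r.
Proof.
move=> us [_ p1].
(* Coordinates outside [s] receive the factor 1, so their sums are 1. *)
pose F j r := p j r * (if j \in s then h j r else 1).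
transitivity (\sum_x \prod_(j < n) F j (tnth x j)).
  apply: eq_bigr => x _; rewrite /F big_split/=; congr *%R.
  by rewrite -big_mkcond/= big_uniq.
rewrite sum_tuple_prod [RHS]big_uniq//= [RHS]big_mkcond/=; apply: eq_bigr => j _.
by rewrite /F; case: ifP => // _; under eq_bigr do rewrite mulr1.
Qed.

Lemma sum_wprod1 p i (h : T -> R) : stochastic p ->
  \sum_x wprod p x * h (tnth x i) = \sum_r p i r * h r.
Proof.
move=> sp; have := @sum_wprod_prod p [:: i] (fun _ => h) isT sp.
by rewrite big_seq1 => <-; apply: eq_bigr => x _; rewrite big_seq1.
Qed.

Lemma sum_wprod2 p i j (h g : T -> R) : i != j -> stochastic p ->
  \sum_x wprod p x * (h (tnth x i) * g (tnth x j)) =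
  (\sum_r p i r * h r) * (\sum_r p j r * g r).
Proof.
move=> ij sp.
have us : uniq [:: i; j] by rewrite /= mem_seq1 ij.
have := @sum_wprod_prod p _ (fun l => if l == i then h else g) us sp.
rewrite big_cons big_seq1 eqxx eq_sym (negbTE ij) => <-.
by apply: eq_bigr => x _; rewrite big_cons big_seq1 eqxx eq_sym (negbTE ij).
Qed.

(** The coordinates are independent and centered, so the cross terms vanish and n squares remain. *)
Lemma wprod_second_moment p (a : 'I_n -> T -> R) (b : R) : stochastic p ->
  (forall i, \sum_r p i r * a i r = 0) -> (forall i r, `|a i r| <= b) ->
  \sum_x wprod p x * (\sum_(i < n) a i (tnth x i)) ^+ 2 <= n%:R * b ^+ 2.
Proof.
move=> sp a0 ab.
have -> : \sum_x wprod p x * (\sum_(i < n) a i (tnth x i)) ^+ 2 =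
    \sum_(i < n) \sum_x wprod p x * a i (tnth x i) ^+ 2.
  under eq_bigr => x _ do rewrite expr2 big_distrlr/= mulr_sumr.
  rewrite exchange_big/=; apply: eq_bigr => i _.
  under eq_bigr => x _ do rewrite mulr_sumr.
  rewrite exchange_big/= (bigD1 i)//= [X in _ + X]big1 ?addr0.
    by [].
  move=> j ji; rewrite sum_wprod2//; first by rewrite a0 mul0r.
  by rewrite eq_sym.
apply: (@le_trans _ _ (\sum_(i < n) b ^+ 2)); last by rewrite sumr_const card_ord mulr_natl.
apply: ler_sum => i _; rewrite -[leRHS]mul1r -(sum_wprod sp) mulr_suml.
apply: ler_sum => x _; rewrite ler_wpM2l ?wprod_ge0//.
by rewrite -real_normK ?num_real// lerXn2r ?nnegrE// (le_trans _ (ab i (tnth x i))).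
Qed.

Lemma wprod_chebyshev p (a : 'I_n -> T -> R) (b e : R) : stochastic p -> 0 < e ->
  (forall i, \sum_r p i r * a i r = 0) -> (forall i r, `|a i r| <= b) ->
  \sum_(x | e < `|\sum_(i < n) a i (tnth x i)|) wprod p x <= n%:R * b ^+ 2 / e ^+ 2.
Proof.
move=> sp e0 a0 ab; rewrite ler_pdivlMr ?exprn_gt0//.
apply: le_trans (wprod_second_moment sp a0 ab); rewrite mulr_suml big_mkcond/=.
apply: ler_sum => x _; case: ifPn => [ex|_]; last first.
  by rewrite mulr_ge0 ?wprod_ge0// sqr_ge0.
rewrite ler_wpM2l ?wprod_ge0// -[leRHS]real_normK ?num_real//.
by rewrite lerXn2r ?nnegrE//; exact: ltW.
Qed.

End product_sums.

(** * The partition of [0, 1] into n cells *)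

Section cells.
Context {R : realType}.
Local Notation leb := (@lebesgue_measure R).
Local Notation I01 := (`[0 : R, 1 : R]%classic).
Local Notation mR := (measurableTypeR R).

(** The index used by [step_kernel], shifted to start at 0. The maximum with 1 puts the point 0 into
    the first cell, which is therefore closed on both sides. *)
Definition cell (n : nat) (u : R) : nat := `|Num.max (Num.ceil (n%:R * u)) 1|%N.-1.

Lemma cellE n u : ((cell n u).+1)%:Z = Num.max (Num.ceil (n%:R * u)) 1.
Proof.
rewrite /cell prednK ?absz_gt0; last first.
  by rewrite gt_eqF// lt_max ltr01 orbT.
by rewrite gez0_abs// le_max ler01 orbT.
Qed.

(** The maximum with 1 disappears because [i.+1] is already at least 1. *)
Lemma cell_ltP n i u : (cell n u < i.+1)%N = (n%:R * u <= i.+1%:R).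
Proof.
by rewrite ltnS -ltnS -[(_ < _)%N]lez_nat cellE ge_max ceil_le_int lez_nat andbT.
Qed.

Lemma cell_lt n u : (0 < n)%N -> I01 u -> (cell n u < n)%N.
Proof.
case: n => // n _; rewrite /= in_itv/= => /andP[u0 u1].
by rewrite cell_ltP ler_piMr.
Qed.

Lemma le_cell n (u w : R) : u <= w -> (cell n u <= cell n w)%N.
Proof.
move=> uw; rewrite -ltnS cell_ltP.
have := leqnn (cell n w); rewrite -ltnS cell_ltP; apply: le_trans.
by rewrite ler_wpM2l.
Qed.

Definition cellset n i := [set u : mR | I01 u /\ cell n u = i].

Lemma cellsetE n i : (0 < n)%N -> (i < n)%N ->
  cellset n i = if i == 0%N then `[0, n%:R^-1]%classic
                else `](i%:R / n%:R), (i.+1%:R / n%:R)]%classic.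
Proof.
move=> n0 ni; have n0' : 0 < n%:R :> R by rewrite ltr0n.
have le1 : i.+1%:R / n%:R <= 1 :> R by rewrite ler_pdivrMr// mul1r ler_nat.
case: i ni le1 => [|i] ni le1 /=; apply/seteqP; split=> u /=; rewrite /cellset/= !in_itv/=.
- move=> [/andP[u0 u1] /eqP]; rewrite -leqn0 -ltnS cell_ltP u0/=.
  by rewrite -ler_pdivlMl// mulr1.
- move=> /andP[u0 un]; rewrite u0 (le_trans un)//; last by rewrite -div1r.
  by split=> //; apply/eqP; rewrite -leqn0 -ltnS cell_ltP -ler_pdivlMl// mulr1.
- move=> [/andP[u0 u1] ci]; apply/andP; split.
    by rewrite ltr_pdivrMr// mulrC ltNge -cell_ltP ci ltnn.
  by rewrite ler_pdivlMr// mulrC -cell_ltP ci.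
- move=> /andP[ui ui1].
  have u0 : 0 <= u by rewrite ltW// (le_lt_trans _ ui)// divr_ge0.
  rewrite u0 (le_trans ui1)//; split=> //; apply/eqP; rewrite eqn_leq -ltnS cell_ltP.
  rewrite mulrC -ler_pdivlMr// ui1/= leqNgt cell_ltP -ltNge.
  by rewrite mulrC -ltr_pdivrMr.
Qed.

Lemma measurable_cellset n i : (0 < n)%N -> (i < n)%N -> measurable (cellset n i).
Proof. by move=> n0 ni; rewrite cellsetE//; case: ifP => _; exact: measurable_itv. Qed.

Lemma leb_cellset n i : (0 < n)%N -> (i < n)%N -> leb (cellset n i) = (n%:R^-1)%:E.
Proof.
move=> n0 ni; have n0' : 0 < n%:R :> R by rewrite ltr0n.
rewrite cellsetE//; case: ifP => _; rewrite lebesgue_measure_itv/= lte_fin.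
  by rewrite invr_gt0 n0' oppr0 adde0.
rewrite ltr_pM2r ?invr_gt0// ltr_nat leqnn -EFinD -mulrBl -natrB//.
by rewrite subSnn mul1r.
Qed.

Lemma cellset_sub n i : cellset n i `<=` I01.
Proof. by move=> u []. Qed.

Lemma Rintegral_cells n (h : R -> R) : (0 < n)%N -> bmfun I01 h ->
  \int[leb]_(u in I01) h u = \sum_(i < n) \int[leb]_(u in cellset n i) h u.
Proof.
move=> n0 bh.
have mC (i : 'I_n) : measurable (cellset n i) by exact: measurable_cellset.
transitivity (\int[leb]_(u in I01) \sum_(i < n) (\1_(cellset n i) u * h u)).
  apply: eq_Rintegral => u /set_mem Iu.
  rewrite (bigD1 (Ordinal (cell_lt n0 Iu)))//= indicE mem_set// mul1r.
  rewrite big1 ?addr0// => i ni; rewrite indicE memNset ?mul0r// => -[_ ci].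
  by move: ni => /eqP; apply; apply/val_inj; rewrite /= ci.
rewrite Rintegral_sum//; last first.
  move=> i _; apply: bmfun_integrable => //; first exact: leb_I01_lty.
  by apply: bmfunM => //; exact: bmfun_indic.
apply: eq_bigr => i _; rewrite -[in RHS](setIidr (@cellset_sub n i)).
rewrite [RHS]Rintegral_mkcondr; apply: eq_Rintegral => u _.
by rewrite patchE indicE; case: ifP; rewrite ?mul1r ?mul0r.
Qed.

Lemma cellset_bmfun n i (h : R -> R) : bmfun I01 h -> bmfun (cellset n i) h.
Proof. by apply: bmfunS => //; exact: cellset_sub. Qed.

Lemma cellset_integrable n i (h : R -> R) : (0 < n)%N -> (i < n)%N -> bmfun I01 h ->
  leb.-integrable (cellset n i) (EFin \o h).
Proof.
move=> n0 ni bh.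
have oo : (leb (cellset n i) < +oo)%E by rewrite leb_cellset// ltry.
apply: bmfun_integrable; [exact: measurable_cellset|exact: oo|].
exact: cellset_bmfun.
Qed.

Section empirical.
Variables (k n : nat).
Hypothesis n0 : (0 < n)%N.
Implicit Type x : n.-tuple 'I_k.+1.

(** The default color is read only when [cell n u] is at least n, which does not occur for u in
    [0, 1] and n > 0. *)
Definition empirical (x : n.-tuple 'I_k.+1) (r : 'I_k.+1) (u : R) : R :=
  (nth ord0 x (cell n u) == r)%:R.

Lemma measurable_cell_fun (h : nat -> R) : measurable_fun I01 (fun u => h (cell n u)).
Proof.
apply: (@eq_measurable_fun _ _ _ _ I01
    (fun u => \sum_(i < n) (h i * \1_(cellset n i) u))).
  move=> u /set_mem Iu.
  rewrite (bigD1 (Ordinal (cell_lt n0 Iu)))//= indicE mem_set// mulr1.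
  rewrite big1 ?addr0// => i ni; rewrite indicE memNset ?mulr0// => -[_ ci].
  by move: ni => /eqP; apply; apply/val_inj; rewrite /= ci.
apply: measurable_sum => i; apply: measurable_funM => //.
by apply: measurable_indic; exact: measurable_cellset.
Qed.

Lemma empirical_coloring x : fractional_coloring (empirical x).
Proof.
split=> [r|u uI]; first exact: (measurable_cell_fun (fun i => (nth ord0 x i == r)%:R)).
split=> [r|]; first by rewrite in_itv/= /empirical; case: eqP; rewrite ?lexx ler01.
rewrite /empirical (bigD1 (nth ord0 x (cell n u)))//= eqxx big1 ?addr0// => r.
by rewrite eq_sym => /negbTE ->.
Qed.

(** The i-th term depends on [x] only through its i-th color, so the exponential of such an integral
    factors over the sites. *)
Lemma Rintegral_empirical x (h : 'I_k.+1 -> R -> R) : (forall r, bmfun I01 (h r)) ->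
  \int[leb]_(u in I01) \sum_r h r u * empirical x r u =
  \sum_(i < n) \int[leb]_(u in cellset n i) h (tnth x i) u.
Proof.
move=> bh; rewrite (@Rintegral_cells n)//; last first.
  apply: bmfun_sum => r _; apply: bmfunM => //.
  exact: coloring_bmfun (empirical_coloring x).
apply: eq_bigr => i _; apply: eq_Rintegral => u /set_mem[Iu ci].
rewrite (bigD1 (tnth x i))//= /empirical ci -tnth_nth eqxx mulr1.
by rewrite big1 ?addr0// => r; rewrite eq_sym => /negbTE ->; rewrite mulr0.
Qed.

Lemma Rintegral_empirical1 x r (h : R -> R) : bmfun I01 h ->
  \int[leb]_(u in I01) (h u * empirical x r u) =
  \sum_(i < n) (tnth x i == r)%:R * \int[leb]_(u in cellset n i) h u.
Proof.
move=> bh; rewrite (@Rintegral_cells n)//; last first.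
  by apply: bmfunM => //; exact: coloring_bmfun (empirical_coloring x).
apply: eq_bigr => i _; rewrite mulrC -RintegralZr//; last 2 first.
- exact: measurable_cellset.
- exact: cellset_integrable.
apply: eq_Rintegral => u /set_mem[Iu ci].
by rewrite /empirical ci -tnth_nth.
Qed.

End empirical.
End cells.

(** * Relative entropy *)

Section entropy.
Context {R : realType} {k : nat}.
Local Notation leb := (@lebesgue_measure R).
Local Notation I01 := (`[0 : R, 1 : R]%classic).
Implicit Types f g : 'I_k.+1 -> R -> R.

Lemma Rintegral_I01_cst (c : R) : \int[leb]_(u in I01) c = c.
Proof.
transitivity (c * fine (1%:E : \bar R)); last exact: mulr1.
by rewrite Rintegral_cst//; congr (_ * fine _); exact: leb_I01.
Qed.

Lemma Rintegral_cell_cst n i (c : R) : (0 < n)%N -> (i < n)%N ->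
  \int[leb]_(u in cellset n i) c = c * n%:R^-1.
Proof.
move=> n0 ni; rewrite Rintegral_cst; last exact: measurable_cellset.
by congr (_ * _); rewrite -[RHS]/(fine (n%:R^-1)%:E); congr fine; exact: leb_cellset.
Qed.

Lemma ln_le_subr1 (x : R) : 0 < x -> ln x <= x - 1.
Proof. by move=> x0; have := expR_ge1Dx (ln x); rewrite lnK ?posrE//; lra. Qed.

(* [ln (y / a) >= 1 - a / y], multiplied by [y] *)
Lemma mulr_ln_tangent (y a m : R) : 0 <= y -> 0 < a -> 0 < m ->
  y * ln (a / m) + (y - a) <= y * ln (y / m).
Proof.
rewrite le_eqVlt => /predU1P[<-|y0] a0 m0; first by rewrite !mul0r !add0r oppr_le0 ltW.
have ay : 0 < a / y by exact: divr_gt0.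
have -> : ln (a / m) = ln (a / y) + ln (y / m).
  rewrite -lnM ?posrE ?divr_gt0//; congr ln.
  by rewrite mulrA divfK// gt_eqF.
rewrite mulrDr addrAC -[leRHS]add0r lerD2r.
have := ln_le_subr1 ay; rewrite -(ler_pM2l y0) mulrBr mulr1 mulrCA divff ?gt_eqF//.
by lra.
Qed.

Variable m : 'I_k.+1 -> R.
Hypothesis m0 : forall r, 0 < m r.
Hypothesis m1 : \sum_r m r = 1.

(** With [m] the weights of [mu], this is convertible to [rel_entropy mu]. *)
Definition relent f : R :=
  \int[leb]_(u in I01) (\sum_(r < k.+1) f r u * ln (f r u / m r)).

Definition pairing (l f : 'I_k.+1 -> R -> R) : R :=
  \int[leb]_(u in I01) (\sum_(r < k.+1) l r u * f r u).

(* the tilts for which the exponential moment in [chernoff] is at most 1 *)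
Definition normalized (l : 'I_k.+1 -> R -> R) :=
  (forall r, bmfun I01 (l r)) /\
  forall u, I01 u -> \sum_r m r * expR (l r u) = 1.

Lemma entropy_bmfun f r : fractional_coloring f ->
  bmfun I01 (fun u => f r u * ln (f r u / m r)).
Proof.
move=> cf; have mf := coloring_measurable r cf; split.
  apply: measurable_funM => //; apply: measurableT_comp; first exact: measurable_ln.
  by apply: measurable_funM.
(* The tangent at y = m gives y ln (y / m) >= y - m >= - m. From above, y ln (y / m) <= y (y / m -
   1) <= 1 / m since y <= 1. *)
exists (m r + (m r)^-1) => u Iu; have /andP[f0 f1] := coloring_itv01 r cf Iu.
have mr0 := m0 r; have im0 : 0 < (m r)^-1 by rewrite invr_gt0.
rewrite ler_norml; apply/andP; split.
  have := mulr_ln_tangent f0 mr0 mr0; rewrite divff ?gt_eqF// ln1; lra.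
have [->|fn0] := eqVneq (f r u) 0; first by rewrite mul0r addr_ge0// ltW.
have fm0 : 0 < f r u / m r by rewrite divr_gt0// lt_neqAle eq_sym fn0.
rewrite (le_trans (ler_wpM2l f0 (ln_le_subr1 fm0)))//.
have : f r u * (f r u / m r) <= (m r)^-1.
  by rewrite mulrA ler_piMl ?(ltW im0)// mulr_ile1.
by rewrite mulrBr mulr1; lra.
Qed.

Lemma entropy_integrable f : fractional_coloring f ->
  leb.-integrable I01 (EFin \o (fun u => \sum_r f r u * ln (f r u / m r))).
Proof.
move=> cf; apply: bmfun_integrable => //; first exact: leb_I01_lty.
by apply: bmfun_sum => r _; exact: entropy_bmfun.
Qed.

Lemma pairing_bmfun l f : (forall r, bmfun I01 (l r)) -> fractional_coloring f ->
  bmfun I01 (fun u => \sum_r l r u * f r u).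
Proof.
by move=> bl cf; apply: bmfun_sum => r _; apply: bmfunM => //; exact: coloring_bmfun.
Qed.

Lemma pairing_integrable l f : (forall r, bmfun I01 (l r)) -> fractional_coloring f ->
  leb.-integrable I01 (EFin \o (fun u => \sum_r l r u * f r u)).
Proof.
move=> bl cf; apply: bmfun_integrable => //; first exact: leb_I01_lty.
exact: pairing_bmfun.
Qed.

(** Use, for each color, the tangent at the point m exp (l). The corrections f - m exp (l) cancel in
    the sum, because both families have total 1. *)
Lemma pairing_le_relent l f : normalized l -> fractional_coloring f ->
  pairing l f <= relent f.
Proof.
move=> [bl l1] cf; apply: le_Rintegral => //.
- exact: pairing_integrable.
- exact: entropy_integrable.
move=> u Iu.
have -> : \sum_r l r u * f r u =
    \sum_r (f r u * ln ((m r * expR (l r u)) / m r) + (f r u - m r * expR (l r u))).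
  rewrite big_split/= sumrB (coloring_sum cf Iu) (l1 u Iu) subrr addr0.
  by apply: eq_bigr => r _; rewrite mulrAC divff ?gt_eqF// mul1r expRK mulrC.
apply: ler_sum => r _; have /andP[f0 f1] := coloring_itv01 r cf Iu.
by apply: mulr_ln_tangent => //; rewrite mulr_gt0// expR_gt0.
Qed.

Lemma relent_ge0 f : fractional_coloring f -> 0 <= relent f.
Proof.
move=> cf; have := @pairing_le_relent (fun _ _ => 0) f.
rewrite /pairing; under eq_Rintegral do under eq_bigr do rewrite mul0r.
under eq_Rintegral do rewrite big1//.
rewrite Rintegral_cst// mul0r; apply => //; split=> [r|u _]; first exact: bmfun_cst.
by under eq_bigr do rewrite expR0 mulr1.
Qed.

(* The optimal tilt is [ln (f / m)]; mixing [f] with [m] makes it bounded. *)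
Lemma relent_dual f e : 0 < e -> fractional_coloring f ->
  exists2 l, normalized l & relent f - e <= pairing l f.
Proof.
(* Since h >= q f, the tilt ln (h / m) is at least ln (f / m) + ln q, so this weight costs exactly
   e. The share [p] > 0 of [m] keeps [h] away from 0. *)
move=> e0 cf; pose q : R := expR (- e); pose p := 1 - q.
have q0 : 0 < q by exact: expR_gt0.
have p0 : 0 < p by rewrite subr_gt0 expR_lt1 oppr_lt0.
pose h r u := q * f r u + p * m r.
have h0 r u : I01 u -> 0 < h r u.
  move=> Iu; have /andP[f0 _] := coloring_itv01 r cf Iu.
  by rewrite ltr_wpDl ?mulr_gt0// mulr_ge0// ltW.
pose l r u := ln (h r u / m r).
have bl r : bmfun I01 (l r).
  split.
    apply: measurableT_comp; first exact: measurable_ln.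
    apply: measurable_funM => //; apply: measurable_funD => //.
    by apply: measurable_funM => //; exact: coloring_measurable.
  have im0 : 0 < (m r)^-1 by rewrite invr_gt0.
  exists (`|ln p| + (q / m r + p)) => u Iu; have /andP[f0 f1] := coloring_itv01 r cf Iu.
  have hm : h r u / m r = q * f r u / m r + p.
    by rewrite /h mulrDl mulfK// gt_eqF.
  have qm0 : 0 <= q * f r u / m r by rewrite mulr_ge0 ?mulr_ge0// ltW.
  have hp : p <= h r u / m r by rewrite hm lerDr.
  have lp : ln p <= l r u by rewrite ler_ln ?posrE// (lt_le_trans p0).
  have lu : l r u <= h r u / m r - 1 by exact: ln_le_subr1 (lt_le_trans p0 hp).
  have : q * f r u / m r <= q / m r.
    by rewrite ler_wpM2r ?(ltW im0)// ler_piMr// ltW.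
  have := ler_norm (- ln p); rewrite normrN => lpn.
  have := normr_ge0 (ln p); rewrite hm in lu => ? ?.
  by rewrite ler_norml; apply/andP; split; lra.
have l1 u : I01 u -> \sum_r m r * expR (l r u) = 1.
  move=> Iu; transitivity (\sum_r h r u).
    apply: eq_bigr => r _; rewrite lnK ?posrE ?divr_gt0 ?h0//.
    by rewrite mulrC divfK// gt_eqF.
  by rewrite big_split/= -!mulr_sumr (coloring_sum cf Iu) m1 !mulr1 addrC subrK.
exists l => //.
have -> : relent f - e = \int[leb]_(u in I01) ((\sum_r f r u * ln (f r u / m r)) - e).
  rewrite RintegralB//; last 2 first.
  - exact: entropy_integrable.
  - by apply: bmfun_integrable (bmfun_cst _ _) => //; exact: leb_I01_lty.
  by rewrite Rintegral_I01_cst.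
apply: le_Rintegral => //.
- apply: bmfun_integrable => //; first exact: leb_I01_lty.
  apply: bmfunB (bmfun_cst _ _); apply: bmfun_sum => r _; exact: entropy_bmfun.
- exact: pairing_integrable.
(* Writing e as e times the sum of the f r u distributes the loss over the colors, and the
   comparison becomes termwise. *)
move=> u Iu; rewrite -[X in _ - X]mulr1 -(coloring_sum cf Iu) mulr_sumr -sumrB.
apply: ler_sum => r _; have /andP[f0 f1] := coloring_itv01 r cf Iu.
rewrite [e * _]mulrC -mulrBr [leRHS]mulrC.
have [->|fn0] := eqVneq (f r u) 0; first by rewrite !mul0r.
have {}f0 : 0 < f r u by rewrite lt_neqAle eq_sym fn0.
rewrite ler_pM2l// -[X in _ - X](opprK e) opprK -[- e]expRK -/q addrC -lnM ?posrE ?divr_gt0//.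
rewrite ler_ln ?posrE ?mulr_gt0 ?divr_gt0 ?h0 ?invr_gt0//.
by rewrite mulrA ler_pM2r ?invr_gt0// lerDl mulr_ge0// ltW.
Qed.

Lemma cvg_pairing (F : set_system ('I_k.+1 -> R -> R)) f (l : 'I_k.+1 -> R -> R) : Filter F ->
  wcvg F f -> fractional_coloring f -> (forall r, bmfun I01 (l r)) ->
  pairing l g @[g --> F] --> pairing l f.
Proof.
move=> FF Ff cf bl.
have E g : fractional_coloring g ->
    pairing l g = \sum_r \int[leb]_(u in I01) (l r u * g r u).
  move=> cg; rewrite /pairing Rintegral_sum// => r _.
  apply: bmfun_integrable => //; first exact: leb_I01_lty.
  exact: (bmfunM (bl r) (coloring_bmfun r cg)).
rewrite E//; apply: (@cvg_trans _ ((fun g =>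
    \sum_r \int[leb]_(u in I01) (l r u * g r u)) @ F)).
  by apply: near_eq_cvg; apply: filterS Ff.1 => g cg; rewrite E.
apply: cvg_sumr => r; apply: wcvg_integrable => //.
exact: (@bmfun_integrable _ _ _ leb I01 (l r) measurable_I01 leb_I01_lty (bl r)).
Qed.

(** By duality the entropy is a supremum of the weakly continuous functionals [pairing l]. *)
Lemma relent_lsc (F : set_system ('I_k.+1 -> R -> R)) f a : ProperFilter F ->
  wcvg F f -> fractional_coloring f -> F [set g | relent g <= a] -> relent f <= a.
Proof.
move=> FF Ff cf Fa; apply/ler_addgt0Pr => e e0.
have [l nl le] := relent_dual e0 cf; have [bl _] := nl.
rewrite -lerBlDr (le_trans le)//.
apply: (cvgr_to_le (cvg_pairing _ Ff cf bl)).
apply: filterS (filterI Ff.1 Fa) => g [cg ga].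
by rewrite (le_trans _ ga)//; exact: pairing_le_relent.
Qed.

(** Jensen's inequality for the uniform law on a cell, whose length is 1 / n: integrate the tangent
    of exp at the average [a]. *)
Lemma expR_avg_cell n i (h : R -> R) : (0 < n)%N -> (i < n)%N -> bmfun I01 h ->
  expR (n%:R * \int[leb]_(u in cellset n i) h u) <=
  n%:R * \int[leb]_(u in cellset n i) expR (h u).
Proof.
move=> n0 ni bh; set a := n%:R * _.
have n0' : 0 < n%:R :> R by rewrite ltr0n.
have mC := measurable_cellset n0 ni.
have be : bmfun I01 (fun u => expR (h u)).
  have [mh [C hC]] := bh; split; first exact: measurableT_comp.
  exists (expR C) => u Iu; rewrite ger0_norm ?expR_ge0// ler_expR.
  by rewrite (le_trans (ler_norm _))// hC.
have bt : bmfun I01 (fun u => expR a * (1 + (h u - a))).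
  by apply: bmfunZ; apply: bmfunD; [exact: bmfun_cst|apply: bmfunB => //; exact: bmfun_cst].
have : \int[leb]_(u in cellset n i) (expR a * (1 + (h u - a))) <=
       \int[leb]_(u in cellset n i) expR (h u).
  apply: le_Rintegral => //; [exact: cellset_integrable..|].
  move=> u _; have -> : expR (h u) = expR a * expR (h u - a).
    by rewrite -expRD; congr expR; ring.
  by rewrite ler_pM2l ?expR_gt0// expR_ge1Dx.
rewrite -(ler_pM2l n0'); apply: le_trans.
have bc c : bmfun I01 (cst c : R -> R) by exact: bmfun_cst.
have bha : bmfun I01 (fun u => h u - a) by exact: (bmfunB bh (bc a)).
have bha1 : bmfun I01 (fun u => 1 + (h u - a)) by exact: (bmfunD (bc 1) bha).
rewrite RintegralZl//; last exact: cellset_integrable bha1.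
rewrite RintegralD//; [|exact: cellset_integrable (bc 1)|exact: cellset_integrable bha].
rewrite RintegralB//; [|exact: cellset_integrable bh|exact: cellset_integrable (bc a)].
rewrite !Rintegral_cell_cst// mul1r mulrCA !mulrDr divff ?gt_eqF//.
by rewrite -/a mulrN [n%:R * (a / _)]mulrC divfK ?gt_eqF// mulrN subrr addr0 mulr1.
Qed.

(** The exponential moment factors over the sites. Jensen's inequality moves exp inside each cell
    average, and normalization then bounds each factor by 1. *)
Lemma chernoff n l : (0 < n)%N -> normalized l ->
  \sum_(x : n.-tuple 'I_k.+1) wprod (fun _ => m) x * expR (n%:R * pairing l (empirical x)) <= 1.
Proof.
move=> n0 [bl l1].
have n0' : 0 < n%:R :> R by rewrite ltr0n.
have E (x : n.-tuple 'I_k.+1) : wprod (fun _ => m) x * expR (n%:R * pairing l (empirical x)) =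
    \prod_(j < n) (m (tnth x j) *
      expR (n%:R * \int[leb]_(u in cellset n j) l (tnth x j) u)).
  by rewrite /pairing Rintegral_empirical// mulr_sumr expR_sum -big_split.
under eq_bigr do rewrite E.
rewrite (sum_tuple_prod (fun j r => m r *
  expR (n%:R * \int[leb]_(u in cellset n j) l r u))).
have P := @prod_itv01 R _ (index_enum _) (fun j : 'I_n => \sum_r m r *
  expR (n%:R * \int[leb]_(u in cellset n j) l r u)).
suff /P/andP[] : forall j : 'I_n, 0 <= \sum_r m r *
  expR (n%:R * \int[leb]_(u in cellset n j) l r u) <= 1 by [].
move=> j.
rewrite sumr_ge0/=; last by move=> r _; rewrite mulr_ge0 ?expR_ge0// ltW.
have be r : bmfun I01 (fun u => expR (l r u)).
  have [mh [C hC]] := bl r; split; first exact: measurableT_comp.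
  exists (expR C) => u Iu; rewrite ger0_norm ?expR_ge0// ler_expR.
  by rewrite (le_trans (ler_norm _))// hC.
apply: (@le_trans _ _ (\sum_r m r * (n%:R * \int[leb]_(u in cellset n j) expR (l r u)))).
  by apply: ler_sum => r _; rewrite ler_pM2l// expR_avg_cell.
have -> : \sum_r m r * (n%:R * \int[leb]_(u in cellset n j) expR (l r u)) =
    n%:R * \int[leb]_(u in cellset n j) (\sum_r m r * expR (l r u)).
  rewrite Rintegral_sum; last 2 first.
  - exact: measurable_cellset.
  - by move=> r _; apply: cellset_integrable => //; exact: bmfunZ.
  rewrite mulr_sumr; apply: eq_bigr => r _; rewrite mulrCA; congr *%R.
  by rewrite RintegralZl//; [exact: measurable_cellset|exact: cellset_integrable].
have -> : \int[leb]_(u in cellset n j) (\sum_r m r * expR (l r u)) =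
    \int[leb]_(u in cellset n j) 1.
  by apply: eq_Rintegral => u /set_mem[Iu _]; rewrite l1.
by rewrite Rintegral_cell_cst// mul1r divff// gt_eqF.
Qed.

End entropy.

(** * Lower bound by change of measure *)

Section change_of_measure.
Context {R : realType} {T : finType} {n : nat}.
Variables (m : T -> R) (nu : 'I_n -> T -> R).
Hypotheses (m0 : forall r, 0 < m r) (m1 : \sum_r m r = 1) (nus : stochastic nu).

Let L (x : n.-tuple T) : R := \sum_(i < n) ln (nu i (tnth x i) / m (tnth x i)).
Let K : R := \sum_(i < n) \sum_r nu i r * ln (nu i r / m r).

(** [L] is the log-likelihood ratio, so the two sides agree where [nu] is positive. Where [nu]
    vanishes the left side is 0, and only the inequality survives. *)
Let wprod_expR x : wprod nu x * expR (- L x) <= wprod (fun _ => m) x.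
Proof.
rewrite -sumrN expR_sum -big_split/=; apply: ler_prod => i _.
have [nu0 _] := nus; rewrite mulr_ge0 ?expR_ge0//=.
have [->|ni] := eqVneq (nu i (tnth x i)) 0; first by rewrite mul0r ltW.
have {}ni : 0 < nu i (tnth x i) by rewrite lt_neqAle eq_sym ni nu0.
rewrite -lnV ?posrE ?divr_gt0// lnK ?posrE ?invr_gt0 ?divr_gt0//.
by rewrite invf_div mulrCA divff ?gt_eqF// mulr1.
Qed.

Let sum_wprod_L : \sum_x wprod nu x * L x = K.
Proof.
under eq_bigr do rewrite mulr_sumr; rewrite exchange_big/=.
by apply: eq_bigr => i _; exact: (sum_wprod1 i (fun r => ln (nu i r / m r)) nus).
Qed.

(* Gibbs' variational inequality restricted to the event [A]. *)
Lemma change_of_measure (A : pred (n.-tuple T)) (s := \sum_(x | A x) wprod nu x) : 0 < s ->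
  s * expR (- ((K + 1) / s)) <= \sum_(x | A x) wprod (fun _ => m) x.
Proof.
move=> s0; set t := (K + 1) / s.
(* Off [A], the bound 1 - L <= exp (- L) makes the nu-sum of [L] at least the nu-mass minus the
   m-mass, hence at least -1. The full sum is [K], so at most K + 1 = t * s remains on [A]. *)
have LA : \sum_(x | A x) wprod nu x * L x <= t * s.
  rewrite divfK ?gt_eqF// -sum_wprod_L [in leRHS](bigID A)/= -addrA lerDl.
  have : \sum_(x | ~~ A x) (wprod nu x - wprod (fun _ => m) x) <=
         \sum_(x | ~~ A x) wprod nu x * L x.
    apply: ler_sum => x _; have := wprod_expR x.
    have := ler_wpM2l (wprod_ge0 x nus) (expR_ge1Dx (- L x)).
    by rewrite mulrDr mulr1 mulrN; lra.
  rewrite sumrB => h.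
  have h1 : 0 <= \sum_(x | ~~ A x) wprod nu x by apply: sumr_ge0 => x _; exact: wprod_ge0.
  have ms : @stochastic R T n (fun _ => m) by split=> // j r; exact: ltW.
  have : \sum_(x | ~~ A x) wprod (fun _ => m) x <= 1.
    rewrite -(sum_wprod ms) [leRHS](bigID A)/= lerDr.
    by apply: sumr_ge0 => x _; exact: wprod_ge0.
  lra.
(* By [LA] the nu-sum of t - L over [A] is nonnegative, so inserting it only increases the bound;
   then 1 + (t - L) <= exp (t - L) is applied at each point. *)
have -> : s * expR (- t) = expR (- t) * (s + t * s - t * s) by rewrite addrK mulrC.
apply: (@le_trans _ _ (expR (- t) * (s + t * s - \sum_(x | A x) wprod nu x * L x))).
  by rewrite ler_wpM2l ?expR_ge0// lerB.
have -> : s + t * s - \sum_(x | A x) wprod nu x * L x =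
    \sum_(x | A x) wprod nu x * (1 + (t - L x)).
  rewrite /s mulr_sumr -big_split/= -sumrB; apply: eq_bigr => x _; ring.
rewrite mulr_sumr; apply: ler_sum => x _; apply: le_trans (wprod_expR x).
rewrite mulrCA ler_wpM2l ?wprod_ge0//.
have -> : expR (- L x) = expR (- t) * expR (t - L x) by rewrite -expRD; congr expR; ring.
by rewrite ler_wpM2l ?expR_ge0// expR_ge1Dx.
Qed.

End change_of_measure.

(** * Random colorings drawn from cell averages *)

Section sampling.
Context {R : realType} {k : nat}.
Local Notation leb := (@lebesgue_measure R).
Local Notation I01 := (`[0 : R, 1 : R]%classic).
Variable f : 'I_k.+1 -> R -> R.
Hypothesis cf : fractional_coloring f.

Definition cell_avg n (i : 'I_n) (r : 'I_k.+1) : R :=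
  n%:R * \int[leb]_(u in cellset n i) f r u.

Lemma cell_integral_itv n (i : 'I_n) (h : R -> R) :
  (0 < n)%N -> bmfun I01 h -> (forall u, I01 u -> 0 <= h u <= 1) ->
  0 <= \int[leb]_(u in cellset n i) h u <= n%:R^-1.
Proof.
move=> n0 bh h01; apply/andP; split.
  by apply: Rintegral_ge0 => u [/h01/andP[]].
rewrite -[leRHS]mul1r -(Rintegral_cell_cst 1 n0 (ltn_ord i)).
apply: le_Rintegral; first exact: measurable_cellset.
- exact: cellset_integrable.
- exact: cellset_integrable (bmfun_cst _ _).
- by move=> u [/h01/andP[]].
Qed.

Lemma cell_avg_stochastic n : (0 < n)%N -> stochastic (@cell_avg n).
Proof.
move=> n0; split=> [i r|i].
  rewrite mulr_ge0//; apply: Rintegral_ge0 => u [Iu _].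
  by have /andP[] := coloring_itv01 r cf Iu.
rewrite -mulr_sumr -Rintegral_sum; last 2 first.
- exact: measurable_cellset.
- by move=> r _; apply: cellset_integrable => //; exact: coloring_bmfun.
have -> : \int[leb]_(u in cellset n i) (\sum_r f r u) = \int[leb]_(u in cellset n i) 1.
  by apply: eq_Rintegral => u /set_mem[Iu _]; rewrite (coloring_sum cf Iu).
by rewrite Rintegral_cell_cst// mul1r divff// pnatr_eq0 -lt0n.
Qed.

(* Events whose probability tends to 1 when the colors are drawn independently,
   the i-th one according to the average of [f] over the i-th cell. *)
Definition sampling_filter : set_system ('I_k.+1 -> R -> R) :=
  [set S | forall e : R, 0 < e -> \forall n \near \oo,
    \sum_(x : n.-tuple 'I_k.+1 | ~~ `[< S (empirical x) >]) wprod (@cell_avg n) x <= e].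

Let wprod_cell_ge0 n (x : n.-tuple 'I_k.+1) : 0 <= wprod (@cell_avg n) x.
Proof.
apply: prodr_ge0 => i _; rewrite mulr_ge0//; apply: Rintegral_ge0 => u [Iu _].
by have /andP[] := coloring_itv01 (tnth x i) cf Iu.
Qed.

Global Instance sampling_filter_filter : Filter sampling_filter.
Proof.
split.
- move=> e e0; apply: nearW => n; rewrite big_pred0 ?ltW// => x.
  by apply/negbTE; rewrite negbK; apply/asboolP.
- move=> S S' FS FS' e e0.
  have e20 : 0 < e / 2 by rewrite divr_gt0.
  apply: filterS2 (FS _ e20) (FS' _ e20) => n hS hS'.
  rewrite [leRHS]splitr; apply: le_trans (lerD hS hS').
  rewrite big_mkcond [in leRHS]big_mkcond [X in _ <= _ + X]big_mkcond -big_split/=.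
  apply: ler_sum => x _; have := wprod_cell_ge0 x.
  case: (pselect (S (empirical x))) => s; case: (pselect (S' (empirical x))) => s' w0.
  - by rewrite !asboolT//= addr0.
  - by rewrite (asboolT s) (asboolF s') asboolF//= ?add0r// => -[].
  - by rewrite (asboolF s) (asboolT s') asboolF//= ?addr0// => -[].
  - by rewrite (asboolF s) (asboolF s') asboolF//= ?lerDl// => -[].
- move=> S S' SS' FS e e0; apply: filterS (FS e e0) => n; apply: le_trans.
  rewrite big_mkcond [leRHS]big_mkcond/=; apply: ler_sum => x _.
  case: ifPn => [/asboolPn nS'|_]; last by case: ifP.
  by rewrite ifT//; apply/asboolPn => /SS'.
Qed.

Global Instance sampling_filter_proper : ProperFilter sampling_filter.
Proof.
apply: Build_ProperFilter => F0.
have [N _ H] := F0 (2^-1) ltac:(by []).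
have := H N.+1 (leqnSn N); rewrite (eq_bigl xpredT); last first.
  by move=> x; apply/asboolPn.
rewrite (sum_wprod (cell_avg_stochastic (ltn0Sn N))).
by move: (@ltr_nat R); lra.
Qed.

(** The indicator of the half-line is constant on every cell except the one containing [a], and on
    constants the average of [f] can replace [f]. The exceptional cell contributes at most its
    length. *)
Let bias n r (a : R) : (0 < n)%N ->
  `|\sum_(i < n) (\int[leb]_(u in cellset n i) \1_`]-oo, a[ u * cell_avg i r -
     \int[leb]_(u in cellset n i) (\1_`]-oo, a[ u * f r u))| <= n%:R^-1.
Proof.
move=> n0; have n0' : 0 < n%:R :> R by rewrite ltr0n.
have bf := coloring_bmfun r cf.
have bi : bmfun I01 (\1_(`]-oo, a[ : set R) : R -> R) by exact: bmfun_indic.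
(* At most one index equals [cell n a], and none does when a > 1, the cell number being then at
   least n. *)
apply: (@le_trans _ _ (\sum_(i < n) (i == cell n a :> nat)%:R * n%:R^-1)); last first.
  rewrite -mulr_suml -[leRHS]mul1r ler_wpM2r ?invr_ge0//.
  rewrite -natr_sum [leRHS](_ : 1 = 1%:R)// ler_nat.
  case: (ltnP (cell n a) n) => ca; last first.
    by rewrite big1// => i _; rewrite ltn_eqF// (leq_trans (ltn_ord i)).
  rewrite (bigD1 (Ordinal ca))//= eqxx big1// => i.
  by rewrite -val_eqE /= => /negbTE ->.
apply: le_trans (ler_norm_sum _ _ _) _; apply: ler_sum => i _.
have [ia|ia|ia] := ltngtP i (cell n a).
- have -> : \int[leb]_(u in cellset n i) \1_`]-oo, a[ u = \int[leb]_(u in cellset n i) 1.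
    apply: eq_Rintegral => u /set_mem[Iu cu]; rewrite indicE mem_set//= in_itv/=.
    by rewrite ltNge; apply: contraL ia => /(le_cell n); rewrite cu -leqNgt.
  have -> : \int[leb]_(u in cellset n i) (\1_`]-oo, a[ u * f r u) =
      \int[leb]_(u in cellset n i) f r u.
    apply: eq_Rintegral => u /set_mem[Iu cu]; rewrite indicE mem_set ?mul1r//= in_itv/=.
    by rewrite ltNge; apply: contraL ia => /(le_cell n); rewrite cu -leqNgt.
  rewrite Rintegral_cell_cst// mul1r mulKf ?gt_eqF// subrr normr0.
  by rewrite mul0r.
- have -> : \int[leb]_(u in cellset n i) \1_`]-oo, a[ u = \int[leb]_(u in cellset n i) 0.
    apply: eq_Rintegral => u /set_mem[Iu cu]; rewrite indicE memNset//= in_itv/=.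
    by move=> /ltW/(le_cell n); rewrite cu leqNgt ia.
  have -> : \int[leb]_(u in cellset n i) (\1_`]-oo, a[ u * f r u) =
      \int[leb]_(u in cellset n i) 0.
    apply: eq_Rintegral => u /set_mem[Iu cu]; rewrite indicE memNset ?mul0r//= in_itv/=.
    by move=> /ltW/(le_cell n); rewrite cu leqNgt ia.
  by rewrite Rintegral_cell_cst// !mul0r subrr normr0.
- rewrite mul1r.
  have i01 u : I01 u -> 0 <= (\1_(`]-oo, a[ : set R) u : R) <= 1.
    by move=> _; rewrite indicE; case: (_ \in _); rewrite ?lexx ler01.
  have /andP[w0 w1] := cell_integral_itv i n0 bi i01.
  have f01 u : I01 u -> 0 <= f r u <= 1 by exact: coloring_itv01.
  have if01 u : I01 u -> 0 <= (\1_(`]-oo, a[ : set R) u : R) * f r u <= 1.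
    move=> Iu; have /andP[? ?] := f01 u Iu; have /andP[? ?] := i01 u Iu.
    by rewrite mulr_ge0//= mulr_ile1.
  have /andP[g0 g1] := cell_integral_itv i n0 (bmfunM bi bf) if01.
  have /andP[c0 c1] := cell_integral_itv i n0 bf f01.
  have v0 : 0 <= cell_avg i r by rewrite mulr_ge0.
  have v1 : cell_avg i r <= 1 by rewrite /cell_avg mulrC -ler_pdivlMr// div1r.
  have p0 := mulr_ge0 w0 v0.
  have p1 : \int[leb]_(u in cellset n i) \1_`]-oo, a[ u * cell_avg i r <= n%:R^-1.
    by rewrite -[leRHS]mulr1 ler_pM.
  by rewrite ler_norml; apply/andP; split; lra.
Qed.

(** The error is a centered sum of n independent terms bounded by 1 / n, controlled by Chebyshev's
    inequality with second moment at most 1 / n, plus the deterministic [bias]. *)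
Lemma wcvg_sampling : wcvg sampling_filter f.
Proof.
split.
  move=> e e0; near=> n; rewrite big_pred0 ?ltW// => x.
  apply/negbTE; rewrite negbK; apply/asboolP; apply: empirical_coloring.
  by near: n; exact: nbhs_infty_gt.
move=> r a; apply/cvgrPdist_le => e e0 e' e'0.
near=> n.
have n0 : (0 < n)%N by near: n; exact: nbhs_infty_gt.
have n0' : 0 < n%:R :> R by rewrite ltr0n.
(* This threshold brings Chebyshev's bound n * n^-2 / (e / 2)^2 below e'; the next one brings the
   bias below e / 2. *)
have ne' : 4 / e ^+ 2 / e' <= n%:R by near: n; exact: nbhs_infty_ger.
have ne : 1 / (e / 2) <= n%:R by near: n; exact: nbhs_infty_ger.
have bi : bmfun I01 (\1_(`]-oo, a[ : set R) : R -> R) by exact: bmfun_indic.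
have bf := coloring_bmfun r cf.
have E h : \int[leb]_(u in I01 `&` `]-oo, a[) h u =
    \int[leb]_(u in I01) (\1_`]-oo, a[ u * h u).
  rewrite Rintegral_mkcondr; apply: eq_Rintegral => u _.
  by rewrite patchE indicE; case: ifP; rewrite ?mul1r ?mul0r.
pose w (i : 'I_n) := \int[leb]_(u in cellset n i) \1_`]-oo, a[ u : R.
pose d (i : 'I_n) s := w i * ((s == r)%:R - cell_avg i r).
have i01 u : I01 u -> 0 <= (\1_(`]-oo, a[ : set R) u : R) <= 1.
  by move=> _; rewrite indicE; case: (_ \in _); rewrite ?lexx ler01.
have f01 u : I01 u -> 0 <= f r u <= 1 by exact: coloring_itv01.
have sp := cell_avg_stochastic n0.
have d0 i : \sum_s cell_avg i s * d i s = 0.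
  under eq_bigr do rewrite mulrCA; rewrite -mulr_sumr.
  under eq_bigr do rewrite mulrBr; rewrite sumrB -mulr_suml.
  have [_ ->] := sp; rewrite mul1r (bigD1 r)//= eqxx mulr1 big1 ?addr0 ?subrr ?mulr0//.
  by move=> s /negbTE ->; rewrite mulr0.
have dn i s : `|d i s| <= n%:R^-1.
  have /andP[w0 w1] := cell_integral_itv i n0 bi i01.
  have /andP[c0 c1] := cell_integral_itv i n0 bf f01.
  have v0 : 0 <= cell_avg i r by rewrite mulr_ge0.
  have v1 : cell_avg i r <= 1 by rewrite /cell_avg mulrC -ler_pdivlMr// div1r.
  rewrite normrM (ger0_norm w0) -[leRHS]mulr1 ler_pM// ler_norml.
  by case: (s == r) => /=; apply/andP; split; lra.
have e20 : 0 < e / 2 by rewrite divr_gt0.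
have ub : n%:R * n%:R^-1 ^+ 2 / (e / 2) ^+ 2 <= e'.
  rewrite (_ : _ / _ = (4 / (e ^+ 2)) / n%:R); last first.
    by field; rewrite !gt_eqF.
  by rewrite ler_pdivrMr// [e' * _]mulrC -ler_pdivrMr.
apply: le_trans (le_trans (wprod_chebyshev sp e20 d0 dn) ub).
rewrite big_mkcond [leRHS]big_mkcond/=; apply: ler_sum => x _.
case: ifPn => [/asboolPn nx|_]; last by case: ifP => // _; exact: wprod_ge0.
rewrite ifT//; rewrite ltNge; apply/negP => dx; apply: nx => /=.
rewrite !E Rintegral_empirical1// (Rintegral_cells n0)//; last exact: bmfunM.
rewrite -normrN opprB.
have -> : \sum_(i < n) (tnth x i == r)%:R * \int[leb]_(u in cellset n i) \1_`]-oo, a[ u -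
    \sum_(i < n) \int[leb]_(u in cellset n i) (\1_`]-oo, a[ u * f r u) =
    \sum_(i < n) d i (tnth x i) +
    \sum_(i < n) (w i * cell_avg i r - \int[leb]_(u in cellset n i) (\1_`]-oo, a[ u * f r u)).
  rewrite -sumrB -big_split/=; apply: eq_bigr => i _; rewrite /d /w; ring.
rewrite (le_trans (ler_normD _ _))// [leRHS]splitr lerD//.
apply: le_trans (bias r a n0) _.
by rewrite -[leLHS]mul1r ler_pdivrMr// [e / 2 * _]mulrC -ler_pdivrMr.
Unshelve. all: by end_near. Qed.

Variable m : 'I_k.+1 -> R.
Hypotheses (m0 : forall r, 0 < m r) (m1 : \sum_r m r = 1).

(** Jensen's inequality on each cell for the convex function y ln (y / m), obtained by integrating
    its tangent at a point a > 0. *)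
Lemma cell_avg_entropy n : (0 < n)%N ->
  \sum_(i < n) \sum_r cell_avg i r * ln (cell_avg i r / m r) <= n%:R * relent m f.
Proof.
move=> n0; have n0' : 0 < n%:R :> R by rewrite ltr0n.
have be r := entropy_bmfun m0 r cf.
rewrite /relent (Rintegral_cells n0); last by apply: bmfun_sum => r _; exact: be.
rewrite mulr_sumr; apply: ler_sum => i _.
rewrite Rintegral_sum; last 2 first.
- exact: measurable_cellset.
- by move=> r _; apply: cellset_integrable => //; exact: be.
rewrite mulr_sumr; apply: ler_sum => r _.
have bf := coloring_bmfun r cf.
have key a : 0 < a -> cell_avg i r * ln (a / m r) + (cell_avg i r - a) <=
    n%:R * \int[leb]_(u in cellset n i) (f r u * ln (f r u / m r)).
  move=> a0; have ba : bmfun I01 (cst a : R -> R) by exact: bmfun_cst.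
  have bl : bmfun I01 (fun u => f r u * ln (a / m r)).
    by apply: bmfunM => //; exact: bmfun_cst.
  have -> : cell_avg i r * ln (a / m r) + (cell_avg i r - a) =
      n%:R * \int[leb]_(u in cellset n i) (f r u * ln (a / m r) + (f r u - a)).
    have mC := measurable_cellset n0 (ltn_ord i).
    have bfa : bmfun I01 (fun u => f r u - a) by exact: (bmfunB bf ba).
    rewrite RintegralD//; [|exact: cellset_integrable bl|exact: cellset_integrable bfa].
    rewrite RintegralB//; [|exact: cellset_integrable bf|exact: cellset_integrable ba].
    rewrite RintegralZr//; last exact: cellset_integrable bf.
    rewrite Rintegral_cell_cst// /cell_avg !mulrDr mulrA mulrN; congr (_ + (_ - _)).
    by rewrite mulrCA divff ?gt_eqF// mulr1.
  rewrite ler_pM2l//; apply: le_Rintegral; first exact: measurable_cellset.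
  - by apply: cellset_integrable => //; apply: bmfunD => //; exact: (bmfunB bf ba).
  - by apply: cellset_integrable => //; exact: be.
  - move=> u [Iu _]; have /andP[f0 _] := coloring_itv01 r cf Iu.
    exact: mulr_ln_tangent.
(* The right point of tangency is the average itself. If it is 0 there is no tangent there, and [a]
   tends to 0 instead. *)
have [c0|c0] := eqVneq (cell_avg i r) 0.
  rewrite c0 mul0r; apply/ler_addgt0Pr => a a0.
  by have := key a a0; rewrite c0 mul0r add0r; lra.
have {}c0 : 0 < cell_avg i r.
  by rewrite lt_neqAle eq_sym c0; have [-> ] := cell_avg_stochastic n0.
by have := key _ c0; rewrite subrr addr0.
Qed.

Lemma lower_bound S e : sampling_filter S -> 0 < e ->
  \forall n \near \oo, expR (- (n%:R * (relent m f + e))) <=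
    \sum_(x : n.-tuple 'I_k.+1 | `[< S (empirical x) >]) wprod (fun _ => m) x.
Proof.
move=> FS e0; set H := relent m f.
have H0 : 0 <= H by exact: relent_ge0.
(* The change of measure divides the entropy by the probability of the event, which is eventually at
   least [q] < 1. This [q] is close enough to 1 that H / q <= H + e / 2. *)
pose q := (2 * H + 2) / (e + 2 * H + 2).
have c0 : 0 < e + 2 * H + 2 by lra.
have q0 : 0 < q by rewrite divr_gt0//; lra.
have q1 : 0 < 1 - q by rewrite subr_gt0 ltr_pdivrMr// mul1r; lra.
have Hq : H / q <= H + e / 2.
  rewrite /q invf_div mulrA ler_pdivrMr; last by lra.
  by rewrite -subr_ge0 (_ : _ - _ = e) ?ltW//; field.
near=> n.
have n0 : (0 < n)%N by near: n; exact: nbhs_infty_gt.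
have n0' : 0 < n%:R :> R by rewrite ltr0n.
have nA : \sum_(x : n.-tuple 'I_k.+1 | ~~ `[< S (empirical x) >]) wprod (@cell_avg n) x <= 1 - q.
  by near: n; exact: FS.
have sp := cell_avg_stochastic n0.
pose A (x : n.-tuple 'I_k.+1) := `[< S (empirical x) >].
(* For large n the other half of n * e absorbs the constant 1 / q - ln q. *)
have nq : (q^-1 - ln q) / (e / 2) <= n%:R by near: n; exact: nbhs_infty_ger.
have hs : q <= \sum_(x | A x) wprod (@cell_avg n) x.
  by move: nA; have := sum_wprod sp; rewrite (bigID A)/=; lra.
have s0 := lt_le_trans q0 hs.
apply: le_trans (change_of_measure m0 m1 sp s0).
set s := \sum_(x | A x) _ in hs s0 *.
set K := \sum_(i < n) \sum_r _.
have Kn : K <= n%:R * H by exact: cell_avg_entropy.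
apply: (@le_trans _ _ (q * expR (- ((n%:R * H + 1) / q)))); last first.
  apply: ler_pM => //; [exact: ltW|].
  rewrite ler_expR lerN2.
  apply: (@le_trans _ _ ((n%:R * H + 1) / s)).
    by rewrite ler_pM2r ?invr_gt0// lerD2r.
  by rewrite ler_wpM2l ?addr_ge0 ?mulr_ge0// lef_pV2 ?posrE.
rewrite -{1}[q]lnK ?posrE// -expRD ler_expR.
move: nq; rewrite ler_pdivrMr ?divr_gt0// => h.
have : n%:R * (H / q) <= n%:R * (H + e / 2) by rewrite ler_pM2l.
by rewrite mulrDl mul1r !mulrDr mulrA; lra.
Unshelve. all: by end_near. Qed.

End sampling.

(** * Kernels close in cut norm *)

Section ryser.
Variables (R : comPzRingType) (v : nat).

(** This is (-1)^(v - #|J|), as a product over indices so that it merges with the other products. *)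
Definition subset_sign (J : {set 'I_v}) : R := \prod_(i < v) (if i \in J then 1 else -1).

(** Inclusion-exclusion: the sum over [J] factors over the points, with factor 0 at a point missed
    by [F] and 1 otherwise. A self-map of a finite set is onto exactly when it is injective. *)
Lemma sum_subset_sign (F : {ffun 'I_v -> 'I_v}) :
  \sum_(J : {set 'I_v}) subset_sign J * \prod_a (F a \in J)%:R = (injectiveb F)%:R.
Proof.
have E (J : {set 'I_v}) : subset_sign J * \prod_a (F a \in J)%:R =
    \prod_i (if i \in J then 1 else - (i \notin codom F)%:R).
  have -> : \prod_a (F a \in J)%:R = \prod_i (if i \in J then 1 else (i \notin codom F)%:R) :> R.
    case: (boolP [forall a, F a \in J]) => [/forallP FJ|/forallPn[a aJ]].
      rewrite !big1// => i _; last by rewrite FJ.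
      case: ifP => // iJ; rewrite (_ : _ \notin _)//.
      by apply/negP => /codomP[a ia]; move: iJ; rewrite ia FJ.
    rewrite (bigD1 a)//= (negbTE aJ) mul0r (bigD1 (F a))//= (negbTE aJ).
    by rewrite codom_f mul0r.
  rewrite -big_split/=; apply: eq_bigr => i _.
  by case: ifP => _; rewrite ?mul1r// mulN1r.
under eq_bigr do rewrite E.
rewrite -(bigA_distr _ _ (fun=> 1) (fun i => - (i \notin codom F)%:R))/=.
case: (boolP (injectiveb F)) => [/injectiveP iF|nF].
  rewrite big1// => i _.
  have -> : i \in codom F by exact: (inj_card_onto iF).
  by rewrite oppr0 addr0.
case: (boolP [forall i, i \in codom F]) => [/forallP Fi|/forallPn[i iF]].
  case/negP: nF; rewrite /injectiveb /dinjectiveb; apply/card_uniqP.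
  by rewrite size_map -cardE; apply: eq_card => i; exact: Fi.
by rewrite (bigD1 i)//= iF subrr mul0r.
Qed.

(** The right side is the permanent of [M]. Expanding the products yields a sum over all self-maps,
    of which [sum_subset_sign] keeps the bijections. *)
Lemma ryser (M : 'I_v -> 'I_v -> R) :
  \sum_(J : {set 'I_v}) subset_sign J * \prod_a \sum_(j in J) M a j =
  \sum_(s : 'S_v) \prod_a M a (s a).
Proof.
transitivity (\sum_(F : {ffun 'I_v -> 'I_v}) (injectiveb F)%:R * \prod_a M a (F a)).
  under [RHS]eq_bigr => F _ do rewrite -sum_subset_sign mulr_suml.
  rewrite exchange_big/=; apply: eq_bigr => J _.
  have -> : \prod_a \sum_(j in J) M a j =
      \prod_(a < v) \sum_(j < v) ((j \in J)%:R * M a j).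
    apply: eq_bigr => a _; rewrite big_mkcond/=; apply: eq_bigr => j _.
    by case: ifP; rewrite ?mul1r ?mul0r.
  rewrite bigA_distr_bigA/= mulr_sumr; apply: eq_bigr => F _.
  by rewrite big_split/= mulrA.
rewrite (bigID (fun F : {ffun 'I_v -> 'I_v} => injectiveb F))/= addrC big1 ?add0r; last first.
  by move=> F /negbTE ->; rewrite mul0r.
rewrite (reindex (@pval _))/=; last first.
  pose in_Sn := insubd (1%g : 'S_v).
  by exists in_Sn => /= F UF; first apply: val_inj; apply: insubdK.
apply: eq_big => [s|s _]; first by rewrite (valP s).
rewrite (valP s) mul1r; apply: eq_bigr => a _; by rewrite pvalE.
Qed.

End ryser.

(** * Invariance of Lebesgue measure on the cube under permutations of the coordinates *)

Section permutation_invariance.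
Context {R : realType} {v : nat}.
Local Notation leb := (@lebesgue_measure R).
Local Notation I01 := (`[0 : R, 1 : R]%classic).
Local Notation mR := (measurableTypeR R).
Local Notation D := (setpow I01 : set (v.-tuple mR)).

Lemma measurable_permute (s : 'S_v) :
  measurable_fun setT (permute s : v.-tuple mR -> v.-tuple mR).
Proof.
apply: (@measurability _ _ _ _ _ _ (@boxes _ mR v)) => //.
  by rewrite -(measurable_boxesE leb).
move=> _ [_ [A mA ->] <-]; rewrite setTI.
have -> : permute s @^-1` [set t : v.-tuple mR | forall i, A i (tnth t i)] =
    [set t | forall i, A (s^-1 i)%g (tnth t i)].
  apply/seteqP; split=> t /= At i.
    by have := At (s^-1 i)%g; rewrite tnth_mktuple permKV.
  by have := At (s i); rewrite tnth_mktuple permK.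
exact: (measurable_box leb (A := fun i => A (s^-1 i)%g)).
Qed.

Lemma permute_setpow (s : 'S_v) (S : set mR) :
  permute s @^-1` setpow S = setpow S :> set (v.-tuple mR).
Proof.
apply/seteqP; split=> t /= St i.
  by have := St (s^-1 i)%g; rewrite tnth_mktuple permKV.
by rewrite tnth_mktuple.
Qed.

(** Permutations preserve the volume of boxes, a generating pi-system. Restricting to the cube makes
    both measures finite, so uniqueness applies with the constant sequence [setT]. *)
Lemma leb_permute (s : 'S_v) (A : set (v.-tuple mR)) : measurable A -> A `<=` D ->
  (leb ^\x v) (permute s @^-1` A) = (leb ^\x v) A.
Proof.
move=> mA AD.
have mD : measurable D by exact: measurable_setpow.
have mp := measurable_permute s.
pose m1 : {measure set (v.-tuple mR) -> \bar R} := mrestr (leb ^\x v) mD.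
pose m2 : {measure set (v.-tuple mR) -> \bar R} := pushforward m1 (permute s).
have E : m1 A = m2 mp A.
  apply: (@measure_unique _ _ _ (@boxes _ mR v) (fun=> setT)) => //.
  - exact: (measurable_boxesE leb).
  - exact: boxes_setI.
  - by move=> _; exists (fun=> setT) => //; apply/seteqP; split.
  - by rewrite bigcup_const.
  - move=> _ [B mB ->].
    change ((leb ^\x v) ([set t : v.-tuple mR | forall i, B i (tnth t i)] `&` D) =
      (leb ^\x v) (permute s @^-1` [set t : v.-tuple mR | forall i, B i (tnth t i)] `&` D)).
    have EB (C : 'I_v -> set mR) : [set t : v.-tuple mR | forall i, C i (tnth t i)] `&` D =
        [set t | forall i, (C i `&` I01) (tnth t i)].
      by apply/seteqP; split=> t; [move=> [Ct It] i; split; [exact: Ct|exact: It]|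
        move=> H; split=> i; have [] := H i].
    have -> : permute s @^-1` [set t : v.-tuple mR | forall i, B i (tnth t i)] =
        [set t | forall i, B (s^-1 i)%g (tnth t i)].
      apply/seteqP; split=> t /= Bt i.
        by have := Bt (s^-1 i)%g; rewrite tnth_mktuple permKV.
      by have := Bt (s i); rewrite tnth_mktuple permK.
    have mC (C : 'I_v -> set mR) : (forall i, measurable (C i)) ->
        forall i, measurable (C i `&` I01).
      by move=> H i; apply: measurableI; [exact: H|exact: measurable_I01].
    rewrite (EB B) (EB (fun i => B (s^-1 i)%g)).
    have [_ ->] := power_measure_box leb (mC B mB).
    have [_ ->] := power_measure_box leb (mC (fun i => B (s^-1 i)%g) (fun i => mB _)).
    by rewrite (reindex_perm (s^-1)%g).
  - move=> _; change ((leb ^\x v) (setT `&` D) < +oo)%E.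
    by rewrite setTI; exact: leb_setpow_lty.
move: E; change ((leb ^\x v) (A `&` D) = (leb ^\x v) (permute s @^-1` A `&` D) ->
  (leb ^\x v) (permute s @^-1` A) = (leb ^\x v) A).
rewrite setIidl// => ->; rewrite setIidl//.
by rewrite -(permute_setpow s); exact: preimage_subset.
Qed.

(** The nonnegative case is a change of variables; it is applied to the positive and negative
    parts. *)
Lemma integral_permute (s : 'S_v) (g : v.-tuple mR -> \bar R) : measurable_fun D g ->
  (\int[leb ^\x v]_(x in D) g (permute s x) = \int[leb ^\x v]_(x in D) g x)%E.
Proof.
move=> mg; have mD : measurable D by exact: measurable_setpow.
have mp := measurable_permute s.
have key h : measurable_fun D h -> (forall x, (0 <= h x)%E) ->
    (\int[leb ^\x v]_(x in D) h (permute s x) = \int[leb ^\x v]_(x in D) h x)%E.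
  move=> mh h0.
  transitivity (\int[pushforward (leb ^\x v) (permute s)]_(x in D) h x)%E.
    by rewrite ge0_integral_pushforward// permute_setpow.
  apply: eq_measure_integral => A mA AD; exact: leb_permute.
rewrite [LHS]integralE [RHS]integralE; congr (_ - _)%E.
  rewrite -(key (g^\+)%E (measurable_funepos mg)) => [|x]; last exact: funepos_ge0.
  by apply: eq_integral => x _; rewrite funepos.unlock.
rewrite -(key (g^\-)%E (measurable_funeneg mg)) => [|x]; last exact: funeneg_ge0.
by apply: eq_integral => x _; rewrite funeneg.unlock.
Qed.

End permutation_invariance.

Section cut_norm_bound.
Context {R : realType} {v : nat}.
Local Notation leb := (@lebesgue_measure R).
Local Notation I01 := (`[0 : R, 1 : R]%classic).
Local Notation mR := (measurableTypeR R).
Local Notation D := (setpow I01 : set (v.-tuple mR)).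
Variables (U : v.-tuple R -> R) (c : R).
Hypothesis iU : (leb ^\x v).-integrable D (EFin \o U).
Hypothesis Usym : forall s : 'S_v, {ae leb ^\x v, forall x,
    setpow I01 x -> U (permute s x) = U x}.
Hypothesis Ucut : forall S : set R, measurable S -> S `<=` I01 ->
  `|\int[leb ^\x v]_(x in setpow S) U x| <= c.

Let mD : measurable D. Proof. exact: measurable_setpow. Qed.

Definition multilinear (h : 'I_v -> R -> R) : R :=
  \int[leb ^\x v]_(x in D) (U x * \prod_(a < v) h a (tnth x a)).

(* Indicators are weakly dense in the functions with values in [0, 1]. *)
Lemma multilinear_diag_le (g : R -> R) : unit_fun I01 g ->
  `|multilinear (fun _ => g)| <= c.
Proof.
(* Completing [g] to a coloring with two colors lets sampling draw a random set, the union of the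
   cells of color 0. *)
move=> [mg g01]; pose f (r : 'I_2) u := if r == ord0 then g u else 1 - g u.
have cf : fractional_coloring f.
  split=> [r|u Iu]; rewrite /f.
    by case: (r == ord0) => //; apply: measurable_funB.
  have /andP[g0 g1] := g01 u Iu.
  split=> [r|]; last by rewrite !big_ord_recl big_ord0/= addr0 addrC subrK.
  by rewrite in_itv/=; case: (r == ord0); rewrite ?g0 ?g1// subr_ge0 g1/= lerBlDr lerDl.
pose s : v.-tuple 'I_2 := [tuple ord0 | _ < v].
have sE a : tnth s a = ord0 by rewrite tnth_mktuple.
have FP := sampling_filter_proper cf.
have Ff := @wcvg_tuple R 2 v (sampling_filter f) f U s (sampling_filter_filter cf)
  (wcvg_sampling cf) cf iU.
have -> : multilinear (fun _ => g) =
    \int[leb ^\x v]_(x in D) (U x * \prod_(a < v) f (tnth s a) (tnth x a)).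
  apply: eq_Rintegral => x _; congr *%R; apply: eq_bigr => a _.
  by rewrite sE /f eqxx.
apply: (cvgr_to_le (cvg_norm Ff)).
move=> e e0; near=> n; rewrite big_pred0 ?ltW// => x.
have n0 : (0 < n)%N by near: n; exact: nbhs_infty_gt.
apply/negbTE; rewrite negbK; apply/asboolP => /=.
(* On the cube the sampled product is the indicator of the power of [S], so [Ucut] applies to every
   sample. *)
pose S := I01 `&` [set u | empirical x ord0 u = 1].
have mS : measurable S.
  have := @coloring_measurable R _ _ ord0 (empirical_coloring n0 x).
  by move=> /(_ measurable_I01 _ (measurable_set1 1)).
rewrite (_ : \int[_]_(_ in _) _ = \int[leb ^\x v]_(x in setpow S) U x).
  by apply: Ucut => //; exact: subIsetl.
have DS : D `&` setpow S = setpow S.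
  by apply/setIidPr => t tS a; have [] := tS a.
rewrite -DS Rintegral_mkcondr; apply: eq_Rintegral => t /set_mem Dt.
rewrite patchE; case: ifPn => [/set_mem St|nSt].
  rewrite big1 ?mulr1// => a _; rewrite sE; have [_ /= ->//] := St a.
have [a na] : exists a, empirical x ord0 (tnth t a) != 1.
  apply: contrapT => H; move/negP: nSt; apply; apply/mem_set => a; split; first exact: Dt.
  by apply/eqP/negPn/negP => na; apply: H; exists a.
rewrite (bigD1 a)//= sE (_ : empirical x ord0 (tnth t a) = 0) ?mul0r ?mulr0//.
by move: na; rewrite /empirical; case: (nth _ _ _ == _); rewrite ?eqxx.
Unshelve. all: by end_near. Qed.

Let prod_bm (h : 'I_v -> R -> R) : (forall a, bmfun I01 (h a)) ->
  bmfun D (fun x => \prod_(a < v) h a (tnth x a)).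
Proof. exact: bmfun_prod_tnth. Qed.

(** Permuting the factors amounts to permuting the variables. The measure is invariant, and so is
    [U], though only almost everywhere. *)
Let multilinear_perm (s : 'S_v) (h : 'I_v -> R -> R) : (forall a, bmfun I01 (h a)) ->
  multilinear (fun a => h (s a)) = multilinear h.
Proof.
move=> bh; rewrite /multilinear /Rintegral; congr fine.
have mi (g : 'I_v -> R -> R) : (forall a, bmfun I01 (g a)) ->
    measurable_fun D (fun x : v.-tuple mR => (U x * \prod_(a < v) g a (tnth x a))%:E).
  by move=> bg; exact: measurable_int (integrable_bmM mD iU (prod_bm bg)).
rewrite -(integral_permute (s^-1)%g (mi _ bh)).
apply: ae_eq_integral => //; first by apply: (mi (fun a => h (s a))) => a; exact: bh.
  apply: (measurable_comp mD _ (mi _ bh)).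
    by rewrite -{1}(permute_setpow (s^-1)%g); exact: image_preimage_subset.
  exact: measurable_funS (measurable_permute _).
have [N [mN N0 sN]] := Usym (s^-1)%g; exists N; split=> // x /= H.
apply: sN => /= Ux; apply: H => Dx; rewrite Ux//; congr (_ * _)%:E.
rewrite (reindex_perm (s^-1)%g)/=; apply: eq_bigr => a _.
by rewrite permKV tnth_mktuple.
Qed.

(** One term for each of the 2^v subsets in Ryser's formula, and v^v for the rescaling of the sums
    over [J]. *)
Let C : R := \sum_(J : {set 'I_v}) v%:R ^+ v.

(* Ryser's formula is a polarization identity: it recovers the symmetric form
   [multilinear] from its diagonal values at the sums of the [h j], j in J. *)
Lemma multilinear_le (h : 'I_v -> R -> R) : (0 < v)%N -> (forall a, unit_fun I01 (h a)) ->
  `|multilinear h| <= C * c.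
Proof.
move=> v0 uh; have v0' : 0 < v%:R :> R by rewrite ltr0n.
have bh a := unit_bmfun (uh a).
have c0 : 0 <= c by exact: le_trans (normr_ge0 _) (Ucut measurable0 (@sub0set _ _)).
(* The factor 1 / v brings the sums over [J] into [0, 1], where the diagonal bound applies; v^v
   compensates for it in degree v. *)
have H1 : \sum_(s : 'S_v) multilinear h = \sum_(J : {set 'I_v}) (subset_sign R J *
    (v%:R ^+ v * multilinear (fun _ u => v%:R^-1 * \sum_(j in J) h j u))).
  rewrite (eq_bigr (fun s : 'S_v => multilinear (fun a => h (s a)))); last first.
    by move=> s _; rewrite multilinear_perm.
  rewrite /multilinear -Rintegral_sum//; last first.
    move=> s _; apply: integrable_bmM => //.
    by apply: (prod_bm (h := fun a => h (s a))) => a; exact: bh.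
  have bJ (J : {set 'I_v}) : bmfun I01 (fun u => v%:R^-1 * \sum_(j in J) h j u).
    by apply: bmfunZ; apply: bmfun_sum => j _; exact: bh.
  have bPJ (J : {set 'I_v}) := prod_bm (fun _ : 'I_v => bJ J).
  under [RHS]eq_bigr => J _.
    rewrite mulrA -RintegralZl//; last by apply: integrable_bmM => //; exact: bPJ.
    over.
  rewrite -Rintegral_sum//; last first.
    move=> J _; have := integrable_bmM mD iU (bmfunZ (subset_sign R J * v%:R ^+ v) (bPJ J)).
    by apply: eq_integrable => // x _ /=; rewrite mulrCA.
  apply: eq_Rintegral => x _; rewrite -mulr_sumr.
  rewrite -(ryser (fun a j => h j (tnth x a))) mulr_sumr; apply: eq_bigr => J _.
  rewrite big_split/= prodr_const card_ord exprVn [RHS]mulrCA -!mulrA; congr *%R.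
  by rewrite mulVKf// expf_neq0// gt_eqF.
have H2 : `|\sum_(s : 'S_v) multilinear h| <= C * c.
  rewrite H1 /C mulr_suml (le_trans (ler_norm_sum _ _ _))//; apply: ler_sum => J _.
  rewrite !normrM -[leRHS]mul1r; apply: ler_pM => //.
    by rewrite /subset_sign normr_prod big1// => i _; case: ifP; rewrite ?normrN normr1.
  rewrite ger0_norm ?exprn_ge0// ler_wpM2l ?exprn_ge0//.
  apply: multilinear_diag_le; split.
    by have [] : bmfun I01 (fun u => v%:R^-1 * \sum_(j in J) h j u);
      [apply: bmfunZ; apply: bmfun_sum => j _; exact: bh|].
  move=> u Iu; have h01 j : 0 <= h j u <= 1 by have [_] := uh j; exact.
  rewrite mulr_ge0 ?invr_ge0//=; last by apply: sumr_ge0 => j _; have /andP[] := h01 j.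
  rewrite ler_pdivrMl// mulr1 (le_trans (ler_sum _ (fun j _ => proj2 (andP (h01 j)))))//.
  by rewrite sumr_const ler_nat (leq_trans (max_card _))// card_ord.
(* All the terms of the sum over permutations are equal, and there is at least one. *)
apply: le_trans H2; rewrite sumr_const normrMn -[leLHS]mulr1n ler_wpMn2l//.
by apply/card_gt0P; exists 1%g.
Qed.

End cut_norm_bound.

(** * Step kernels and the statistic as a value of G *)

Section step_kernels.
Context {R : realType} {v n : nat}.
Local Notation leb := (@lebesgue_measure R).
Local Notation I01 := (`[0 : R, 1 : R]%classic).
Local Notation mR := (measurableTypeR R).
Local Notation D := (setpow I01 : set (v.-tuple mR)).
Hypothesis n0 : (0 < n)%N.
Variable Q : v.-tuple 'I_n -> R.

Let mD : measurable D. Proof. exact: measurable_setpow. Qed.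

Definition cell_box (i : v.-tuple 'I_n) : set (v.-tuple mR) :=
  [set t | forall a, cellset n (tnth i a) (tnth t a)].

Lemma measurable_cell_box i : measurable (cell_box i).
Proof.
apply: (measurable_box leb (A := fun a => cellset n (tnth i a))) => a.
exact: measurable_cellset.
Qed.

Lemma leb_cell_box i : (leb ^\x v) (cell_box i) = ((n%:R ^+ v)^-1)%:E.
Proof.
have [_ ->] := power_measure_box leb
  (fun a => measurable_cellset n0 (ltn_ord (tnth i a))).
rewrite (eq_bigr (fun=> (n%:R^-1)%:E)); last first.
  by move=> a _; exact: leb_cellset.
by rewrite -(big_morph EFin EFinM (erefl _)) prodr_const card_ord exprVn.
Qed.

Lemma cell_box_sub i : cell_box i `<=` D.
Proof. by move=> t Ht a; have [] := Ht a. Qed.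

Lemma cell_boxP (t : v.-tuple R) : D t -> exists i, cell_box i t.
Proof.
move=> Dt; exists [tuple Ordinal (cell_lt n0 (Dt a)) | a < v] => a.
by rewrite tnth_mktuple; split; [exact: Dt|].
Qed.

Lemma cell_box_inj i j t : cell_box i t -> cell_box j t -> i = j.
Proof.
move=> it jt; apply: eq_from_tnth => a; apply/val_inj => /=.
by have [_ <-] := it a; have [_ <-] := jt a.
Qed.

Lemma step_kernel_box i t : cell_box i t -> step_kernel Q t = Q i.
Proof.
move=> it; rewrite /step_kernel; case: pickP => [j /forallP jt|/(_ i)/negP[]].
  congr Q; apply: eq_from_tnth => a; apply/val_inj => /=.
  have [_ ca] := it a; have := jt a; rewrite -cellE ca => /eqP.
  by move=> [].
by apply/forallP => a; rewrite -cellE; have [_ ->] := it a.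
Qed.

Lemma sum_cell_box (h : v.-tuple 'I_n -> R) i t : cell_box i t ->
  \sum_j h j * \1_(cell_box j) t = h i.
Proof.
move=> it; rewrite (bigD1 i)//= indicE mem_set// mulr1 big1 ?addr0// => j ji.
rewrite indicE memNset ?mulr0// => jt; move/eqP: ji; apply.
exact: cell_box_inj jt it.
Qed.

Lemma step_kernel_bmfun : bmfun D (step_kernel Q).
Proof.
apply: (@eq_bmfun _ _ _ D (fun t => \sum_i Q i * \1_(cell_box i) t)).
  move=> t Dt; have [i it] := cell_boxP Dt.
  by rewrite (sum_cell_box Q it) (step_kernel_box it).
by apply: bmfun_sum => i _; apply: bmfunZ; apply: bmfun_indic; exact: measurable_cell_box.
Qed.

Lemma step_kernel_integrable : (leb ^\x v).-integrable D (EFin \o step_kernel Q).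
Proof.
by apply: bmfun_integrable; [exact: mD|exact: leb_setpow_lty|exact: step_kernel_bmfun].
Qed.

Lemma step_kernel_sym (s : 'S_v) t : symmetric_tensor Q -> D t ->
  step_kernel Q (permute s t) = step_kernel Q t.
Proof.
move=> Qs Dt; have [i it] := cell_boxP Dt.
rewrite (step_kernel_box it) -(Qs s i); apply: step_kernel_box => a.
by rewrite !tnth_mktuple; exact: it.
Qed.

(** On the box of cells indexed by i, of volume n^-v, the empirical coloring selects in the sum over
    color tuples the single term given by the colors of x at i. *)
Lemma Nstat_Gfun k (phi : v.-tuple 'I_k.+1 -> R) (x : n.-tuple 'I_k.+1) :
  Nstat Q phi x = Gfun (step_kernel Q) phi (empirical x).
Proof.
pose h (i : v.-tuple 'I_n) := Q i * phi [tuple tnth x (tnth i a) | a < v].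
have -> : Gfun (step_kernel Q) phi (empirical x) =
    \int[leb ^\x v]_(t in D) \sum_i h i * \1_(cell_box i) t.
  apply: eq_Rintegral => t /set_mem Dt; have [i it] := cell_boxP Dt.
  rewrite (step_kernel_box it) (sum_cell_box h it) /h; congr *%R.
  rewrite (bigD1 [tuple tnth x (tnth i a) | a < v])//= [X in _ + X]big1 ?addr0.
    rewrite big1 ?mulr1// => a _; rewrite tnth_mktuple /empirical.
    by have [_ ->] := it a; rewrite -tnth_nth eqxx.
  move=> r rx; have [a ra] : exists a, tnth x (tnth i a) != tnth r a.
    apply: contrapT => H; move/eqP: rx; apply; apply: eq_from_tnth => a.
    rewrite tnth_mktuple; apply/esym/eqP/negPn/negP => ra.
    by apply: H; exists a.
  rewrite (bigD1 a)//= /empirical; have [_ ->] := it a.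
  by rewrite -tnth_nth (negbTE ra) mul0r mulr0.
have bi i : bmfun D (\1_(cell_box i) : v.-tuple mR -> R).
  by apply: bmfun_indic; exact: measurable_cell_box.
have ii (g : v.-tuple mR -> R) : bmfun D g -> (leb ^\x v).-integrable D (EFin \o g).
  by move=> bg; apply: bmfun_integrable => //; exact: leb_setpow_lty.
rewrite Rintegral_sum//; last by move=> i _; apply: ii; exact: bmfunZ.
rewrite /Nstat mulr_sumr; apply: eq_bigr => i _.
rewrite RintegralZl//; last exact: ii.
rewrite mulrC; congr *%R.
transitivity (\int[leb ^\x v]_(t in D `&` cell_box i) 1).
  rewrite setIidr; last exact: cell_box_sub.
  rewrite Rintegral_cst; last exact: measurable_cell_box.
  rewrite mul1r -[LHS]/(fine ((n%:R ^+ v)^-1)%:E); congr fine.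
  by apply/esym; exact: leb_cell_box.
rewrite Rintegral_mkcondr; apply: eq_Rintegral => t _.
by rewrite patchE indicE; case: ifP.
Qed.

End step_kernels.

Section approximation.
Context {R : realType} {k v : nat}.
Local Notation leb := (@lebesgue_measure R).
Local Notation I01 := (`[0 : R, 1 : R]%classic).
Local Notation mR := (measurableTypeR R).
Local Notation D := (setpow I01 : set (v.-tuple mR)).
Hypothesis v0 : (0 < v)%N.
Variables (phi : v.-tuple 'I_k.+1 -> R) (Q : forall n : nat, v.-tuple 'I_n -> R).
Arguments Q : clear implicits.
Hypothesis Q_sym : forall n, symmetric_tensor (Q n).
Variable W : v.-tuple R -> R.
Hypothesis W_kernel : kernel_space W.

Let mD : measurable D. Proof. exact: measurable_setpow. Qed.

Let U n := fun x => step_kernel (Q n) x - W x.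

Let iU n : (0 < n)%N -> (leb ^\x v).-integrable D (EFin \o U n).
Proof.
move=> n0; have [iW _] := W_kernel.
by apply: eq_integrable (integrableB mD (step_kernel_integrable n0 (Q n)) iW) => //.
Qed.

(** Expanding over color tuples, each term is the multilinear form of [U n] at components of [f],
    which take values in [0, 1]. The bound is thus uniform in [f]. *)
Lemma Gfun_cut_norm n c f : (0 < n)%N -> (cut_norm (U n) <= c%:E)%E ->
  fractional_coloring f ->
  `|Gfun (step_kernel (Q n)) phi f - Gfun W phi f| <=
    (\sum_s `|phi s|) * ((\sum_(J : {set 'I_v}) v%:R ^+ v) * c).
Proof.
move=> n0 cc cf; have [iW Wsym] := W_kernel.
have iS := step_kernel_integrable n0 (Q n).
have bP (s : v.-tuple 'I_k.+1) :
    bmfun D (fun x : v.-tuple mR => \prod_(a < v) f (tnth s a) (tnth x a)).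
  exact: bmfun_prod_tnth (fun a => coloring_bmfun (tnth s a) cf).
rewrite !GfunE// -sumrB mulr_suml (le_trans (ler_norm_sum _ _ _))//.
apply: ler_sum => s _; rewrite -mulrBr normrM ler_wpM2l//.
have iSP := integrable_bmM mD iS (bP s).
have iWP := integrable_bmM mD iW (bP s).
rewrite -RintegralB//.
under eq_Rintegral do rewrite -mulrBl.
rewrite -[X in `|X|]/(multilinear (U n) (fun a => f (tnth s a))).
apply: multilinear_le => //; first exact: iU.
- move=> s'; have [N [mN N0 sN]] := Wsym s'; exists N; split=> // x /= H.
  apply: sN => /= Wx; apply: H => Dx; rewrite /U Wx//.
  by rewrite step_kernel_sym.
- move=> S mS SI; rewrite -lee_fin EFin_normr_Rintegral; last 2 first.
  + exact: measurable_setpow.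
  + apply: integrableS (iU n0) => //; first exact: measurable_setpow.
    by move=> t St a; exact/SI/St.
  by apply: le_trans cc; apply: ereal_sup_ubound; exists S.
- by move=> a; exact: coloring_unit.
Qed.

Hypothesis Q_cvg : (fun n => cut_norm (U n)) @ \oo --> 0%E.

Lemma Nstat_approx e : 0 < e -> \forall n \near \oo, forall x : n.-tuple 'I_k.+1,
  `|Nstat (Q n) phi x - Gfun W phi (empirical x)| <= e.
Proof.
move=> e0; pose A := \sum_s `|phi s|; pose B : R := \sum_(J : {set 'I_v}) v%:R ^+ v.
have A0 : 0 <= A by exact: sumr_ge0.
have B0 : 0 <= B by apply: sumr_ge0 => J _; rewrite exprn_ge0.
(* Adding 1 keeps the divisor positive even if [phi] vanishes. *)
have c0 : 0 < e / (A * B + 1) by rewrite divr_gt0// ltr_wpDl// mulr_ge0.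
have /fine_cvgP[finU /cvgrPdist_le/(_ _ c0) Uc] := Q_cvg.
near=> n.
have n0 : (0 < n)%N by near: n; exact: nbhs_infty_gt.
have fU : cut_norm (U n) \is a fin_num by near: n.
have Un : `|0 - fine (cut_norm (U n))| <= e / (A * B + 1) by near: n.
move=> x; rewrite Nstat_Gfun//.
have cU : (cut_norm (U n) <= (e / (A * B + 1))%:E)%E.
  rewrite -(fineK fU) lee_fin (le_trans (ler_norm _))//.
  by rewrite -normrN -sub0r.
apply: le_trans (Gfun_cut_norm n0 cU (empirical_coloring n0 x)) _.
rewrite mulrA -/A -/B mulrA ler_pdivrMr; last by rewrite ltr_wpDl// mulr_ge0.
by rewrite mulrC ler_pM2l// lerDl.
Unshelve. all: by end_near. Qed.

End approximation.

(** * Laws of the colors *)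

Section finite_range.
Context d (T : measurableType d) (R : realType) (P : {measure set T -> \bar R}).
Hypothesis Poo : (P setT < +oo)%E.

Lemma Rintegral_indic (A : set T) : measurable A -> \int[P]_w \1_A w = fine (P A).
Proof.
move=> mA; rewrite -[RHS]mul1r -Rintegral_cst// -[in RHS](setTI A) Rintegral_mkcondr.
by apply: eq_Rintegral => w _; rewrite patchE indicE; case: ifP.
Qed.

Lemma Rintegral_finite_range (I : finType) (Y : T -> I) (h : I -> R) :
  (forall i, measurable (Y @^-1` [set i])) ->
  \int[P]_w h (Y w) = \sum_i h i * fine (P (Y @^-1` [set i])).
Proof.
move=> mY.
transitivity (\int[P]_w \sum_i h i * \1_(Y @^-1` [set i]) w).
  apply: eq_Rintegral => w _; rewrite (bigD1 (Y w))//= indicE mem_set// mulr1.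
  rewrite big1 ?addr0// => i /eqP ni; rewrite indicE memNset ?mulr0//= => E.
  by apply: ni; rewrite E.
have bi i : bmfun setT (\1_(Y @^-1` [set i]) : T -> R) by exact: bmfun_indic.
rewrite Rintegral_sum//; last first.
  by move=> i _; apply: bmfun_integrable => //; exact: bmfunZ.
apply: eq_bigr => i _; rewrite RintegralZl//; last exact: bmfun_integrable.
by rewrite Rintegral_indic.
Qed.

Lemma measure_finite_range (I : finType) (Y : T -> I) (S : set I) :
  (forall i, measurable (Y @^-1` [set i])) ->
  P (Y @^-1` S) = (\sum_(i | `[< S i >]) fine (P (Y @^-1` [set i])))%:E.
Proof.
move=> mY.
have mS : measurable (Y @^-1` S).
  have -> : Y @^-1` S = \big[setU/set0]_(i | `[< S i >]) Y @^-1` [set i].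
    rewrite -bigcup_seq_cond; apply/seteqP; split=> w.
      by move=> Sw; exists (Y w) => //=; rewrite mem_index_enum; apply/asboolP.
    by move=> [i /andP[_ /asboolP Si] Yw]; move: Si; rewrite -(Yw : Y w = i).
  by apply: bigsetU_measurable => i _; exact: mY.
have fS : P (Y @^-1` S) \is a fin_num.
  rewrite ge0_fin_numE// (le_lt_trans _ Poo)//.
  by apply: le_measure; rewrite ?inE.
rewrite -[LHS]fineK//; congr EFin; rewrite -Rintegral_indic//.
transitivity (\int[P]_w (fun i => (`[< S i >])%:R) (Y w) : R).
  by apply: eq_Rintegral => w _; rewrite indicE; congr (nat_of_bool _)%:R;
    apply/idP/asboolP => [/set_mem//|Sw]; exact/mem_set.
rewrite (@Rintegral_finite_range _ Y (fun i => (`[< S i >])%:R))// [RHS]big_mkcond/=.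
by apply: eq_bigr => i _; case: ifP; rewrite ?mul1r ?mul0r.
Qed.

End finite_range.

Section finite_alphabet.
Context {R : realType} {k : nat} (mu : probability 'I_k.+1 R).

Definition color_weight (r : 'I_k.+1) : R := fine (mu [set r]).

Lemma measurable_colors (A : set 'I_k.+1) : measurable A. Proof. by []. Qed.

Lemma mu_color r : mu [set r] = (color_weight r)%:E.
Proof. by rewrite /color_weight fineK// fin_num_measure. Qed.

Lemma sum_color_weight : \sum_r color_weight r = 1.
Proof.
have muoo : (mu setT < +oo)%E by rewrite probability_setT ltry.
have H : mu setT = (\sum_(r | `[< setT r >]) color_weight r)%:E.
  exact: (@measure_finite_range _ _ _ mu muoo _ id setT (fun i => measurable_colors _)).
apply: EFin_inj; rewrite -[RHS](probability_setT mu) [RHS]H; congr EFin.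
by apply: eq_bigl => r; rewrite asboolT.
Qed.

Lemma power_measure_point n (x : n.-tuple 'I_k.+1) :
  measurable [set x] /\ (mu ^\x n) [set x] = (wprod (fun _ => color_weight) x)%:E.
Proof.
have E : [set x] = [set t | forall i, [set tnth x i] (tnth t i)].
  by apply/seteqP; split=> [t -> //|t tx]; apply: eq_from_tnth => i; rewrite tx.
have [mB muB] := power_measure_box mu (fun i => measurable_colors [set tnth x i]).
rewrite E; split=> //; rewrite muB.
rewrite (eq_bigr (fun i => (color_weight (tnth x i))%:E)); last first.
  by move=> i _; exact: mu_color.
by rewrite -(big_morph EFin EFinM (erefl _)).
Qed.

Lemma power_measure_setT n : (mu ^\x n) setT = 1%E.
Proof.
have [_] := power_measure_box mu (fun i : 'I_n => measurable_colors setT).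
rewrite (_ : [set t | _] = setT); last by apply/seteqP; split.
by move=> ->; rewrite big1// => i _; exact: probability_setT.
Qed.

Lemma Rintegral_power_measure n (h : n.-tuple 'I_k.+1 -> R) :
  \int[mu ^\x n]_x h x = \sum_x h x * wprod (fun _ => color_weight) x.
Proof.
have oo : ((mu ^\x n) setT < +oo)%E by rewrite power_measure_setT ltry.
rewrite (@Rintegral_finite_range _ _ _ (mu ^\x n) oo _ id h); last first.
  by move=> x; have [] := power_measure_point x.
apply: eq_bigr => x _; congr *%R; have [_ E] := power_measure_point x.
by rewrite -[RHS]/(fine (wprod (fun=> color_weight) x)%:E) -E.
Qed.

(** The tuple takes finitely many values, so point masses determine its law; they follow from
    independence over the full index set. *)
Lemma iid_law d (Om : measurableType d) (P : probability Om R) n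
    (X : 'I_n -> {RV P >-> 'I_k.+1}) (S : set (n.-tuple 'I_k.+1)) : iid mu X ->
  P [set w | S [tuple X j w | j < n]] =
  (\sum_(x | `[< S x >]) wprod (fun _ => color_weight) x)%:E.
Proof.
move=> [indep dist]; pose Y w := [tuple X j w | j < n].
have E x : Y @^-1` [set x] =
    \bigcap_(j in [set` [set: 'I_n]%SET]) X j @^-1` [set tnth x j].
  apply/seteqP; split=> [w /= <- j _ /=|w Xw]; first by rewrite tnth_mktuple.
  by apply: eq_from_tnth => j; rewrite tnth_mktuple; apply: Xw; rewrite /= finset.inE.
have PY x : P (Y @^-1` [set x]) = (wprod (fun _ => color_weight) x)%:E.
  rewrite E (indep _ (fun j => [set tnth x j]))//.
  rewrite (eq_bigr (fun j => (color_weight (tnth x j))%:E)); last first.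
    by move=> j _; rewrite -mu_color -(dist j).
  by rewrite -(big_morph EFin EFinM (erefl _)); congr EFin; apply: eq_bigl => j; rewrite finset.inE.
have mY x : measurable (Y @^-1` [set x]).
  rewrite E; apply: fin_bigcap_measurable => // j _.
  by rewrite -[X in measurable X]setTI; exact: (measurable_funPT (X j)).
have Poo : (P setT < +oo)%E by rewrite probability_setT ltry.
rewrite -[X in P X]/(Y @^-1` S) (measure_finite_range Poo _ mY).
congr EFin; apply: eq_bigr => x _.
by rewrite -[RHS]/(fine (wprod (fun=> color_weight) x)%:E) -PY.
Qed.

End finite_alphabet.

(** * Large deviations *)

Section upper_bound.
Context {R : realType} {k : nat}.
Implicit Types f g : 'I_k.+1 -> R -> R.

(* Neighbourhoods for weak convergence, seen through ultrafilters so that no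
   topology has to be put on colorings. *)
Definition weak_nbhs f (S : set ('I_k.+1 -> R -> R)) :=
  forall F : set_system ('I_k.+1 -> R -> R), UltraFilter F -> wcvg F f -> F S.

Lemma weak_nbhsI f S S' : weak_nbhs f S -> weak_nbhs f S' -> weak_nbhs f (S `&` S').
Proof. by move=> h h' F FU Ff; apply: filterI; [exact: h|exact: h']. Qed.

Variable wt : forall n, n.-tuple 'I_k.+1 -> R.
Arguments wt : clear implicits.
Hypothesis wt0 : forall n x, 0 <= wt n x.

(* Compactness makes the bound global: otherwise the sets with exponentially
   negligible complement generate a proper filter, which has a weak limit. *)
Lemma local_to_global (a : R) :
  (forall f, fractional_coloring f -> exists S, exists b, [/\ b < a, weak_nbhs f S &
     \forall n \near \oo, \sum_(x : n.-tuple 'I_k.+1 | `[< S (empirical x) >]) wt n x <=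
       expR (n%:R * b)]) ->
  \forall n \near \oo, \sum_(x : n.-tuple 'I_k.+1) wt n x <= expR (n%:R * a).
Proof.
move=> local.
pose F : set_system ('I_k.+1 -> R -> R) := [set S | exists2 b, b < a &
  \forall n \near \oo, \sum_(x : n.-tuple 'I_k.+1 | ~~ `[< S (empirical x) >]) wt n x <=
    expR (n%:R * b)].
have [[b ba Fb]|F0] := pselect (F set0).
  apply: filterS Fb => n; rewrite (eq_bigl xpredT); last by move=> x; apply/asboolPn.
  by move=> /le_trans; apply; rewrite ler_expR ler_wpM2l// ltW.
have FF : Filter F.
  split.
  - exists (a - 1); first by rewrite ltrBlDr ltrDl.
    apply: nearW => n; rewrite big_pred0 ?expR_ge0// => x.
    by apply/negbTE; rewrite negbK; apply/asboolP.
  - move=> S S' [b ba Sb] [b' b'a Sb'].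
    pose c := Num.max b b'; have ca : c < a by rewrite gt_max ba.
    (* The two masses add up to at most 2 exp (n c), and the margin (a - c) / 2 absorbs the factor 2
       for n large. *)
    exists ((c + a) / 2); first by rewrite midf_lt.
    have ac0 : 0 < (a - c) / 2 by rewrite divr_gt0// subr_gt0.
    near=> n.
    have n2 : ln 2 / ((a - c) / 2) <= n%:R by near: n; exact: nbhs_infty_ger.
    have h : \sum_(x : n.-tuple 'I_k.+1 | ~~ `[< S (empirical x) >]) wt n x <= expR (n%:R * b).
      by near: n.
    have h' : \sum_(x : n.-tuple 'I_k.+1 | ~~ `[< S' (empirical x) >]) wt n x <= expR (n%:R * b').
      by near: n.
    apply: (@le_trans _ _ (expR (n%:R * b) + expR (n%:R * b'))).
      apply: le_trans (lerD h h').
      rewrite big_mkcond [in leRHS]big_mkcond [X in _ <= _ + X]big_mkcond -big_split/=.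
      apply: ler_sum => x _; have w0 := wt0 x.
      case: (pselect (S (empirical x))) => s; case: (pselect (S' (empirical x))) => s'.
      + by rewrite !asboolT//= addr0.
      + by rewrite (asboolT s) (asboolF s') asboolF//= ?add0r// => -[].
      + by rewrite (asboolF s) (asboolT s') asboolF//= ?addr0// => -[].
      + by rewrite (asboolF s) (asboolF s') asboolF//= ?lerDl// => -[].
    apply: (@le_trans _ _ (2 * expR (n%:R * c))).
      rewrite mulr2n mulrDl mul1r lerD// ler_expR ler_wpM2l// le_max lexx ?orbT//.
    rewrite -[X in X * _]lnK ?posrE// -expRD ler_expR.
    move: n2; rewrite ler_pdivrMr// => n2.
    have -> : n%:R * ((c + a) / 2) = n%:R * ((a - c) / 2) + n%:R * c by field.
    by rewrite lerD2r.
  - move=> S S' SS' [b ba Sb]; exists b => //; apply: filterS Sb => n; apply: le_trans.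
    rewrite big_mkcond [leRHS]big_mkcond/=; apply: ler_sum => x _.
    case: ifPn => [/asboolPn nS'|_]; last by case: ifP.
    by rewrite ifT//; apply/asboolPn => /SS'.
have FP : ProperFilter F by exact: Build_ProperFilter.
have [G [GU FG]] := ultraFilterLemma FP.
have Gc : G (@fractional_coloring R k.+1).
  apply: FG; exists (a - 1); first by rewrite ltrBlDr ltrDl.
  near=> n; rewrite big_pred0 ?expR_ge0// => x.
  apply/negbTE; rewrite negbK; apply/asboolP; apply: empirical_coloring.
  by near: n; exact: nbhs_infty_gt.
have [f cf Gf] := coloring_compact GU Gc.
have [S [b [ba Sf Sb]]] := local f cf.
have GS := Sf G GU Gf.
have GnS : G (~` S).
  apply: FG; exists b => //; apply: filterS Sb => n; apply: le_trans.
  rewrite (eq_bigl (fun x => `[< S (empirical x) >]))// => x.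
  by rewrite asbool_neg negbK.
have [g [Sg nSg]] : (S `&` ~` S) !=set0 by apply: (@filter_ex _ G); exact: filterI.
by [].
Unshelve. all: by end_near. Qed.

End upper_bound.

Section chernoff_local.
Context {R : realType} {k : nat}.
Variable m : 'I_k.+1 -> R.
Hypotheses (m0 : forall r, 0 < m r) (m1 : \sum_r m r = 1).

(** A nearly optimal tilt for [f] defines the neighborhood, a half-space, and Markov's inequality
    with [chernoff] bounds its mass. Half of [e] pays for the tilt and half for the width of the
    neighborhood. *)
Lemma local_entropy_bound (f : 'I_k.+1 -> R -> R) (e : R) : 0 < e -> fractional_coloring f ->
  exists2 S, weak_nbhs f S & forall n, (0 < n)%N ->
    \sum_(x : n.-tuple 'I_k.+1 | `[< S (empirical x) >]) wprod (fun _ => m) x <=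
      expR (- (n%:R * (relent m f - e))).
Proof.
move=> e0 cf; have e20 : 0 < e / 2 by rewrite divr_gt0.
have [l nl lf] := relent_dual m0 m1 e20 cf; have [bl _] := nl.
pose c := relent m f - e.
exists [set g | c <= pairing l g].
  move=> F FU Ff; have Fp : pairing l g @[g --> F] --> pairing l f by exact: cvg_pairing.
  move/cvgrPdist_le : Fp => /(_ _ e20); apply: filterS => g /=.
  by rewrite ler_norml => /andP[_]; rewrite /c; lra.
move=> n n0; have := chernoff m0 n0 nl.
rewrite -(ler_pM2r (expR_gt0 (- (n%:R * c)))) mul1r; apply: le_trans.
rewrite mulr_suml big_mkcond/=; apply: ler_sum => x _.
have w0 : 0 <= wprod (fun _ => m) x by apply: prodr_ge0 => i _; exact: ltW.
case: ifPn => [/asboolP/= cx|_]; last by rewrite !mulr_ge0// expR_ge0.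
rewrite -mulrA -expRD -[leLHS]mulr1 ler_wpM2l// -[leLHS]expR0 ler_expR.
by rewrite -mulrBr mulr_ge0// subr_ge0.
Qed.

End chernoff_local.

(** * Existence of optimizers and the rate function *)

Section variational.
Context {R : realType} {k v : nat}.
Local Notation leb := (@lebesgue_measure R).
Local Notation I01 := (`[0 : R, 1 : R]%classic).
Local Notation mR := (measurableTypeR R).
Local Notation D := (setpow I01 : set (v.-tuple mR)).
Variable m : 'I_k.+1 -> R.
Hypotheses (m0 : forall r, 0 < m r) (m1 : \sum_r m r = 1).
Variables (W : v.-tuple R -> R) (phi : v.-tuple 'I_k.+1 -> R).
Hypothesis iW : (leb ^\x v).-integrable D (EFin \o W).

Let G := Gfun W phi.

(** The nested sets [B e] of approximate solutions generate a filter; refining it to an ultrafilter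
    stands in for a convergent minimizing sequence. *)
Lemma coloring_family_limit (B : R -> set ('I_k.+1 -> R -> R)) :
  (forall e, 0 < e -> B e !=set0) -> (forall e, B e `<=` @fractional_coloring R k.+1) ->
  (forall e e', e <= e' -> B e `<=` B e') ->
  exists F : set_system ('I_k.+1 -> R -> R), exists f, [/\ ProperFilter F,
    forall e, 0 < e -> F (B e), fractional_coloring f & wcvg F f].
Proof.
move=> B0 Bc Bmono.
have FP : ProperFilter (filter_from [set e : R | 0 < e] B).
  apply: filter_from_proper; last by move=> e /= /B0.
  apply: filter_from_filter; first by exists 1 => /=.
  move=> e e' /= e0 e'0; exists (Num.min e e'); first by rewrite lt_min e0.
  by move=> g Bg; split; apply: Bmono Bg; rewrite ge_min lexx ?orbT.
have [F [FU sF]] := ultraFilterLemma FP.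
have FB e : 0 < e -> F (B e) by move=> e0; apply: sF; exists e.
have [f cf Ff] := coloring_compact FU (filterS (Bc 1) (FB 1 ltr01)).
by exists F, f; split => //; exact: ultra_proper.
Qed.

(** At a weak limit of approximate solutions [G] has the limiting value and the entropy can only
    drop. This gives both attainment in [rateJ] and the closedness of its level sets. *)
Lemma level_attained t a :
  (forall e, 0 < e -> exists g, [/\ fractional_coloring g, `|G g - t| <= e & relent m g <= a + e]) ->
  exists f, [/\ fractional_coloring f, G f = t & relent m f <= a].
Proof.
move=> H; pose B e := [set g | [/\ fractional_coloring g, `|G g - t| <= e & relent m g <= a + e]].
have [|||F [f [FP FB cf Ff]]] := @coloring_family_limit B.
- by move=> e e0; have [g gB] := H e e0; exists g.
- by move=> e g [].
- move=> e e' ee' g [cg gt ga]; split=> //; first exact: le_trans ee'.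
  by rewrite (le_trans ga)// lerD2l.
have FG : G g @[g --> F] --> G f by exact: wcvg_Gfun.
have Ft : G g @[g --> F] --> t.
  by apply/cvgrPdist_le => e e0; apply: filterS (FB e e0) => g [_ + _]; rewrite distrC.
exists f; split=> //; first exact: cvgr_unique FG Ft.
apply/ler_addgt0Pr => e e0; apply: (relent_lsc m0 m1 FP Ff cf).
by apply: filterS (FB e e0) => g [].
Qed.

Lemma const_coloring : fractional_coloring (fun r (_ : R) => m r).
Proof.
split=> [r|x _]; first exact: measurable_cst.
split=> [r|]; last exact: m1.
rewrite in_itv/= ltW//= -m1 (bigD1 r)//= lerDl sumr_ge0// => s _; exact: ltW.
Qed.

Lemma gibbs_attained (beta : R) : exists2 f, fractional_coloring f &
  forall g, fractional_coloring g -> beta * G g - relent m g <= beta * G f - relent m f.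
Proof.
have [C GC] := Gfun_bounded phi iW.
pose E := [set beta * G g - relent m g | g in @fractional_coloring R k.+1].
have E0 : E !=set0 by eexists; exists (fun r _ => m r); [exact: const_coloring|reflexivity].
have Eub g : fractional_coloring g -> beta * G g - relent m g <= `|beta| * C.
  move=> cg; have := relent_ge0 m0 m1 cg; have := GC g cg => GgC.
  have : beta * G g <= `|beta| * C.
    by rewrite (le_trans (ler_norm _))// normrM ler_wpM2l.
  lra.
have supE : has_sup E by split=> //; exists (`|beta| * C) => _ [g cg <-]; exact: Eub.
pose B e := [set g | fractional_coloring g /\ sup E - e <= beta * G g - relent m g].
have [|||F [f [FP FB cf Ff]]] := @coloring_family_limit B.
- move=> e e0; have [_ [g cg <-] sg] := sup_adherent e0 supE.
  by exists g; split=> //; exact: ltW.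
- by move=> e g [].
- by move=> e e' ee' g [cg gs]; split=> //; rewrite (le_trans _ gs)// lerD2l lerN2.
exists f => // g cg.
have : beta * G g - relent m g <= sup E by apply: sup_upper_bound => //; exists g.
move=> /le_trans; apply; apply/ler_addgt0Pr => e e0.
have e20 : 0 < e / 2 by rewrite divr_gt0.
have FG : beta * G g @[g --> F] --> beta * G f by apply: cvgMr; exact: wcvg_Gfun.
(* Near-maximality is rewritten as an upper bound on the entropy, to which lower semicontinuity
   applies. The continuity of G and the approximation of the supremum cost e / 2 each. *)
have : relent m f <= beta * G f + e - sup E; last by lra.
apply: (relent_lsc m0 m1 FP Ff cf).
move/cvgrPdist_le : FG => /(_ _ e20) FG.
apply: filterS (filterI FG (FB _ e20)) => h [+ [_ hs]] /=.
by rewrite ler_norml => /andP[? ?]; lra.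
Qed.

End variational.

Section rate_function.
Context {R : realType} {k v : nat}.
Local Notation leb := (@lebesgue_measure R).
Local Notation I01 := (`[0 : R, 1 : R]%classic).
Local Notation mR := (measurableTypeR R).
Local Notation D := (setpow I01 : set (v.-tuple mR)).
Variable mu : probability 'I_k.+1 R.
Hypothesis mu_gt0 : forall r, (0 < mu [set r])%E.
Variables (W : v.-tuple R -> R) (phi : v.-tuple 'I_k.+1 -> R).
Hypothesis iW : (leb ^\x v).-integrable D (EFin \o W).

Lemma color_weight_gt0 r : 0 < color_weight mu r.
Proof. by rewrite -lte_fin -mu_color. Qed.

Let m0 := color_weight_gt0.
Let m1 := sum_color_weight mu.

Lemma rateJ_le f : fractional_coloring f ->
  (rateJ mu W phi (Gfun W phi f) <= (relent (color_weight mu) f)%:E)%E.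
Proof. by move=> cf; apply: ereal_inf_lbound; exists f. Qed.

Lemma rateJ_lt t (a : R) : (rateJ mu W phi t < a%:E)%E ->
  exists f, [/\ fractional_coloring f, Gfun W phi f = t & relent (color_weight mu) f < a].
Proof.
move=> /ereal_inf_lt [_ [f [cf ft] <-]]; rewrite lte_fin => fa.
by exists f.
Qed.

(** An infimum at most [a] provides colorings of entropy below a + e for each e > 0;
    [level_attained] turns them into one of entropy at most [a]. *)
Lemma rateJ_leP t (a : R) : (rateJ mu W phi t <= a%:E)%E <->
  exists f, [/\ fractional_coloring f, Gfun W phi f = t & relent (color_weight mu) f <= a].
Proof.
split=> [ta|[f [cf <- fa]]]; last first.
  by apply: le_trans (rateJ_le cf) _; rewrite lee_fin.
apply: (level_attained m0 m1 iW) => e e0.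
have [|f [cf ft fa]] := @rateJ_lt t (a + e).
  by apply: le_lt_trans ta _; rewrite lte_fin ltrDl.
by exists f; split=> //; [rewrite ft subrr normr0 ltW|exact: ltW].
Qed.

Lemma rateJ_ge0 t : (0 <= rateJ mu W phi t)%E.
Proof.
apply/ereal_infP => _ [f [cf _] <-]; rewrite lee_fin.
exact: relent_ge0.
Qed.

Lemma rateJ_level_closed (a : R) : closed [set t | (rateJ mu W phi t <= a%:E)%E].
Proof.
move=> t clt; apply/rateJ_leP; apply: (level_attained m0 m1 iW) => e e0.
have [s [/= /rateJ_leP[f [cf fs fa]] ts]] := clt _ (nbhsx_ballx t e e0).
exists f; split=> //; last by rewrite (le_trans fa)// lerDl ltW.
by move: ts; rewrite fs /ball/= distrC => /ltW.
Qed.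

Lemma rateJ_good : good_rate_function (rateJ mu W phi).
Proof.
split; first exact: rateJ_ge0.
- apply/lower_semicontinuousP => a; rewrite -[X in open X]setCK; apply: closed_openC.
  rewrite (_ : ~` _ = [set t | (rateJ mu W phi t <= a%:E)%E]); first exact: rateJ_level_closed.
  by apply/seteqP; split=> t /=; rewrite leNgt => /negP.
- move=> a; have [C GC] := Gfun_bounded phi iW.
  (* A finite level consists of values of G, which are bounded uniformly over colorings. *)
  apply: (subclosed_compact (@rateJ_level_closed a) (@segment_compact R (- C) C)).
  move=> t /= /rateJ_leP[f [cf <- _]].
  by rewrite in_itv/= -ler_norml GC.
Qed.

End rate_function.

Section ereal_limits.
Context {R : realType}.
Local Open Scope ereal_scope.

(** Testing against real [a] allows the estimates to be made with real exponentials, although [b]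
    may be infinite. *)
Lemma limn_esup_le (u : (\bar R)^nat) (b : \bar R) :
  (forall a : R, b < a%:E -> \forall n \near \oo, u n <= a%:E) -> limn_esup u <= b.
Proof.
move=> H; have {}H a : b < a%:E -> limn_esup u <= a%:E.
  move=> /H ua; apply: (@le_trans _ _ (ereal_sup [set u n | n in [set n | u n <= a%:E]])).
    by apply: ereal_inf_lbound; exists [set n | u n <= a%:E].
  by apply: ge_ereal_sup => _ [n /= un <-].
case: b H => [r| |] H; last first.
(* If b = -oo, a finite limit superior s would be at most s - 1. *)
- case: (limn_esup u) H => [s| |] H //.
    have := H (s - 1)%R (ltNyr _); rewrite lee_fin => h.
    by exfalso; move: h; rewrite leNgt ltrBlDr ltrDl ltr01.
  by have := H 0%R (ltNyr _).
- exact: leey.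
- apply/lee_addgt0Pr => e e0; rewrite -EFinD; apply: H.
  by rewrite lte_fin ltrDl.
Qed.

Lemma limn_einf_ge (u : (\bar R)^nat) (b : \bar R) :
  (forall a : R, a%:E < b -> \forall n \near \oo, a%:E <= u n) -> b <= limn_einf u.
Proof.
move=> H; rewrite /limn_einf leeNr; apply: limn_esup_le => a ab.
have := H (- a)%R; rewrite EFinN lteNl => /(_ ab); apply: filterS => n.
by rewrite leeNl.
Qed.

Lemma scaled_lne_le n (p a : R) : (0 < n)%N -> (0 <= p)%R -> (p <= expR (n%:R * a))%R ->
  (n%:R^-1)%:E * lne p%:E <= a%:E.
Proof.
move=> n0; have n0' : (0 < n%:R :> R)%R by rewrite ltr0n.
rewrite le_eqVlt => /predU1P[<- _|p0 pa].
  (* For p = 0 the logarithm is -oo, and it stays so after scaling because n > 0. *)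
  by rewrite le0_lneNy// gt0_muleNy ?leNye// lte_fin invr_gt0.
rewrite lne_EFin// -EFinM lee_fin mulrC ler_pdivrMr// mulrC.
by rewrite -ler_expR lnK.
Qed.

Lemma scaled_lne_ge n (p a : R) : (0 < n)%N -> (expR (n%:R * a) <= p)%R ->
  a%:E <= (n%:R^-1)%:E * lne p%:E.
Proof.
move=> n0 ap; have n0' : (0 < n%:R :> R)%R by rewrite ltr0n.
have p0 : (0 < p)%R by rewrite (lt_le_trans (expR_gt0 _) ap).
rewrite lne_EFin// -EFinM lee_fin mulrC ler_pdivlMr// mulrC.
by rewrite -ler_expR lnK.
Qed.

End ereal_limits.

(** * Large deviation bounds and Laplace's method *)

Section large_deviation_principle.
Context {R : realType} {k v : nat}.
Local Notation leb := (@lebesgue_measure R).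
Local Notation I01 := (`[0 : R, 1 : R]%classic).
Local Notation mR := (measurableTypeR R).
Local Notation D := (setpow I01 : set (v.-tuple mR)).
Variable mu : probability 'I_k.+1 R.
Hypothesis mu_gt0 : forall r, (0 < mu [set r])%E.
Variables (phi : v.-tuple 'I_k.+1 -> R) (Q : forall n : nat, v.-tuple 'I_n -> R).
Arguments Q : clear implicits.
Variable W : v.-tuple R -> R.
Hypothesis iW : (leb ^\x v).-integrable D (EFin \o W).

Let G := Gfun W phi.
Let m := color_weight mu.
Let m0 : forall r, 0 < m r := color_weight_gt0 mu_gt0.
Let m1 : \sum_r m r = 1 := sum_color_weight mu.
Let p n (x : n.-tuple 'I_k.+1) : R := wprod (fun _ => m) x.
Let N n (x : n.-tuple 'I_k.+1) : R := Nstat (Q n) phi x.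

Hypothesis Napprox : forall e, 0 < e -> \forall n \near \oo,
  forall x : n.-tuple 'I_k.+1, `|N x - G (empirical x)| <= e.

Let p_ge0 n (x : n.-tuple 'I_k.+1) : 0 <= p x.
Proof. by apply: prodr_ge0 => i _; exact: ltW. Qed.

Let weak_nbhs_G f e : 0 < e -> fractional_coloring f ->
  weak_nbhs f [set g | `|G g - G f| <= e].
Proof.
move=> e0 cf F FU Ff.
have FG : G g @[g --> F] --> G f by exact: wcvg_Gfun.
by move/cvgrPdist_le : FG => /(_ _ e0); apply: filterS => g /=; rewrite distrC.
Qed.

Let sampling_G f e : 0 < e -> fractional_coloring f ->
  sampling_filter f [set g | `|G g - G f| <= e].
Proof.
move=> e0 cf; have FP := sampling_filter_proper cf.
have FG : G g @[g --> sampling_filter f] --> G f.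
  by apply: wcvg_Gfun => //; exact: wcvg_sampling.
have FF := sampling_filter_filter cf.
by move/cvgrPdist_le : FG => /(_ _ e0); apply: (@filterS _ _ FF) => g /=; rewrite distrC.
Qed.

(** Weights that vanish off the event reduce this to local bounds. If G f lies in [F], the entropy
    of [f] exceeds -a; otherwise, near [f], the statistic eventually avoids the closed set [F] and
    the weights are 0. *)
Lemma upper_bound_closed (F : set R) (a : R) : closed F ->
  (- ereal_inf [set rateJ mu W phi t | t in F] < a%:E)%E ->
  \forall n \near \oo, \sum_(x : n.-tuple 'I_k.+1 | `[< F (N x) >]) p x <= expR (n%:R * a).
Proof.
move=> cF Fa; pose wt n (x : n.-tuple 'I_k.+1) := if `[< F (N x) >] then p x else 0.
have wt0 n (x : n.-tuple 'I_k.+1) : 0 <= wt n x by rewrite /wt; case: ifP.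
suff : \forall n \near \oo, \sum_(x : n.-tuple 'I_k.+1) wt n x <= expR (n%:R * a).
  by apply: filterS => n; rewrite [X in _ -> X <= _]big_mkcond.
apply: (@local_to_global R k wt wt0) => f cf; have [FG|nFG] := pselect (F (G f)).
  have fa : - a < relent m f.
    have : (ereal_inf [set rateJ mu W phi t | t in F] <= rateJ mu W phi (G f))%E.
      by apply: ereal_inf_lbound; exists (G f).
    move=> /le_trans/(_ (rateJ_le mu W phi cf)) h.
    by rewrite -lte_fin (lt_le_trans _ h)// EFinN lteNl.
  (* Half of the gap between -a and the entropy, so that the local rate stays strictly below [a]. *)
  pose e := (relent m f + a) / 2; have e0 : 0 < e by rewrite divr_gt0//; lra.
  have [S Sf SE] := local_entropy_bound m0 m1 e0 cf.
  exists S, (- (relent m f - e)); split=> //; first by rewrite /e; lra.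
  near=> n.
  have n0 : (0 < n)%N by near: n; exact: nbhs_infty_gt.
  rewrite mulrN; apply: le_trans (SE n n0).
  by apply: ler_sum => x _; rewrite /wt; case: ifP => // _; exact: p_ge0.
have [/= e e0 eF] : exists2 e : R, 0 < e & forall s, `|s - G f| <= e -> ~ F s.
  have : nbhs (G f) (~` F) by apply: open_nbhs_nbhs; split=> //; exact: closed_openC.
  move=> /nbhs_ballP[e /= e0 eF]; exists (e / 2); first by rewrite divr_gt0.
  move=> s sG; apply: eF; rewrite /ball/= distrC (le_lt_trans sG)//.
  by rewrite ltr_pdivrMr// ltr_pMr// ltr1n.
have e20 : 0 < e / 2 by rewrite divr_gt0.
(* The local sum is eventually 0, so any rate below [a] would do. *)
exists [set g | `|G g - G f| <= e / 2], (a - 1); split.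
- by rewrite ltrBlDr ltrDl.
- exact: weak_nbhs_G.
- near=> n.
  have Nn : forall x : n.-tuple 'I_k.+1, `|N x - G (empirical x)| <= e / 2.
    by near: n; exact: Napprox.
  rewrite big1 ?expR_ge0// => x /asboolP/= Gx; rewrite /wt asboolF//; apply: eF.
  rewrite (_ : N x - G f = (N x - G (empirical x)) + (G (empirical x) - G f)); last by ring.
  by rewrite [leRHS]splitr (le_trans (ler_normD _ _))// lerD.
Unshelve. all: by end_near. Qed.

(** Choose [f] with G f in [U] and entropy below -a. As [U] is open, it contains the statistic of
    every coloring whose empirical G-value is close to G f, and sampling bounds the mass of
    these. *)
Lemma lower_bound_open (U : set R) (a : R) : open U ->
  (a%:E < - ereal_inf [set rateJ mu W phi t | t in U])%E ->
  \forall n \near \oo, expR (n%:R * a) <= \sum_(x : n.-tuple 'I_k.+1 | `[< U (N x) >]) p x.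
Proof.
move=> oU; rewrite lteNr => /ereal_inf_lt[_ [t Ut <-]].
rewrite -EFinN => /rateJ_lt[f [cf ft fa]].
have [/= e e0 eU] : exists2 e : R, 0 < e & forall s, `|s - G f| <= e -> U s.
  have : nbhs (G f) U by apply: open_nbhs_nbhs; split=> //; rewrite /G ft.
  move=> /nbhs_ballP[e /= e0 eU]; exists (e / 2); first by rewrite divr_gt0.
  move=> s sG; apply: eU; rewrite /ball/= distrC (le_lt_trans sG)//.
  by rewrite ltr_pdivrMr// ltr_pMr// ltr1n.
have e20 : 0 < e / 2 by rewrite divr_gt0.
(* With this slack the exponent given by [lower_bound] is exactly n * a. *)
have d0 : 0 < - a - relent m f by rewrite subr_gt0.
have LB := lower_bound cf m0 m1 (sampling_G e20 cf) d0.
near=> n.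
have Nn : forall x : n.-tuple 'I_k.+1, `|N x - G (empirical x)| <= e / 2.
  by near: n; exact: Napprox.
have lb : expR (- (n%:R * (relent m f + (- a - relent m f)))) <=
    \sum_(x : n.-tuple 'I_k.+1 | `[< `|G (empirical x) - G f| <= e / 2 >]) p x.
  by near: n; exact: LB.
move: lb; rewrite (_ : - (n%:R * _) = n%:R * a); last by ring.
move=> /le_trans; apply; rewrite big_mkcond [leRHS]big_mkcond/=; apply: ler_sum => x _.
case: ifPn => [/asboolP Gx|_]; last by case: ifP.
rewrite ifT//; apply/asboolP; apply: eU.
rewrite (_ : N x - G f = (N x - G (empirical x)) + (G (empirical x) - G f)); last by ring.
by rewrite [leRHS]splitr (le_trans (ler_normD _ _))// lerD.
Unshelve. all: by end_near. Qed.

Lemma ldp (law : nat -> set R -> \bar R) :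
  (forall n S, law n S = (\sum_(x : n.-tuple 'I_k.+1 | `[< S (N x) >]) p x)%:E) ->
  satisfies_LDP law (fun n => n%:R) (rateJ mu W phi).
Proof.
move=> lawE; split=> [F cF|U oU].
  apply: limn_esup_le => a /(upper_bound_closed cF) Fa.
  near=> n; rewrite lawE; apply: scaled_lne_le.
  - by near: n; exact: nbhs_infty_gt.
  - by apply: sumr_ge0 => x _.
  - by near: n.
apply: limn_einf_ge => a /(lower_bound_open oU) Ua.
near=> n; rewrite lawE; apply: scaled_lne_ge.
- by near: n; exact: nbhs_infty_gt.
- by near: n.
Unshelve. all: by end_near. Qed.

(** Near [f] the exponential weight is almost constant, so the local entropy bound multiplies it;
    [local_to_global] then removes the localization. *)
Lemma laplace_upper (beta M e : R) : 0 < e ->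
  (forall f, fractional_coloring f -> beta * G f - relent m f <= M) ->
  \forall n \near \oo,
    \sum_(x : n.-tuple 'I_k.+1) expR (n%:R * beta * N x) * p x <= expR (n%:R * (M + e)).
Proof.
move=> e0 gM.
apply: (@local_to_global R k (fun n x => expR (n%:R * beta * N x) * p x)).
  by move=> n x; rewrite mulr_ge0 ?expR_ge0.
(* The statistic is within 2 d of G f and the entropy bound loses d, for a total of c * d = e / 2.
   The other e / 2 makes the local rate strictly smaller than M + e. *)
move=> f cf; pose c := 2 * `|beta| + 1; have b0 : 0 <= `|beta| by [].
have c0 : 0 < c by rewrite /c; lra.
pose d := e / (2 * c); have d0 : 0 < d by rewrite divr_gt0// mulr_gt0.
have dc : c * d = e / 2 by rewrite /d; field; rewrite gt_eqF.
have [S Sf SE] := local_entropy_bound m0 m1 d0 cf.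
exists (S `&` [set g | `|G g - G f| <= d]), (M + e / 2); split.
- by rewrite ltrD2l gtr_pMr// invf_lt1// ltr1n.
- by apply: weak_nbhsI => //; exact: weak_nbhs_G.
near=> n.
have n0 : (0 < n)%N by near: n; exact: nbhs_infty_gt.
have Nn : forall x : n.-tuple 'I_k.+1, `|N x - G (empirical x)| <= d.
  by near: n; exact: Napprox.
pose t := n%:R * (beta * G f + 2 * `|beta| * d).
apply: (@le_trans _ _ (expR t * expR (- (n%:R * (relent m f - d))))); last first.
  rewrite -expRD ler_expR /t -mulrBr ler_wpM2l//.
  have := gM f cf; move: dc; rewrite /c mulrDl mul1r => dc ?.
  lra.
apply: (@le_trans _ _ (expR t * \sum_(x : n.-tuple 'I_k.+1 | `[< S (empirical x) >]) p x)); last first.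
  by rewrite ler_wpM2l ?expR_ge0//; exact: SE.
rewrite mulr_sumr big_mkcond [leRHS]big_mkcond/=; apply: ler_sum => x _.
case: ifPn => [/asboolP[Sx Gx]|_]; last by case: ifP => // _; rewrite mulr_ge0 ?expR_ge0.
rewrite ifT; last exact/asboolP.
apply: ler_wpM2r => //; rewrite ler_expR /t -[n%:R * beta * _]mulrA ler_wpM2l//.
have NG : `|N x - G f| <= 2 * d.
  rewrite (_ : N x - G f = (N x - G (empirical x)) + (G (empirical x) - G f)); last by ring.
  by rewrite (le_trans (ler_normD _ _))// mulr2n mulrDl mul1r lerD.
have : beta * (N x - G f) <= `|beta| * (2 * d).
  by rewrite (le_trans (ler_norm _))// normrM ler_wpM2l.
lra.
Unshelve. all: by end_near. Qed.

(** All terms are nonnegative, so it suffices to keep those whose empirical coloring has a G-value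
    close to that of [f]. *)
Lemma laplace_lower (beta e : R) f : 0 < e -> fractional_coloring f ->
  \forall n \near \oo, expR (n%:R * (beta * G f - relent m f - e)) <=
    \sum_(x : n.-tuple 'I_k.+1) expR (n%:R * beta * N x) * p x.
Proof.
(* The losses are again 2 d in the statistic and d in the entropy; here they may use all of e. *)
move=> e0 cf; pose c := 2 * `|beta| + 1; have b0 : 0 <= `|beta| by [].
have c0 : 0 < c by rewrite /c; lra.
pose d := e / c; have d0 : 0 < d by rewrite divr_gt0.
have dc : c * d = e by rewrite /d mulrC divfK// gt_eqF.
have LB := lower_bound cf m0 m1 (sampling_G d0 cf) d0.
near=> n.
have Nn : forall x : n.-tuple 'I_k.+1, `|N x - G (empirical x)| <= d.
  by near: n; exact: Napprox.
have lb : expR (- (n%:R * (relent m f + d))) <=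
    \sum_(x : n.-tuple 'I_k.+1 | `[< `|G (empirical x) - G f| <= d >]) p x.
  by near: n; exact: LB.
pose t := n%:R * (beta * G f - 2 * `|beta| * d).
apply: (@le_trans _ _ (expR t * expR (- (n%:R * (relent m f + d))))).
  rewrite -expRD ler_expR /t -mulrBr ler_wpM2l//.
  by move: dc; rewrite /c mulrDl mul1r => dc; lra.
apply: le_trans (ler_wpM2l (expR_ge0 t) lb) _.
rewrite mulr_sumr big_mkcond/=; apply: ler_sum => x _.
case: ifPn => [/asboolP Gx|_]; last by rewrite mulr_ge0 ?expR_ge0.
apply: ler_wpM2r => //; rewrite ler_expR /t -[n%:R * beta * _]mulrA ler_wpM2l//.
have NG : `|N x - G f| <= 2 * d.
  rewrite (_ : N x - G f = (N x - G (empirical x)) + (G (empirical x) - G f)); last by ring.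
  by rewrite (le_trans (ler_normD _ _))// mulr2n mulrDl mul1r lerD.
have : - (beta * (N x - G f)) <= `|beta| * (2 * d).
  by rewrite (le_trans (ler_norm _))// normrN normrM ler_wpM2l.
lra.
Unshelve. all: by end_near. Qed.

Lemma logZ_cvg beta f : fractional_coloring f ->
  (forall g, fractional_coloring g -> beta * G g - relent m g <= beta * G f - relent m f) ->
  (fun n => logZ (Q n) phi mu beta) @ \oo --> beta * G f - relent m f.
Proof.
move=> cf fmax; apply/cvgrPdist_le => e e0.
have UB := laplace_upper e0 fmax; have LB := laplace_lower beta e0 cf.
near=> n.
have n0 : (0 < n)%N by near: n; exact: nbhs_infty_gt.
have n0' : 0 < n%:R :> R by rewrite ltr0n.
have lb : expR (n%:R * (beta * G f - relent m f - e)) <=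
    \sum_(x : n.-tuple 'I_k.+1) expR (n%:R * beta * N x) * p x by near: n; exact: LB.
have ub : \sum_(x : n.-tuple 'I_k.+1) expR (n%:R * beta * N x) * p x <=
    expR (n%:R * (beta * G f - relent m f + e)) by near: n; exact: UB.
rewrite /logZ Rintegral_power_measure.
set s := \sum_(x : n.-tuple 'I_k.+1) _ in lb ub *.
have s0 : 0 < s by rewrite (lt_le_trans (expR_gt0 _) lb).
move: lb ub; rewrite -[X in X <= _ -> _]/(expR _) -{1 2}[s]lnK ?posrE// !ler_expR => lb ub.
rewrite -ler_pdivlMl// in lb; rewrite -ler_pdivrMl// in ub.
by rewrite ler_norml; apply/andP; split; move: lb ub; set z := _^-1 * ln s; lra.
Unshelve. all: by end_near. Qed.

End large_deviation_principle.

Theorem theorem2p2 (R : realType) (k v : nat) (v_ge2 : (2 <= v)%N)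
  (mu : probability 'I_k.+2 R) (mu_gt0 : forall r, (0 < mu [set r])%E)
  (phi : v.-tuple 'I_k.+2 -> R)
  (Q : forall n : nat, v.-tuple 'I_n -> R)
  (Q_sym : forall n, symmetric_tensor (Q n))
  (Q_diag : forall n, zero_diagonal (Q n))
  (W : v.-tuple R -> R) (W_kernel : kernel_space W)
  (Q_cvg : (fun n => cut_norm (fun x => step_kernel (Q n) x - W x))
             @ \oo --> 0%E) :
  ((forall (d : nat -> measure_display) (Om : forall n, measurableType (d n))
      (P : forall n, probability (Om n) R)
      (X : forall n, 'I_n -> {RV P n >-> 'I_k.+2}),
      (forall n, iid mu (X n)) ->
      satisfies_LDP
        (fun n => pushforward (P n)
           (fun w => Nstat (Q n) phi [tuple X n j w | j < n]))
        (fun n => n%:R) (rateJ mu W phi)) /\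
    good_rate_function (rateJ mu W phi)) /\
  (forall beta : R,
     let gibbs f := beta * Gfun W phi f - rel_entropy mu f in
     let M := ereal_sup [set (gibbs f)%:E | f in [set f | fractional_coloring f]]
     in (fun n => (logZ (Q n) phi mu beta)%:E) @ \oo --> M /\
     exists2 f, fractional_coloring f & (gibbs f)%:E = M).
Proof.
have iW := W_kernel.1; have v_gt0 : (0 < v)%N by exact: ltnW.
have Napprox := Nstat_approx v_gt0 phi Q_sym W_kernel Q_cvg.
split; [split|].
- move=> d Om P X iidX; apply: (ldp mu_gt0 iW Napprox) => n S.
  exact: (iid_law [set x | S (Nstat (Q n) phi x)] (iidX n)).
- exact: rateJ_good.
move=> beta gibbs M.
(* Attainment comes first: it identifies the extended supremum with a real number, to which the real
   limit converges. *)
have [f cf fmax] := gibbs_attained (color_weight_gt0 mu_gt0) (sum_color_weight mu) phi iW beta.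
have ME : (gibbs f)%:E = M.
  apply/le_anti/andP; split; first by apply: ereal_sup_ubound; exists f.
  by apply: ge_ereal_sup => _ [g cg <-]; rewrite lee_fin; exact: fmax.
split; last by exists f.
by rewrite -ME; apply: cvg_EFin; [exact: nearW|exact: logZ_cvg].
Qed.
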